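(* Let $1\leq p<\infty$, $0<\alpha<d$ and $\beta\in\mathbb{R}$ with $0\leq\alpha+\beta+1<d/p$, and let $\mathrm{M}_{\alpha,\beta}$ be either $\mathrm{M}^{c}_{\alpha,\beta}$ or $\mathrm{M}^{u}_{\alpha,\beta}$. Then there is a constant $C_{d,\alpha,\beta,p}$ depending only on $d,\alpha,\beta,p$ such that for all $f\in W^{1,p}(\mathbb{R}^d)$, \[ \|\mathrm{M}_{\alpha,\beta} f\|_{L^{(p^{-1}-(1+\alpha+\beta)/d)^{-1}}(\mathbb{R}^d)}\leq C_{d,\alpha,\beta,p}\|\nabla f\|_{L^p(\mathbb{R}^d)}. \] For $p=1$, the same holds for all $f\in\mathrm{BV}(\mathbb{R}^d)$ with $\|\nabla f\|_1$ replaced by $\operatorname{var} f$. The endpoint case $p=d/(1+\alpha+\beta)$ also holds, with the left-hand side being $\|\mathrm{M}_{\alpha,\beta}f\|_{L^\infty}$.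
   Context: For $f\in L^1_{\mathrm{loc}}(\mathbb{R}^d)$ and a ball $B$, $f_B=\frac1{|B|}\int_B|f|$ and $r(B)$ is the radius of $B$; $\overline{B}$ denotes the closure. The centered fractional maximal function is $\mathrm{M}^{c}_\alpha f(x)=\sup_{r>0}r^\alpha f_{B(x,r)}$ and the uncentered one is $\mathrm{M}^{u}_\alpha f(x)=\sup_{B\ni x}r(B)^\alpha f_B$ (supremum over balls containing $x$). Define $\mathcal{B}^c_\alpha(x)=\{B(x,r)\}$ where $r$ is the largest radius with $\mathrm{M}^c_\alpha f(x)=r^\alpha f_{B(x,r)}$, and $\mathcal{B}^u_\alpha(x)$ as the set of balls $B$ with $x\in\overline B$, $r(B)^\alpha f_B=\mathrm{M}^u_\alpha f(x)$, and $r(A)^\alpha f_A<\mathrm{M}^u_\alpha f(x)$ for every ball $A\supsetneq B$. (These sets are nonempty for a.e. $x$.) Let $\mathcal{B}^c_\alpha=\bigcup_x\mathcal{B}^c_\alpha(x)$, $\mathcal{B}^u_\alpha=\bigcup_x\mathcal{B}^u_\alpha(x)$, and for a.e. $x$ define $\mathrm{M}^c_{\alpha,\beta}f(x)=\sup_{B\in\mathcal{B}^c_\alpha:\,x\in\overline B}r(B)^{\alpha+\beta}f_B$ and $\mathrm{M}^u_{\alpha,\beta}f(x)=\sup_{B\in\mathcal{B}^u_\alpha:\,x\in\overline B}r(B)^{\alpha+\beta}f_B$ (in the centered case the supremum is over all balls of $\mathcal{B}^c_\alpha$ whose closure contains $x$, not only those centered at $x$). $\operatorname{var} f$ is the total variation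 of $f\in\mathrm{BV}(\mathbb{R}^d)$. *)

(* Defs.v *)
From HB Require Import structures.
From mathcomp Require Import all_boot all_order all_algebra.
From mathcomp Require Import all_classical all_reals all_analysis.
Set Implicit Arguments. Unset Strict Implicit. Unset Printing Implicit Defensive.
Import Order.TTheory GRing.Theory Num.Theory.
Import numFieldNormedType.Exports.
Local Open Scope classical_set_scope.
Local Open Scope ring_scope.

Definition enorm (R : realType) (d : nat) (x : 'rV[R]_d) : R :=
  Num.sqrt (\sum_(i < d) x ord0 i ^+ 2).

Definition eball (R : realType) (d : nat) (c : 'rV[R]_d) (r : R) : set 'rV[R]_d :=
  [set y | enorm (y - c) < r].

Definition box (R : realType) (d : nat) (a b : 'rV[R]_d) : set 'rV[R]_d :=
  [set x | forall i : 'I_d, a ord0 i <= x ord0 i < b ord0 i].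

Definition boxvol (R : realType) (d : nat) (a b : 'rV[R]_d) : R :=
  \prod_(i < d) Num.max (b ord0 i - a ord0 i) 0.

Definition lstar (R : realType) (d : nat) (A : set 'rV[R]_d) : \bar R :=
  ereal_inf [set (\sum_(k <oo) ((boxvol (ab k).1 (ab k).2)%:E))%E
            | ab in [set ab : nat -> 'rV[R]_d * 'rV[R]_d |
                      A `<=` \bigcup_k box (ab k).1 (ab k).2]].

Definition lmeasurable (R : realType) (d : nat) (A : set 'rV[R]_d) : Prop :=
  (@lstar R d).-caratheodory A.

Definition lmeasurable_fun (R : realType) (d : nat) (f : 'rV[R]_d -> R) : Prop :=
  forall t : R, lmeasurable [set x | t < f x].

(* Lebesgue integral over R^d of a nonnegative extended function,
   via the layer-cake formula  int u = int_0^oo |{u > t}| dt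
   (the t-integral is the 1-dimensional Lebesgue integral). *)
Definition integ (R : realType) (d : nat) (u : 'rV[R]_d -> \bar R) : \bar R :=
  (\int[@lebesgue_measure R]_(t in [set t : R | (0 < t)%R])
      lstar [set x | (t%:E < u x)%E])%E.

Definition integs (R : realType) (d : nat) (h : 'rV[R]_d -> R) : \bar R :=
  (integ (fun x => (Num.max (h x) 0)%:E) - integ (fun x => (Num.max (- h x) 0)%:E))%E.

Definition Lpnorm (R : realType) (d : nat) (p : R) (u : 'rV[R]_d -> \bar R) : \bar R :=
  ((integ (fun x => (`|u x| `^ p)%E)) `^ p^-1)%E.

Definition Linfnorm (R : realType) (d : nat) (u : 'rV[R]_d -> \bar R) : \bar R :=
  ereal_inf [set t%:E | t in [set t : R | lstar [set x | (t%:E < `|u x|)%E] = 0%E]].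

Definition evec (R : realType) (d : nat) (i : 'I_d) : 'rV[R]_d := delta_mx ord0 i.

Definition partial (R : realType) (d : nat) (i : 'I_d) (phi : 'rV[R]_d -> R) :
  'rV[R]_d -> R := fun x => 'D_(evec R i) phi x.

Fixpoint dpart (R : realType) (d : nat) (s : seq 'I_d) (phi : 'rV[R]_d -> R) :
  'rV[R]_d -> R :=
  match s with [::] => phi | i :: s' => partial i (dpart s' phi) end.

Definition smooth (R : realType) (d : nat) (phi : 'rV[R]_d -> R) : Prop :=
  forall s : seq 'I_d, continuous (dpart s phi) /\
    forall (i : 'I_d) (x : 'rV[R]_d), derivable (dpart s phi) x (evec R i).

Definition test_fun (R : realType) (d : nat) (phi : 'rV[R]_d -> R) : Prop :=
  smooth phi /\ exists r : R, forall x, r < enorm x -> phi x = 0.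

Definition gradnorm (R : realType) (d : nat) (g : 'I_d -> 'rV[R]_d -> R) :
  'rV[R]_d -> \bar R := fun x => (Num.sqrt (\sum_(i < d) g i x ^+ 2))%:E.

Definition W1p_grad (R : realType) (d : nat) (p : R) (f : 'rV[R]_d -> R)
    (g : 'I_d -> 'rV[R]_d -> R) : Prop :=
  [/\ lmeasurable_fun f, (Lpnorm p (fun x => (f x)%:E) < +oo)%E,
      forall i, lmeasurable_fun (g i),
      forall i, (Lpnorm p (fun x => (g i x)%:E) < +oo)%E &
      forall (i : 'I_d) (phi : 'rV[R]_d -> R), test_fun phi ->
        integs (fun x => f x * partial i phi x) = (- integs (fun x => (g i x * phi x)%R))%E].

Definition var (R : realType) (d : nat) (f : 'rV[R]_d -> R) : \bar R :=
  ereal_sup [set integs (fun x => f x * \sum_(i < d) partial i (phi i) x)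
            | phi in [set phi : 'I_d -> 'rV[R]_d -> R |
                      (forall i, test_fun (phi i)) /\
                      forall x, Num.sqrt (\sum_(i < d) phi i x ^+ 2) <= 1]].

Definition BV (R : realType) (d : nat) (f : 'rV[R]_d -> R) : Prop :=
  [/\ lmeasurable_fun f, (Lpnorm 1 (fun x => (f x)%:E) < +oo)%E & (var f < +oo)%E].

Definition avg (R : realType) (d : nat) (f : 'rV[R]_d -> R) (c : 'rV[R]_d) (r : R) : \bar R :=
  ((fine (lstar (eball c r)))^-1%:E *
     integ (fun y => (if `[< eball c r y >] then `|f y| else 0)%:E))%E.

Definition Mc (R : realType) (d : nat) (alpha : R) (f : 'rV[R]_d -> R) (x : 'rV[R]_d) : \bar R :=
  ereal_sup [set ((r `^ alpha)%:E * avg f x r)%E | r in [set r : R | 0 < r]].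

Definition Mu (R : realType) (d : nat) (alpha : R) (f : 'rV[R]_d -> R) (x : 'rV[R]_d) : \bar R :=
  ereal_sup [set ((cr.2 `^ alpha)%:E * avg f cr.1 cr.2)%E
            | cr in [set cr : 'rV[R]_d * R | 0 < cr.2 /\ eball cr.1 cr.2 x]].

Definition Bc (R : realType) (d : nat) (alpha : R) (f : 'rV[R]_d -> R) (x : 'rV[R]_d) :
  set ('rV[R]_d * R) :=
  [set cr | cr.1 = x /\ 0 < cr.2 /\
     ((cr.2 `^ alpha)%:E * avg f x cr.2)%E = Mc alpha f x /\
     forall r', 0 < r' -> ((r' `^ alpha)%:E * avg f x r')%E = Mc alpha f x -> r' <= cr.2].

Definition Bu (R : realType) (d : nat) (alpha : R) (f : 'rV[R]_d -> R) (x : 'rV[R]_d) :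
  set ('rV[R]_d * R) :=
  [set cr | 0 < cr.2 /\ closure (eball cr.1 cr.2) x /\
     ((cr.2 `^ alpha)%:E * avg f cr.1 cr.2)%E = Mu alpha f x /\
     forall ca : 'rV[R]_d * R, 0 < ca.2 -> eball cr.1 cr.2 `<` eball ca.1 ca.2 ->
       ((ca.2 `^ alpha)%:E * avg f ca.1 ca.2 < Mu alpha f x)%E].

(* centered = true : M^c_{alpha,beta};  centered = false : M^u_{alpha,beta}.
   The value 0 is added to the supremum (harmless: all candidates are
   nonnegative; it only fixes the value on the null set where no ball occurs). *)
Definition Mab (R : realType) (d : nat) (centered : bool) (alpha beta : R)
    (f : 'rV[R]_d -> R) (x : 'rV[R]_d) : \bar R :=
  let Bx := if centered then Bc alpha f else Bu alpha f in
  ereal_sup ([set 0%E] `|`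
    [set ((cr.2 `^ (alpha + beta))%:E * avg f cr.1 cr.2)%E
    | cr in [set cr | (exists y, Bx y cr) /\ closure (eball cr.1 cr.2) x]]).

(* Main.v *)
Require Import Defs.
From HB Require Import structures.
From mathcomp Require Import all_boot all_order all_algebra.
From mathcomp Require Import all_classical all_reals all_analysis.
From mathcomp Require Import measurable_realfun ring lra.
Set Implicit Arguments. Unset Strict Implicit. Unset Printing Implicit Defensive.
Import Order.TTheory GRing.Theory Num.Theory.
Import numFieldNormedType.Exports.
Local Open Scope classical_set_scope.
Local Open Scope ring_scope.

(** Write [S c r] for the mean of [|f|] over the cube with centre [c] and half side [r].
    A ball [B(c, r)] selected by the maximal function satisfies
    [S c R <= C (r / R)^alpha S c r] for all [R >= r], and nothing else about it is used: the
    averages of [f] drop by a large factor on a suitable dilate of the ball.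

    If [p > 1], the Poincare inequality on that dilate bounds [S c r] by [r] times a mean [a] of
    [|grad f|].  A Vitali selection among the balls with [2^l <= a < 2^(l+1)] leaves cubes that
    are disjoint for each [l]; only the points where [|grad f| > 2^(l-1)] matter, so a
    geometric series gives [sum 2^(l p) r^d <= C int |grad f|^p].

    If [p = 1], let the levels be [A^k <= S c r < A^(k+1)] with [A = 2^d], again with a Vitali
    selection.  Let [theta_m] cut [f] down to its values between [A^m] and [A^(m+1)], up to constants.
    The selected balls of level at most [m] have a radius function [rho_m], Lipschitz with a
    small constant, on whose scale the averages of [f] are below the cut, so [theta_m f] vanishes
    on a large part of every ball [B(x, L rho_m x)] and [int |theta_m f| / rho_m <= C int |grad (theta_m f)|].
    Intersecting selected balls of increasing level have geometrically decreasing radii, so the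
    weights [sum 1_B / r] over the levels at most [m] are bounded by [C / rho_m]; since the
    gradients of the [theta_m f] add up to at most [|grad f|], [sum A^k r^(d-1) <= C var f].

    The power [M_{alpha,beta}^q] is at most the sum over the selected balls of a power at least [1]
    of these quantities times [r^(-d)] on a dilate of the ball, and integrating this finishes the
    proof.  The endpoints need a single ball. *)

(** * The Lebesgue outer measure *)

(** At p = 1 the geometric series of the case p > 1 would have ratio 2^(p-1) = 1 and diverge, just
    as the maximal theorem fails on L^1. The way out is to charge to each level only the part of the
    gradient that lives on the corresponding values of f: the derivatives of the cut-offs have
    absolute values telescoping to at most 1, so no part of the gradient is counted twice. The ratio
    2^d of the levels is what makes radii of intersecting balls decay like 2^(-n) over n levels:
    optimality gives a d-th power of the ratio of the radii, or a power alpha <= d of it, and a root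
    is taken. A second obstacle is that f is known only through weak derivatives or its variation.
    The level sum is therefore proved for finitely many balls and a C1 function close to f in L^1;
    the closeness depends on the least radius, but the constant depends neither on it nor on the
    number of balls. Infinite families enter only at the end, by countability. *)

Section lstar.
Context {R : realType} {d' : nat}.
Local Notation d := d'.+1.
Implicit Types (a b x h : 'rV[R]_d) (A B : set 'rV[R]_d).

Lemma boxvol_ge0 a b : 0 <= boxvol a b.
Proof. by apply: prodr_ge0 => i _; rewrite le_max lexx orbT. Qed.

Lemma lstar_ge0 A : (0 <= lstar A)%E.
Proof.
apply: le_ereal_inf_tmp => _ [ab _ <-]; apply: nneseries_ge0 => n _ _.
by rewrite lee_fin boxvol_ge0.
Qed.

Lemma lstar_le_series A (ab : nat -> 'rV[R]_d * 'rV[R]_d) :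
  A `<=` \bigcup_k box (ab k).1 (ab k).2 ->
  (lstar A <= \sum_(k <oo) (boxvol (ab k).1 (ab k).2)%:E)%E.
Proof. by move=> Aab; apply: ereal_inf_lbound; exists ab. Qed.

Lemma le_lstar : {homo @lstar R d : A B / A `<=` B >-> (A <= B)%E}.
Proof.
move=> A B AB; apply: le_ereal_inf_tmp => _ [ab Bab <-].
by apply: lstar_le_series; apply: subset_trans Bab.
Qed.

Lemma boxvol_id a : boxvol a a = 0.
Proof.
by rewrite /boxvol (bigD1 ord0) //= subrr maxxx mul0r.
Qed.

Lemma lstar_box a b : (lstar (box a b) <= (boxvol a b)%:E)%E.
Proof.
pose ab m := if m is 0%N then (a, b) else (a, a).
apply: le_trans (@lstar_le_series _ ab _) _; first by move=> x abx; exists 0%N.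
rewrite nneseries_recl//=; last by move=> k _; rewrite lee_fin boxvol_ge0.
rewrite eseries0 ?adde0 // => -[//|k] _ _ /=.
by rewrite boxvol_id.
Qed.

Lemma lstar0 : lstar (@set0 'rV[R]_d) = 0%E.
Proof.
apply/eqP; rewrite eq_le lstar_ge0 andbT.
by apply: le_trans (le_lstar (@sub0set _ (box 0 0))) _; rewrite (le_trans (lstar_box _ _))// boxvol_id.
Qed.

Lemma lstar_subset_sigma_subadditive A F :
  subset_sigma_subadditive (@lstar R d) A F.
Proof.
move=> AF.
have [|noo] := eqVneq (\sum_(n <oo) lstar (F n))%E +oo%E; first by move=> ->; rewrite leey.
apply/lee_addgt0Pr => e e0.
have fin n : lstar (F n) \is a fin_num.
  rewrite ge0_fin_numE ?lstar_ge0 //.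
  apply: le_lt_trans (_ : _ < +oo)%E; last by rewrite ltey; exact: noo.
  rewrite (@nneseriesD1 _ _ n) //; last by move=> *; exact: lstar_ge0.
  by rewrite leeDl // nneseries_ge0 // => *; exact: lstar_ge0.
have pick n : {ab : nat -> 'rV[R]_d * 'rV[R]_d |
   F n `<=` \bigcup_k box (ab k).1 (ab k).2 /\
   (\sum_(k <oo) (boxvol (ab k).1 (ab k).2)%:E <= lstar (F n) + (e / (2 ^ n.+1)%:R)%:E)%E}.
  apply/cid.
  have e2 : 0 < e / (2 ^ n.+1)%:R by rewrite divr_gt0 // ltr0n expn_gt0.
  have [_ [ab abF <-] /ltW abe] := lb_ereal_inf_adherent e2 (fin n).
  by exists ab.
pose ab n := sval (pick n).
have /card_esym/ppcard_eqP[f] := card_nat2.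
pose abf k := let nk := f k in ab nk.1 nk.2.
apply: le_trans (@lstar_le_series _ abf _) _.
  move=> x /AF[n _ Fx]; have [/(_ _ Fx)[k _ kx] _] := svalP (pick n).
  exists (f^-1%FUN (n, k)) => //; rewrite /abf /= invK //=; exact: in_setT.
rewrite (_ : (\sum_(k <oo) (boxvol (abf k).1 (abf k).2)%:E)%E =
   (\sum_(n <oo) \sum_(k <oo) (boxvol (ab n k).1 (ab n k).2)%:E)%E); last first.
  rewrite nneseries_esum; last by move=> *; rewrite lee_fin boxvol_ge0.
  rewrite set_true.
  pose g (nk : nat * nat) := (boxvol (ab nk.1 nk.2).1 (ab nk.1 nk.2).2)%:E.
  rewrite [LHS](_ : _ = \esum_(k in [set: nat]) g (f k))%E //.
  have -> : (\esum_(k in [set: nat]) g (f k) = \esum_(nk in [set: nat * nat]) g nk)%E.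
    rewrite (reindex_esum [set: nat] setT f) //.
  rewrite (_ : [set: nat * nat] = setT `*`` (fun=> setT)); last first.
    by apply/seteqP; split.
  rewrite -(@esum_esum _ _ _ setT (fun=> setT) (fun n k => (boxvol (ab n k).1 (ab n k).2)%:E)) //; last first.
    by move=> *; rewrite lee_fin boxvol_ge0.
  rewrite nneseries_esum; last first.
    by move=> n _; apply: nneseries_ge0 => *; rewrite lee_fin boxvol_ge0.
  rewrite set_true; apply: eq_esum => n _.
  by rewrite nneseries_esum ?set_true // => *; rewrite lee_fin boxvol_ge0.
apply: (@le_trans _ _ (\sum_(n <oo) (lstar (F n) + (e / (2 ^ n.+1)%:R)%:E))%E).
  apply: lee_nneseries => [n _ _|n _].
    by apply: nneseries_ge0 => *; rewrite lee_fin boxvol_ge0.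
  by have [_] := svalP (pick n).
by rewrite epsilon_trick ?ltW// => n; exact: lstar_ge0.
Qed.

Lemma lstar_sigma_subadditive : sigma_subadditive (@lstar R d).
Proof. by move=> F; apply: lstar_subset_sigma_subadditive. Qed.

HB.instance Definition _ := isOuterMeasure.Build R 'rV[R]_d (@lstar R d)
  lstar0 lstar_ge0 le_lstar lstar_sigma_subadditive.

Definition half (i : 'I_d) (t : R) : set 'rV[R]_d := [set x | x ord0 i < t].

(** A hyperplane cuts a box into two boxes whose volumes add up, so cutting every box of a cover of
    the test set gives covers of both pieces with the same total volume. *)
Lemma half_measurable i t : lmeasurable (half i t).
Proof.
apply: le_caratheodory_measurable => X.
apply: le_ereal_inf_tmp => _ [ab Xab <-].
pose upd (a : 'rV[R]_d) s : 'rV[R]_d := \row_j if j == i then s else a ord0 j.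
pose ab1 k := ((ab k).1, upd (ab k).2 (Num.min ((ab k).2 ord0 i) t)).
pose ab2 k := (upd (ab k).1 (Num.max ((ab k).1 ord0 i) t), (ab k).2).
have E k : ((boxvol (ab k).1 (ab k).2)%:E =
  (boxvol (ab1 k).1 (ab1 k).2)%:E + (boxvol (ab2 k).1 (ab2 k).2)%:E)%E.
  rewrite -EFinD; congr (_%:E).
  rewrite /boxvol (bigD1 i) //= [X in _ = X + _](bigD1 i) //= [X in _ = _ + X](bigD1 i) //=.
  rewrite !mxE eqxx.
  under [X in _ = _ * X + _]eq_bigr => j ji do rewrite mxE (negbTE ji).
  under [X in _ = _ + _ * X]eq_bigr => j ji do rewrite mxE (negbTE ji).
  rewrite -mulrDl; congr (_ * _).
  set a := (ab k).1 ord0 i; set b := (ab k).2 ord0 i.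
  by case: (leP b t) => ?; case: (leP a t) => ?; rewrite /Order.max; do ![case: ltP => ?]; lra.
rewrite (eq_eseriesr (fun k _ => E k)) nneseriesD; last 2 first.
- by move=> k _ _; rewrite lee_fin boxvol_ge0.
- by move=> k _ _; rewrite lee_fin boxvol_ge0.
apply: leeD; apply: lstar_le_series => x [/Xab[k _ kx] xt]; exists k => //= j.
  rewrite mxE; case: eqP => [->|_]; last exact: kx.
  by have := kx i; rewrite lt_min => /andP[-> ->].
rewrite mxE; case: eqP => [->|_]; last exact: kx.
have := kx i; rewrite ge_max => /andP[-> ->] /=; rewrite andbT.
by move/negP: xt; rewrite -leNgt.
Qed.

Lemma lstar_affine_le (s : R) (h : 'rV[R]_d) A : 0 < s ->
  (lstar ((fun x => (s *: x + h)%R) @^-1` A) <= ((s ^- d)%:E) * lstar A)%E.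
Proof.
move=> s0.
have sd : 0 < s ^- d by rewrite invr_gt0 exprn_gt0.
rewrite -lee_pdivrMl // invrK.
apply: le_ereal_inf_tmp => _ [ab Aab <-].
pose f (a : 'rV[R]_d) := s^-1 *: (a - h).
pose ab' k := (f (ab k).1, f (ab k).2).
have E k : ((boxvol (ab k).1 (ab k).2)%:E = (s ^+ d)%:E * (boxvol (ab' k).1 (ab' k).2)%:E)%E.
  rewrite -EFinM; congr (_%:E); rewrite /boxvol.
  have -> : s ^+ d = \prod_(i < d) s by rewrite prodr_const card_ord.
  rewrite -big_split /=; apply: eq_bigr => i _.
  rewrite !mxE maxr_pMr ?ltW // mulr0; congr (Num.max _ _).
  by rewrite -mulrBr mulVKf ?gt_eqF//; ring.
rewrite (eq_eseriesr (fun k _ => E k)) nneseriesZl; last first.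
  by move=> k _; rewrite lee_fin boxvol_ge0.
apply: lee_wpmul2l; first by rewrite lee_fin exprn_ge0 // ltW.
apply: lstar_le_series => x Ax; have [k _ kx] := Aab _ Ax; exists k => //= i.
have := kx i; rewrite !mxE => /andP[k1 k2].
by rewrite ler_pdivrMl // ltr_pdivlMl // lerBlDr ltrBrDr k1.
Qed.

(** The inequality just proved, applied to the inverse map, gives the converse. *)
Lemma lstar_affine (s : R) (h : 'rV[R]_d) A : 0 < s ->
  (lstar ((fun x => (s *: x + h)%R) @^-1` A) = (s ^- d)%:E * lstar A)%E.
Proof.
move=> s0; apply/eqP; rewrite eq_le lstar_affine_le //=.
have sd : 0 < s ^- d by rewrite invr_gt0 exprn_gt0.
rewrite -lee_pdivlMl //.
have s1 : 0 < s^-1 by rewrite invr_gt0.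
have := @lstar_affine_le s^-1 (- (s^-1 *: h)) ((fun x => (s *: x + h)%R) @^-1` A) s1.
rewrite exprVn; apply: le_trans; apply: le_lstar => x Ax /=.
by rewrite scalerDr scalerN !scalerA mulfV ?gt_eqF// !scale1r subrK.
Qed.

End lstar.

(** The index is one less than the dimension. The measurable sets of this type are by definition
    those satisfying [lmeasurable], so the integration theory of [mu] applies to the functions of
    the statement. *)
Notation vec R n := (caratheodory_type (@lstar R n.+1)).

(** * Lebesgue measure as a Caratheodory measure *)

Section mu.
Context {R : realType} {d' : nat}.
Local Notation d := d'.+1.
Local Notation T := (vec R d').

Definition mu : set T -> \bar R := @lstar R d.
HB.instance Definition _ := isMeasure.Build _ T R mu
  (@caratheodory_measure0 _ _ (@lstar R d)) (@caratheodory_measure_ge0 _ _ (@lstar R d))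
  (@caratheodory_measure_sigma_additive _ _ (@lstar R d)).

Lemma muE (A : set T) : mu A = lstar A. Proof. by []. Qed.

End mu.

Lemma measurable_fun_gt {dd} {S : measurableType dd} {R : realType} (D : set S) (f : S -> R) :
  measurable D ->
  (forall t, measurable (D `&` [set x | t < f x])) -> measurable_fun D f.
Proof.
move=> mD H; apply: (measurability _ (RGenOInfty.measurableE R)) => //.
move=> _ [_ [t ->] <-]; have := H t; congr (measurable (D `&` _)).
by apply/seteqP; split => x /=; rewrite in_itv /= andbT.
Qed.

Section mu2.
Context {R : realType} {d' : nat}.
Local Notation d := d'.+1.
Local Notation T := (vec R d').

Lemma lmeasurable_funP (f : 'rV[R]_d -> R) :
  lmeasurable_fun f <-> measurable_fun setT (f : T -> R).
Proof.
split=> [mf|mf t]; first by apply: measurable_fun_gt => // t; rewrite setTI; exact: mf.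
have := @measurable_fun_ltr _ T R setT (cst t) f (@measurable_cst _ _ _ _ _ _) mf.
move=> /(_ measurableT [set true] I); rewrite setTI.
by congr (measurable _); apply/seteqP; split.
Qed.

Lemma measurable_coord (i : 'I_d) :
  measurable_fun setT (fun x : T => (x : 'rV[R]_d) ord0 i).
Proof.
have H : measurable_fun setT (fun x : T => - (x : 'rV[R]_d) ord0 i).
  apply: measurable_fun_gt => // t; rewrite setTI.
  rewrite (_ : [set x | _] = half i (- t)); first exact: half_measurable.
  by apply/seteqP; split => x /=; rewrite /half /=; rewrite ltrNr.
rewrite (_ : (fun x => _) = -%R \o (fun x : T => - (x : 'rV[R]_d) ord0 i)).
  exact: measurableT_comp.
by apply/funext => x /=; rewrite opprK.
Qed.

(** The norm of row vectors is the sup norm, so these are its open balls; scaling reduces their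
    measure to that of the unit cube. *)
Definition cube (c : 'rV[R]_d) (r : R) : set 'rV[R]_d := [set y | `|y - c| < r].

Lemma norm_ltP (x : 'rV[R]_d) r : 0 < r ->
  `|x| < r <-> forall i, `|x ord0 i| < r.
Proof.
move=> r0; rewrite /Num.norm /= mx_normrE; split.
  by move=> /bigmax_ltP[_ H] i; exact: (H (ord0, i)).
by move=> H; apply/bigmax_ltP; split => // -[i j] _; rewrite ord1; exact: H.
Qed.

Lemma norm_leP (x : 'rV[R]_d) r : 0 <= r ->
  `|x| <= r <-> forall i, `|x ord0 i| <= r.
Proof.
move=> r0; rewrite /Num.norm /= mx_normrE; split.
  by move=> /bigmax_leP[_ H] i; exact: (H (ord0, i)).
by move=> H; apply/bigmax_leP; split => // -[i j] _; rewrite ord1; exact: H.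
Qed.

Lemma coord_le_norm (x : 'rV[R]_d) i : `|x ord0 i| <= `|x|.
Proof. by move: i; apply/norm_leP. Qed.

Lemma ball_cube (c : 'rV[R]_d) r : ball c r = cube c r.
Proof. by apply/seteqP; split => y; rewrite -ball_normE /cube /= distrC. Qed.

Section coordinatewise.
Context {dd} {S : measurableType dd} (F : S -> 'rV[R]_d).
Hypothesis mF : forall i, measurable_fun setT (fun s => F s ord0 i).

Lemma measurable_preimage_cube c r : measurable (F @^-1` cube c r).
Proof.
have [r0|r0] := ltP 0 r; last first.
  rewrite (_ : _ @^-1` _ = set0) //; apply/seteqP; split => x //=.
  by rewrite /cube /= => /lt_le_trans/(_ r0); rewrite ltNge normr_ge0.
rewrite (_ : _ @^-1` _ = \bigcap_(i in [set: 'I_d])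
  ((fun s => `|F s ord0 i - c ord0 i|) @^-1` `]-oo, r[%classic)); last first.
  apply/seteqP; split => s /=.
    by move=> /norm_ltP H i _ /=; rewrite in_itv /=; have := H r0 i; rewrite !mxE.
  move=> H; apply/norm_ltP => // i; have := H i I.
  by rewrite /= in_itv /= !mxE.
apply: fin_bigcap_measurable => // i _.
rewrite -[X in measurable X]setTI.
have m1 : measurable_fun setT (fun s => `|F s ord0 i - c ord0 i|).
  apply: measurableT_comp => //; apply: measurable_funB => //.
exact: m1.
Qed.

(** An open set is a countable union of cubes with rational centres and radii 1 / (k + 1), and
    preimages of cubes are measurable coordinate by coordinate. The source is arbitrary because the
    lemma also serves for maps on products such as [T * T], with the product sigma-algebra. *)
Lemma measurable_preimage_open (A : set 'rV[R]_d) : open A -> measurable (F @^-1` A).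
Proof.
move=> oA.
pose q (u : 'rV[rat]_d * nat) : set 'rV[R]_d := cube (map_mx ratr u.1) u.2.+1%:R^-1.
have -> : A = \bigcup_(u in [set: 'rV[rat]_d * nat]) (if `[< q u `<=` A >] then q u else set0).
  apply/seteqP; split => [x Ax|x [u _]]; last by case: asboolP => // uA /uA.
  have /nbhs_ballP[e /= e0 xe] : nbhs x A by exact: open_nbhs_nbhs.
  have [k ke] : exists k : nat, 2 * k.+1%:R^-1 < e.
    exists (Num.bound (2 / e)); rewrite ltr_pdivrMr //.
    have := @archi_boundP _ (2 / e) (divr_ge0 (ler0n _ _) (ltW e0)).
    by rewrite ltr_pdivrMr // -natr1 => ?; lra.
  have H' i (u : R) : 0 < u -> exists y : rat, `|ratr y - x ord0 i| < u.
    move=> u0; have : x ord0 i - u < x ord0 i + u by lra.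
    move=> /rat_in_itvoo[y]; rewrite in_itv /= => /andP[y1 y2].
    by exists y; rewrite ltr_norml; apply/andP; split; lra.
  have H i : exists y : rat, `|ratr y - x ord0 i| < k.+1%:R^-1.
    by apply: H'; rewrite invr_gt0.
  pose y : 'rV[rat]_d := \row_i sval (cid (H i)).
  have yx : `|x - map_mx ratr y| < k.+1%:R^-1.
    apply/norm_ltP; first by rewrite invr_gt0.
    by move=> i; rewrite !mxE distrC; exact: (svalP (cid (H i))).
  exists (y, k) => //; case: asboolP => [_|[]]; first exact: yx.
  move=> z; rewrite /q /cube /= => zy; apply: xe; rewrite ball_cube /cube /=.
  rewrite (le_lt_trans (ler_distD (map_mx ratr y) _ _))//.
  by move: ke; rewrite mulr2n mulrDl !mul1r; apply: lt_trans; rewrite ltrD // distrC.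
rewrite preimage_bigcup; apply: countable_bigcupT_measurable.
  exact: countableP.
move=> u; case: asboolP => _; first exact: measurable_preimage_cube.
by rewrite preimage_set0.
Qed.

Lemma measurable_comp_continuous (f : 'rV[R]_d -> R) :
  continuous f -> measurable_fun setT (f \o F).
Proof.
move=> cf; apply: measurable_fun_gt => // t; rewrite setTI.
apply: (@measurable_preimage_open [set x | t < f x]).
rewrite (_ : [set x | _] = f @^-1` `]t, +oo[%classic); last first.
  by apply/seteqP; split => x /=; rewrite in_itv /= andbT.
apply: open_comp => [x _|]; first exact: cf.
exact: interval_open.
Qed.
End coordinatewise.

Lemma measurable_continuous (f : 'rV[R]_d -> R) :
  continuous f -> measurable_fun setT (f : T -> R).
Proof. exact: (measurable_comp_continuous measurable_coord). Qed.

Lemma measurable_cube c r : measurable (cube c r : set T).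
Proof. exact: (measurable_preimage_cube measurable_coord). Qed.

Lemma mu_affine (s : R) (h : 'rV[R]_d) (A : set T) : 0 < s ->
  (mu ((fun x : 'rV[R]_d => (s *: x + h)%R) @^-1` A) = (s ^- d)%:E * mu A)%E.
Proof. by move=> s0; rewrite !muE lstar_affine. Qed.

Lemma mu_cube_fin c r : (mu (cube c r : set T) < +oo)%E.
Proof.
rewrite muE.
apply: le_lt_trans (ltry (boxvol (\row_i (c ord0 i - r)) (\row_i (c ord0 i + r)))).
apply: le_trans (lstar_box _ _); apply: le_lstar => x.
rewrite /cube /= => xr i; rewrite !mxE.
have := le_lt_trans (coord_le_norm (x - c) i) xr.
by rewrite !mxE ltr_norml => /andP[? ?]; apply/andP; split; lra.
Qed.

(* Never computed: if it were [0], then so would be every [Lpnorm] and [Linfnorm], by [lstar_null]. *)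
Definition mu1 : R := fine (mu (cube 0 1 : set T)).

Lemma mu1_ge0 : 0 <= mu1.
Proof. by rewrite fine_ge0 // measure_ge0. Qed.

Lemma mu_cube c r : 0 < r -> mu (cube c r : set T) = (mu1 * r ^+ d)%:E.
Proof.
move=> r0; have r1 : 0 < r^-1 by rewrite invr_gt0.
have -> : cube c r = (fun x : 'rV[R]_d => r^-1 *: x + (- (r^-1 *: c))) @^-1` cube 0 1.
  apply/seteqP; split => x; rewrite /cube /= subr0 -scalerBr normrZ gtr0_norm //;
  by rewrite ltr_pdivrMl // mulr1.
rewrite mu_affine // exprVn invrK EFinM muleC fineK //.
by rewrite ge0_fin_numE ?measure_ge0 // mu_cube_fin.
Qed.

Lemma mu_sigma_finite : sigma_finite [set: T] (@mu R d').
Proof.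
exists (fun k => cube 0 k.+1%:R).
  apply/esym/seteqP; split => // x _; exists (Num.bound `|x|) => //.
  rewrite /cube /= subr0 (lt_trans (archi_boundP (normr_ge0 _))) //.
  by rewrite ltr_nat.
by move=> k; split; [exact: measurable_cube|exact: mu_cube_fin].
Qed.

HB.instance Definition _ := Measure_isSigmaFinite.Build _ T R mu mu_sigma_finite.

Lemma lstar_null (A : set 'rV[R]_d) : mu1 = 0 -> lstar A = 0%E.
Proof.
move=> v0; apply/eqP; rewrite eq_le lstar_ge0 andbT.
apply: (@le_trans _ _ (lstar (\bigcup_k (cube (0 : 'rV[R]_d) k.+1%:R)))).
  apply: le_lstar => x _; exists (Num.bound `|x|) => //.
  rewrite /cube /= subr0 (lt_trans (archi_boundP (normr_ge0 _))) //.
  by rewrite ltr_nat.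
apply: (le_trans (lstar_sigma_subadditive _)).
rewrite eseries0 // => k _ _; rewrite -muE mu_cube //.
by rewrite v0 mul0r.
Qed.

End mu2.

(** * Layer cake formula and affine changes of variables *)

Section integral_monotone.
Context {dd} {S : measurableType dd} {R : realType} (m : {measure set S -> \bar R}).

(** The integral of a nonnegative function is a supremum over the simple functions below it, and
    there are more of these below the larger function; this argument applies to arbitrary
    nonnegative integrands. *)
Lemma le_int (D : set S) (f g : S -> \bar R) :
  (forall x, D x -> 0 <= f x)%E -> (forall x, D x -> f x <= g x)%E ->
  (\int[m]_(x in D) f x <= \int[m]_(x in D) g x)%E.
Proof.
move=> f0 fg; rewrite ge0_integralE // [leRHS]ge0_integralE; last first.
  by move=> x Dx; apply: le_trans (fg _ Dx); exact: f0.
apply: ereal_sup_le => _ [h hf <-]; exists h => // x.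
apply: (le_trans (hf x)); rewrite /patch; case: ifPn => // xD.
by apply: fg; rewrite inE in xD.
Qed.

Lemma le_int_subset (A B : set S) (f : S -> \bar R) :
  (forall x, B x -> 0 <= f x)%E -> A `<=` B ->
  (\int[m]_(x in A) f x <= \int[m]_(x in B) f x)%E.
Proof.
move=> f0 AB; rewrite [leLHS]integral_mkcond [leRHS]integral_mkcond.
apply: le_int => x _; rewrite /patch.
  by case: ifPn => // /set_mem /AB /f0.
case: ifPn => [/set_mem xA|_]; first by rewrite mem_set //; exact: AB.
by case: ifPn => // /set_mem /f0.
Qed.
End integral_monotone.

Section layer_cake.
Context {R : realType} {d' : nat}.
Local Notation d := d'.+1.
Local Notation T := (vec R d').

Lemma lebesgue_subgraph (a : \bar R) : (0 <= a)%E ->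
  lebesgue_measure [set t : R | 0 < t /\ (t%:E < a)%E] = a.
Proof.
case: a => [r||]// r0.
  rewrite (_ : [set t | _] = `]0, r[%classic); last first.
    by apply/seteqP; split => t /=; rewrite in_itv /= lte_fin; [case=> -> ->|case/andP].
  rewrite lebesgue_measure_itv /= lte_fin; case: ltP => h; rewrite ?sube0 //.
  by apply/eqP; rewrite eq_sym eqe eq_le h andTb -lee_fin.
rewrite (_ : [set t | _] = `]0, +oo[%classic); last first.
  by apply/seteqP; split => t /=; rewrite in_itv /= ltry andbT //; case.
by rewrite lebesgue_measure_itv /= ltry.
Qed.

(** Tonelli for the indicator of the region under the graph: its sections over [x] have length
    [u x], its sections at height [t] are the superlevel sets measured by [integ]. *)
Lemma layer_cake (u : 'rV[R]_d -> \bar R) :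
  measurable_fun setT (u : T -> \bar R) -> (forall x, 0 <= u x)%E ->
  integ u = (\int[@mu R d']_x u x)%E.
Proof.
move=> mU u0.
pose A : set (T * measurableTypeR R) := [set z | 0 < z.2 /\ (z.2%:E < u z.1)%E].
have mA : measurable A.
  rewrite (_ : A = [set z : T * measurableTypeR R | (0%:E < z.2%:E)%E] `&` [set z : T * measurableTypeR R | (z.2%:E < u z.1)%E]).
    apply: measurableI; rewrite -[X in measurable X]setTI; apply: measurable_lte => //.
    - by apply/measurable_EFinP; exact: measurable_snd.
    - by apply/measurable_EFinP; exact: measurable_snd.
    - by apply: measurableT_comp => //; exact: measurable_fst.
  by apply/seteqP; split => z /=; rewrite lte_fin.
have mF : measurable_fun setT (fun z : T * measurableTypeR R => (\1_A z)%:E : \bar R).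
  by apply/measurable_EFinP; exact: measurable_indic.
have := @fubini_tonelli _ _ T (measurableTypeR R) R (@mu R d') (@lebesgue_measure R) (fun z => (\1_A z)%:E) mF.
move=> H.
rewrite (_ : (\int[mu]_x u x)%E = (\int[mu]_x \int[lebesgue_measure]_y (\1_A (x, y))%:E)%E); last first.
  apply: eq_integral => x _.
  rewrite (_ : (fun y => (\1_A (x, y))%:E) = (fun y => (\1_[set t : R | 0 < t /\ (t%:E < u x)%E] y)%:E)); last first.
    by apply/funext => y; rewrite !indicE; congr (_%:R%:E); apply/idP/idP; rewrite !inE.
  rewrite integral_indic // ?setIT; first exact/esym/lebesgue_subgraph.
  rewrite (_ : [set t | _] = xsection A x); first exact: measurable_xsection.
  by apply/seteqP; split => y; rewrite /xsection /= inE.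
rewrite H; last by move=> z; rewrite lee_fin.
rewrite /integ integral_mkcond; apply: eq_integral => t _.
rewrite /patch; case: ifPn => [/set_mem /= t0|]; last first.
  rewrite notin_setE /= => t0; rewrite integral0_eq // => x _.
  by rewrite indicE memNset // => -[].
rewrite (_ : (fun x => (\1_A (x, t))%:E) = (fun x => (\1_[set x : T | (t%:E < u x)%E] x)%:E)); last first.
  by apply/funext => y; rewrite !indicE; congr ((nat_of_bool _)%:R%:E); apply/idP/idP; rewrite !inE // => -[].
rewrite integral_indic // ?setIT // -[X in measurable X]setTI.
by apply: measurable_lte => //; exact: measurable_cst.
Qed.

Lemma le_integ (u w : 'rV[R]_d -> \bar R) : (forall x, u x <= w x)%E ->
  (integ u <= integ w)%E.
Proof.
move=> uw; apply: le_int => t /= t0; first exact: lstar_ge0.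
by apply: le_lstar => x /= /lt_le_trans; apply.
Qed.

(** Every test set [X] is the preimage of its image [Y], and [lstar] of a preimage is a fixed
    multiple of [lstar]; the Caratheodory condition for [A] at [Y] thus becomes the one for the
    preimage at [X]. *)
Lemma measurable_affine (s : R) (h : 'rV[R]_d) : 0 < s ->
  measurable_fun setT (fun x : T => (s *: (x : 'rV[R]_d) + h : T)).
Proof.
move=> s0 _ A mA; rewrite setTI.
apply: le_caratheodory_measurable => X.
pose g (y : 'rV[R]_d) := s^-1 *: y + (- (s^-1 *: h)).
have s1 : 0 < s^-1 by rewrite invr_gt0.
pose Y := g @^-1` X.
have K x : s *: g x + h = x by rewrite /g scalerDr scalerN !scalerA mulfV ?gt_eqF// !scale1r subrK.
have K' x : g (s *: x + h) = x by rewrite /g scalerDr !scalerA mulVf ?gt_eqF// scale1r addrK.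
have XE : X = (fun x => s *: x + h) @^-1` Y by apply/seteqP; split => x; rewrite /Y /= K'.

pose f (x : 'rV[R]_d) := s *: x + h.
have E (Z : set 'rV[R]_d) : lstar (f @^-1` Z) = ((s ^- d)%:E * lstar Z)%E.
  exact: lstar_affine.
change (lstar (X `&` f @^-1` A) + lstar (X `&` ~` (f @^-1` A)) <= lstar X)%E.
rewrite XE -/f (preimage_setC f A) -!preimage_setI !E [in leRHS](mA Y).
by rewrite ge0_muleDr //; exact: lstar_ge0.
Qed.

Lemma int_affine (F : T -> \bar R) (s : R) (h : 'rV[R]_d) : 0 < s ->
  measurable_fun setT F -> (forall x, 0 <= F x)%E ->
  (\int[@mu R d']_x F (s *: (x : 'rV[R]_d) + h)%R = (s ^- d)%:E * \int[@mu R d']_x F x)%E.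
Proof.
move=> s0 mF F0.
pose f (x : T) : T := s *: (x : 'rV[R]_d) + h.
have mf : measurable_fun setT f := measurable_affine h s0.
have sd : 0 <= s ^- d by rewrite invr_ge0 exprn_ge0 // ltW.
transitivity (\int[pushforward (@mu R d') f]_y F y)%E.
  by rewrite ge0_integral_pushforward.
rewrite -[RHS](@ge0_integral_mscale _ T R (@mu R d') setT measurableT (NngNum sd) F) //.
apply: eq_measure_integral => A mA _; rewrite /pushforward /mscale /=.
exact: mu_affine.
Qed.

Lemma int_translate (F : T -> \bar R) (h : 'rV[R]_d) :
  measurable_fun setT F -> (forall x, 0 <= F x)%E ->
  (\int[@mu R d']_x F ((x : 'rV[R]_d) + h)%R = \int[@mu R d']_x F x)%E.
Proof.
move=> mF F0; have := int_affine h ltr01 mF F0; rewrite expr1n invr1 mul1e => <-.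
by under [RHS]eq_integral do rewrite scale1r.
Qed.

End layer_cake.

(** * Vitali selection *)

Section vitali.
Context {R : realType} {I : Type} {T : Type} (B : I -> set T) (r : I -> R).

Definition meets (i j : I) := (B i `&` B j) !=set0.

(** The index set may be uncountable, so the greedy selection is replaced by Zorn's lemma. The
    constant 2 comes from picking a ball whose radius exceeds half a supremum. *)
Lemma vitali (D : set I) (M : R) :
  (forall i, D i -> 0 < r i) -> (forall i, D i -> r i <= M) ->
  (forall i, D i -> B i !=set0) ->
  exists V, [/\ V `<=` D, forall i j, V i -> V j -> meets i j -> i = j &
    forall i, D i -> exists j, [/\ V j, meets i j & r i <= 2 * r j]].
Proof.
move=> r0 rM B0.
(* Domination is required only of the balls that meet V, so that the empty family qualifies and
   unions of chains inherit it; a maximal V is then shown to meet every ball. *)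
pose P (V : set I) := [/\ V `<=` D, forall i j, V i -> V j -> meets i j -> i = j &
    forall i j0, D i -> V j0 -> meets i j0 -> exists j, [/\ V j, meets i j & r i <= 2 * r j]].
have [|V [[VD Vdisj VP] Vmax]] := @Zorn_bigcup I P.
  move=> F FP Ftot; split.
  - by move=> i [X /FP[XD _ _]] /XD.
  - move=> i j [X FX Xi] [Y FY Yj] ij.
    have [XY|YX] := Ftot _ _ FX FY.
      by have [_ H _] := FP _ FY; apply: H => //; exact: XY.
    by have [_ H _] := FP _ FX; apply: H => //; exact: YX.
  - move=> i j0 Di [X FX Xj0] ij0.
    have [_ _ /(_ i j0 Di Xj0 ij0)[j [Xj ij rij]]] := FP _ FX.
    by exists j; split => //; exists X.
exists V; split => // i Di; apply: contrapT => noj.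
(* The balls of D disjoint from all of V. If there are any, one with radius above half the supremum
   of their radii can be added to V, against maximality. *)
pose W := [set i | D i /\ forall j, V j -> ~ meets i j].
have Wi : W i.
  by split => // j Vj ij; apply: noj; exact: (VP i j).
pose s := sup [set r i | i in W].
have hs : has_sup [set r i | i in W].
  by split; [exists (r i), i|exists M => _ [k [Dk _] <-]; exact: rM].
have s0 : 0 < s.
  by apply: lt_le_trans (r0 _ Di) _; apply: ub_le_sup; [exact: hs.2|exists i].
have [_ [i0 [Di0 Wi0] <-] i0s] : exists2 x, [set r i | i in W] x & s / 2 < x.
  have := @sup_adherent _ _ (s / 2) (divr_gt0 s0 (ltr0n _ 2)) hs.
  by rewrite -/s => -[x Wx sx]; exists x => //; lra.
have Bsym k l : meets k l -> meets l k by rewrite /meets setIC.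
apply: (Vmax (V `|` [set i0])).
  split; first by move=> k Vk; left.
  move=> /(_ i0 (or_intror erefl)) Vi0.
  by apply: (Wi0 i0) => //; have [x Bx] := B0 _ Di0; exists x.
split.
- by move=> k [/VD//|->].
- move=> k l [Vk|->] [Vl|->] kl //; first exact: Vdisj.
    by exfalso; apply: (Wi0 _ Vk); exact: Bsym.
  by exfalso; apply: (Wi0 _ Vl).
- move=> k j0 Dk Vj0 kj0.
  have [[j [Vj kj]]|noV] := pselect (exists j, V j /\ meets k j).
    by have [j' [? ? ?]] := VP _ _ Dk Vj kj; exists j'; split => //; left.
  exists i0; split; [by right| |].
    by case: Vj0 => [Vj0|<-//]; case: noV; exists j0.
  suff : r k <= s by lra.
  apply: ub_le_sup; first exact: hs.2.
  by exists k => //; split => // j Vj kj; apply: noV; exists j.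
Qed.

(** One selection for each level: disjointness holds within a level only, and radii need to be
    bounded only level by level. *)
Lemma vitali_levels (D : set I) (lev : I -> int) :
  (forall i, D i -> 0 < r i) ->
  (forall l, exists M, forall i, D i -> lev i = l -> r i <= M) ->
  (forall i, D i -> B i !=set0) ->
  exists V, [/\ V `<=` D, forall i j, V i -> V j -> lev i = lev j -> meets i j -> i = j &
    forall i, D i -> exists j, [/\ V j, lev j = lev i, meets i j & r i <= 2 * r j]].
Proof.
move=> r0 rM B0.
have H l : {V | [/\ V `<=` [set i | D i /\ lev i = l], forall i j, V i -> V j -> meets i j -> i = j &
    forall i, D i /\ lev i = l -> exists j, [/\ V j, meets i j & r i <= 2 * r j]]}.
  apply/cid; have [M rMl] := rM l; apply: (@vitali _ M).
  - by move=> i [Di _]; exact: r0.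
  - by move=> i [Di li]; exact: rMl.
  - by move=> i [Di _]; exact: B0.
exists [set i | sval (H (lev i)) i]; split.
- by move=> i /=; have [VD _ _] := svalP (H (lev i)) => /VD[].
- move=> i j /= Vi Vj lij; rewrite -lij in Vj.
  by have [_ d _] := svalP (H (lev i)); exact: d.
- move=> i Di; have [VD _ /(_ i (conj Di erefl))[j [Vj ij rij]]] := svalP (H (lev i)).
  exists j; have [_ lj] := VD _ Vj; split => //=.
  by rewrite lj.
Qed.
End vitali.

(** Since the exponents are distinct, the sum is part of a geometric progression and is comparable
    to its largest possible term. *)
Lemma geo_sum {R : realFieldType} {I : eqType} (z : R) (s : seq I) (k : I -> nat) (K : nat) :
  1 < z -> uniq s -> {in s &, injective k} -> (forall i, i \in s -> (k i <= K)%N) ->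
  \sum_(i <- s) z ^+ k i <= z ^+ K.+1 / (z - 1).
Proof.
move=> z1 us ki kK.
rewrite -(big_map k xpredT (fun j => z ^+ j)).
have uks : uniq (map k s) by rewrite map_inj_in_uniq.
have kl j : j \in map k s -> j \in iota 0 K.+1.
  by case/mapP=> i /kK ? ->; rewrite mem_iota add0n ltnS.
have ul : uniq (iota 0 K.+1) by exact: iota_uniq.
apply: (@le_trans _ _ (\sum_(j <- iota 0 K.+1) z ^+ j)).
  move: kl ul; set l := iota 0 K.+1 => kl ul.
  rewrite [leRHS](bigID (mem (map k s))) /=.
  rewrite -[X in _ <= X + _]big_filter.
  rewrite (perm_big [seq i <- l | i \in map k s]); last first.
    apply: uniq_perm => //; first by rewrite filter_uniq.
    move=> j; rewrite mem_filter; case js : (j \in map k s) => //=.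
    by rewrite kl.
  by rewrite lerDl sumr_ge0 // => j _; rewrite exprn_ge0 // ltW // (lt_trans ltr01).
rewrite ler_pdivlMr ?subr_gt0 // mulrC.
have -> : iota 0 K.+1 = index_iota 0 K.+1 by rewrite /index_iota subn0.
by rewrite big_mkord -subrX1 gerBl.
Qed.

Lemma le_poweR {R : realType} (x y : \bar R) (q : R) :
  0 <= q -> (0 <= x)%E -> (x <= y)%E -> (x `^ q <= y `^ q)%E.
Proof.
move=> q0 x0 xy; apply: gt0_ler_poweR => //; rewrite in_itv /= leey andbT //.
exact: le_trans xy.
Qed.

(** * From sums over the selected balls to a bound on an integral *)

Section assembly.
Context {R : realType} {d' : nat}.
Local Notation d := d'.+1.
Local Notation T := (vec R d').
Local Notation V := ('rV[R]_d * R)%type.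

(** Only finitely many indices can have [w] above 1 / (n + 1). Countability is what allows the
    integral of a sum over all selected balls to be computed as a series. *)
Lemma finite_sums_countable {I : choiceType} (A : set I) (w : I -> R) (Y : R) :
  (forall i, A i -> 0 < w i) ->
  (forall s : seq I, uniq s -> {in s, forall i, A i} -> \sum_(i <- s) w i <= Y) ->
  countable A.
Proof.
move=> w0 wY.
rewrite (_ : A = \bigcup_(n in [set: nat]) [set i | A i /\ n.+1%:R^-1 < w i]).
  apply: bigcup_countable => // n _; apply: finite_set_countable.
  apply: contrapT => infA.
  have [F FA Fn] := infinite_set_fset (Num.bound (Y * n.+1%:R)).+1 infA.
  have := wY (finmap.enum_fset F) (finmap.fset_uniq F) (fun i iF => (FA i iF).1).
  apply/negP; rewrite -ltNge.
  apply: (@lt_le_trans _ _ (\sum_(i <- finmap.enum_fset F) n.+1%:R^-1)); last first.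
    by rewrite big_seq [leRHS]big_seq; apply: ler_sum => i iF; apply: ltW; have [] := FA i iF.
  rewrite big_const_seq count_predT iter_addr_0 -[X in _ < X]mulr_natl ltr_pdivlMr //.
  apply: (lt_le_trans (unstable.ltr_bound _)); rewrite ler_nat.
  by apply: leq_trans Fn.
apply/seteqP; split => [i Ai|i [n _ []]//]; have wi := w0 _ Ai.
exists (Num.bound (w i)^-1) => //; split => //=.
rewrite invf_plt ?posrE // (lt_trans (archi_boundP _)) ?invr_ge0 ?ltW//.
by rewrite ltr_nat.
Qed.

(** Values in [option] let one enumeration by all natural numbers serve for finite and empty sets
    too. *)
Lemma countable_enum {I : eqType} (A : set I) : countable A ->
  exists e : nat -> option I, [/\ forall n i, e n = Some i -> A i,
    forall i, A i -> exists n, e n = Some i &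
    forall n m i, e n = Some i -> e m = Some i -> n = m].
Proof.
move=> /countable_injP[f finj].
exists (fun n => if pselect (exists i, A i /\ f i = n) is left h then Some (sval (cid h)) else None).
split.
- move=> n i; case: pselect => // h [<-].
  by have [] := svalP (cid h).
- move=> i Ai; exists (f i); case: pselect => [h|[]]; last by exists i.
  congr Some; have [Ah fh] := svalP (cid h).
  by apply: finj; rewrite ?inE.
- move=> n m i; case: pselect => // h [<-]; case: pselect => // h' [E].
  have [_ <-] := svalP (cid h); have [_ <-] := svalP (cid h').
  by rewrite E.
Qed.

Lemma enum_sum_le {I : eqType} (A : set I) (w : I -> R) Y (e : nat -> option I) N :
  (forall n i, e n = Some i -> A i) ->
  (forall n m i, e n = Some i -> e m = Some i -> n = m) ->
  (forall s : seq I, uniq s -> {in s, forall i, A i} -> \sum_(i <- s) w i <= Y) ->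
  \sum_(n < N) oapp w 0 (e n) <= Y.
Proof.
move=> eA einj wY.
rewrite -(big_mkord xpredT (fun n => oapp w 0 (e n))).
have -> : \sum_(0 <= n < N) oapp w 0 (e n) = \sum_(i <- pmap e (index_iota 0 N)) w i.
  elim: (index_iota 0 N) => [|n s IH]; first by rewrite !big_nil.
  by rewrite big_cons /= IH; case: (e n) => [i|] /=; rewrite ?big_cons ?add0r.
apply: wY => [|i]; last by rewrite mem_pmap => /mapP[n _ /esym/eA].
have : uniq (index_iota 0 N) by exact: iota_uniq.
elim: (index_iota 0 N) => //= n s IH /andP[ns us].
case en : (e n) => [i|] /=; rewrite ?IH // andbT.
apply: contra ns; rewrite mem_pmap => /mapP[m ms /esym em].
by rewrite (einj _ _ _ en em).
Qed.

(** The power q of the supremum is at most the sum over the balls of B * w^s * r^(-d) on a dilate of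
    the ball. Integrating cancels r^(-d) against the volume and leaves the sum of the w^s, which is
    at most Y^s because s >= 1. *)
Lemma assembly (A : set V) (w : V -> R) (S : 'rV[R]_d -> set \bar R) (kap q s Y B : R) :
  0 < kap -> 1 <= s -> 0 < q -> 0 <= B -> 0 <= Y ->
  (forall v, A v -> 0 < v.2 /\ 0 < w v) ->
  (forall l : seq V, uniq l -> {in l, forall v, A v} -> \sum_(v <- l) w v <= Y) ->
  (forall x t, S x t -> t = 0%E \/
    exists v, [/\ A v, cube v.1 (kap * v.2) x & (0 <= t)%E /\ (t `^ q <= (B * w v `^ s * v.2 ^- d)%:E)%E]) ->
  (integ (fun x => `|ereal_sup ([set 0%E] `|` S x)| `^ q) <= (B * kap ^+ d * @mu1 R d' * Y `^ s)%:E)%E.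
Proof.
move=> kap0 s1 q0 B0 Y0 A0 wY HS.
have cA : countable A.
  by apply: (@finite_sums_countable _ _ w Y) => // v /A0[].
have [e [eA Ae einj]] := countable_enum cA.
pose g n (x : T) : R := oapp (fun v => B * w v `^ s * v.2 ^- d * \1_(cube v.1 (kap * v.2)) x) 0 (e n).
have w0 v : A v -> 0 <= w v by move=> /A0[_ /ltW].
have c0 v : A v -> 0 <= B * w v `^ s * v.2 ^- d.
  move=> Av; have [v0 _] := A0 _ Av.
  by rewrite !mulr_ge0 ?powR_ge0 // invr_ge0 exprn_ge0 // ltW.
have g0 n x : 0 <= g n x.
  by rewrite /g; case en : (e n) => [v|] //=; rewrite mulr_ge0 // c0 //; exact: eA en.
have mg n : measurable_fun setT (g n).
  rewrite /g; case: (e n) => [v|] /=; last exact: measurable_cst.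
  by apply: measurable_funM => //; apply: measurable_indic; exact: measurable_cube.
have mG : measurable_fun setT (fun x : T => \sum_(n <oo) (g n x)%:E)%E.
  apply: ge0_emeasurable_sum => [n x _ _|n _]; first by rewrite lee_fin.
  exact/measurable_EFinP.
apply: (@le_trans _ _ (integ (fun x : T => \sum_(n <oo) (g n x)%:E)%E)).
  apply: le_integ => x.
  have sup0 : (0 <= ereal_sup ([set 0%E] `|` S x))%E by apply: ereal_sup_ubound; left.
  have G0 : (0 <= \sum_(n <oo) (g n x)%:E)%E by apply: nneseries_ge0 => *; rewrite lee_fin.
  (* Taking the root of order q first reduces the bound on a power of the supremum to a bound on
     each of its elements. *)
  rewrite gee0_abs // -[leRHS]poweRe1 // -(mulVf (lt0r_neq0 q0)) poweRrM //.
  apply: le_poweR => //; first exact: ltW.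
  apply: ge_ereal_sup => t [->|/HS[->|[v [Av vx [t0 tq]]]]]; rewrite ?poweR_ge0 //.
  rewrite -[leLHS]poweRe1 // -(mulfV (lt0r_neq0 q0)) poweRrM //.
  apply: le_poweR; [by rewrite invr_ge0 ltW|exact: poweR_ge0|].
  apply: (le_trans tq); have [n en] := Ae _ Av.
  rewrite (@nneseriesD1 _ _ n) //; last by move=> *; rewrite lee_fin.
  rewrite (_ : (g n x)%:E = (B * w v `^ s * v.2 ^- d)%:E); last first.
    by rewrite /g en /= indicE mem_set // mulr1.
  by rewrite leeDl // nneseries_ge0 // => *; rewrite lee_fin.
rewrite layer_cake //; last by move=> x; apply: nneseries_ge0 => *; rewrite lee_fin.
rewrite (integral_nneseries _ measurableT); last 2 first.
- by move=> n; exact/measurable_EFinP.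
- by move=> n x _; rewrite lee_fin.
apply: lime_le; first by apply: is_cvg_nneseries => n _ _; apply: integral_ge0 => x _; rewrite lee_fin.
apply: nearW => N.
(* Each [w v] is at most [Y], so w^s <= Y^(s-1) * w, and one factor w is left to be summed. *)
pose C := B * kap ^+ d * @mu1 R d' * Y `^ (s - 1).
have C0 : 0 <= C by rewrite !mulr_ge0 ?powR_ge0 ?mu1_ge0 // exprn_ge0 // ltW.
apply: (@le_trans _ _ (\sum_(0 <= n < N) (C * oapp w 0 (e n))%:E)%E).
  apply: lee_sum => n _; rewrite /g; case en : (e n) => [v|] /=; last by rewrite integral0 mulr0.
  have Av := eA _ _ en; have [v0 wv0] := A0 _ Av.
  under eq_integral do rewrite EFinM.
  rewrite ge0_integralZl //; last 2 first.
  - by apply/measurable_EFinP; apply: measurable_indic; exact: measurable_cube.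
  - by rewrite lee_fin c0.
  rewrite integral_indic ?setIT //; last exact: measurable_cube.
  rewrite [X in (_ * X <= _)%E]mu_cube ?mulr_gt0 // -EFinM lee_fin.
  have wY1 : w v <= Y by have := wY [:: v] isT; rewrite big_seq1; apply=> u; rewrite inE => /eqP ->.
  rewrite -(mulr_powRB1 (w0 _ Av)) ?(lt_le_trans ltr01) // exprMn.
  rewrite [leLHS](_ : _ = B * kap ^+ d * @mu1 R d' * w v `^ (s - 1) * w v); last first.
    by field; rewrite expf_neq0 // gt_eqF.
  rewrite ler_wpM2r ?w0 // ler_wpM2l //; first by rewrite !mulr_ge0 ?mu1_ge0 // exprn_ge0 // ltW.
  by apply: ge0_ler_powR; rewrite ?nnegrE ?subr_ge0 // w0.
rewrite sumEFin lee_fin -mulr_sumr big_mkord -(mulr_powRB1 Y0) ?(lt_le_trans ltr01) //.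
rewrite [leRHS](_ : _ = C * Y); last by rewrite /C; ring.
by rewrite ler_wpM2l //; apply: (enum_sum_le _ _ _ wY).
Qed.
End assembly.

(** * A smooth bump and its convolutions *)

Section quadratic_derivative.
Context {R : realType} {V : normedModType R}.

(** A quadratic error bound is the form in which all derivatives below arise: for functions glued at
    a point as well as for integrals with a parameter. *)
Lemma is_derive_quadratic (f : V -> R) (x v : V) (df C : R) :
  (forall h : R, `|h| <= 1 -> `|f (h *: v + x) - f x - h * df| <= C * h ^+ 2) ->
  is_derive x v f df.
Proof.
move=> H.
have C0 : 0 <= C by have := H 1; rewrite normr1 lexx expr1n mulr1 => /(_ isT); apply: le_trans.
have cv : h^-1 *: (f (h *: v + x) - f x) @[h --> (0:R)^'] --> df.
  apply/cvgrPdist_le => /= e e0; near=> h.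
  have h0 : h != 0 by near: h; exact: nbhs_dnbhs_neq.
  have h1 : `|h| <= 1 by near: h; apply: dnbhs0_le.
  have he : `|h| <= e / (C + 1) by near: h; apply: dnbhs0_le; rewrite divr_gt0 // ltr_wpDl.
  rewrite distrC.
  rewrite (_ : _ - df = h^-1 * (f (h *: v + x) - f x - h * df)); last first.
    by rewrite /GRing.scale /= [RHS]mulrBr mulKf.
  rewrite normrM normfV ler_pdivrMl ?normr_gt0 //.
  apply: (le_trans (H h h1)).
  rewrite -(real_normK (num_real h)) expr2 mulrA [leRHS]mulrC ler_wpM2r //.
  move: he; rewrite ler_pdivlMr ?ltr_wpDl // => he.
  by apply: le_trans he; rewrite mulrC ler_wpM2l // lerDl.
by apply: DeriveDef; [apply/cvg_ex; exists df|apply/cvg_lim].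
Unshelve. all: by end_near. Qed.

Lemma continuous_at_lip (f : V -> R) (x : V) (L : R) : 0 <= L ->
  (forall y, `|y - x| <= 1 -> `|f y - f x| <= L * `|y - x|) -> {for x, continuous f}.
Proof.
move=> L0 H; apply/(@cvgrPdist_le _ _ _ (nbhs x)) => /= eps eps0.
near=> y.
have yx : `|x - y| <= Num.min 1 (eps / (L + 1)).
  near: y; apply: (@cvgr_dist_le _ _ _ (nbhs x) _ id x) => //.
  by rewrite lt_min ltr01 divr_gt0 // ltr_wpDl.
move: yx; rewrite le_min => /andP[y1].
rewrite ler_pdivlMr ?ltr_wpDl // => h.
rewrite distrC; apply: (le_trans (H y _)); first by rewrite distrC.
by apply: le_trans h; rewrite distrC mulrC ler_wpM2l // lerDl.
Unshelve. all: by end_near. Qed.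

End quadratic_derivative.

Section mono.
Context {R : realType}.

(* The derivatives of the bump [expR (- (1 - t)^-1) * expR (- (1 + t)^-1)] on [-1, 1] are the sums of
   terms [c * mono i (1 - t) * mono j (1 + t)] coded by lists of triples [(c, i, j)]. *)
Definition mono (n : nat) (t : R) : R :=
  if 0 < t then t^-1 ^+ n * expR (- t^-1) else 0.

Lemma mono_ge0 n t : 0 <= mono n t.
Proof.
rewrite /mono; case: ifP => // t0.
by rewrite mulr_ge0 ?expR_ge0 // exprn_ge0 // invr_ge0 ltW.
Qed.

Lemma expn_exp_le (n : nat) (x : R) : 0 <= x -> x ^+ n * expR (- x) <= n`!%:R.
Proof.
move=> x0; rewrite expRN ler_pdivrMr ?expR_gt0 //.
case: n => [|n]; first by rewrite expr0 fact0 mul1r -expR0 ler_expR.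
have := expR_ge1Dxn n x0.
rewrite -ler_pdivrMl ?ltr0n ?fact_gt0 // mulrC => h; apply: le_trans h.
by rewrite lerDr.
Qed.

Lemma mono_le n t : mono n t <= n`!%:R.
Proof.
rewrite /mono; case: ifP => // t0.
by apply: expn_exp_le; rewrite invr_ge0 ltW.
Qed.

(** The exponential absorbs two more powers of 1 / t. This quadratic flatness gives the derivative 0
    at the gluing point t = 0. *)
Lemma mono_le_sqr n t : mono n t <= n.+2`!%:R * t ^+ 2.
Proof.
rewrite /mono; case: ifP => t0; last by rewrite mulr_ge0 ?ler0n // sqr_ge0.
rewrite -ler_pdivrMr ?exprn_gt0 // mulrAC -exprVn -exprD addn2.
by apply: expn_exp_le; rewrite invr_ge0 ltW.
Qed.

Lemma is_derive_mono n (t : R) :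
  is_derive t 1 (mono n) (- n%:R * mono n.+1 t + mono n.+2 t).
Proof.
have [t0|t0|t0] := ltgtP t 0.
- rewrite /mono !ltNge (ltW t0) /=.
  apply: (@near_eq_is_derive _ _ _ (cst 0)); last first.
    rewrite mulr0 add0r; exact: is_derive_cst.
  near=> s; have s0 : s < 0 by near: s; exact: lt_nbhsl.
  by rewrite /cst ltNge (ltW s0).
- rewrite /mono t0.
  apply: (@near_eq_is_derive _ _ _ (fun s : R => s^-1 ^+ n * expR (- s^-1))).
    by near=> s; have -> : 0 < s by near: s; exact: lt_nbhsr.
  have tn0 : t != 0 by rewrite gt_eqF.
  have dV : is_derive t 1 (fun s : R => s^-1) (- t ^- 2).
    have := @is_deriveV R id t 1 1 tn0 (is_derive_id _ _); move/is_derive_eq; apply; rewrite /GRing.scale /= mulr1 //.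
  have dX : is_derive t 1 (fun s : R => s^-1 ^+ n) (n%:R * t^-1 ^+ n.-1 * (- t ^- 2)).
    have := @is_deriveX _ _ (fun s : R => s^-1) n t 1 _ dV; rewrite exprfctE; move/is_derive_eq; apply; rewrite /GRing.scale /= mulr_natl //.
  have dE : is_derive t 1 (fun s : R => expR (- s^-1)) (expR (- t^-1) * t ^- 2).
    have dN : is_derive t 1 (fun s : R => - s^-1) (t ^- 2).
      have := is_deriveN dV; move/is_derive_eq; apply; rewrite opprK //.
    exact: (is_derive1_comp (is_derive_expR _) dN).
  have := is_deriveM dX dE; move/is_derive_eq; apply; rewrite /GRing.scale /= //.
  rewrite -exprVn; case: n dX => [|n] dX /=; rewrite ?exprS; ring.
- rewrite t0 /mono ltxx mulr0 addr0 -/(mono n).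
  apply: (@is_derive_quadratic _ _ _ _ _ _ n.+2`!%:R) => h _.
  rewrite mulr0 subr0 {2}/mono ltxx subr0 /GRing.scale /= mulr1 addr0.
  by rewrite ger0_norm ?mono_ge0 // mono_le_sqr.
Unshelve. all: by end_near. Qed.

Definition term_val (a : R * nat * nat) (t : R) : R :=
  a.1.1 * (mono a.1.2 (1 - t) * mono a.2 (1 + t)).

Definition val_terms (l : seq (R * nat * nat)) (t : R) : R :=
  \sum_(a <- l) term_val a t.

(** The product rule, with -n * [mono (n+1)] + [mono (n+2)] for the derivative of [mono n]; the
    signs are reversed for the factor in 1 - t. *)
Definition der_term (a : R * nat * nat) : seq (R * nat * nat) :=
  [:: (a.1.1 * a.1.2%:R, a.1.2.+1, a.2); (- a.1.1, a.1.2.+2, a.2);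
      (- (a.1.1 * a.2%:R), a.1.2, a.2.+1); (a.1.1, a.1.2, a.2.+2)].

Definition der_terms l := flatten (map der_term l).

Lemma is_derive_val_terms l (t : R) :
  is_derive t 1 (val_terms l) (val_terms (der_terms l) t).
Proof.
elim: l => [|a l IH].
  rewrite /val_terms /der_terms /= big_nil.
  by under eq_fun do rewrite big_nil; exact: is_derive_cst.
have -> : val_terms (a :: l) = term_val a + val_terms l.
  by apply/funext => s; rewrite /val_terms big_cons fctE.
have -> : val_terms (der_terms (a :: l)) t = val_terms (der_term a) t + val_terms (der_terms l) t.
  by rewrite /val_terms -big_cat.
apply: is_deriveD.
have d1 : is_derive t 1 (fun s => mono a.1.2 (1 - s)) (a.1.2%:R * mono a.1.2.+1 (1 - t) - mono a.1.2.+2 (1 - t)).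
  have dB : is_derive t 1 (fun s : R => 1 - s) (-1).
    have := is_deriveB (is_derive_cst (1:R) t 1) (is_derive_id t 1); move/is_derive_eq; apply; rewrite sub0r //.
  have := @is_derive1_comp _ (mono a.1.2) (fun s : R => 1 - s) t _ _ (is_derive_mono a.1.2 (1 - t)) dB; move/is_derive_eq; apply; ring.
have d2 : is_derive t 1 (fun s => mono a.2 (1 + s)) (- a.2%:R * mono a.2.+1 (1 + t) + mono a.2.+2 (1 + t)).
  have dB : is_derive t 1 (fun s : R => 1 + s) 1.
    have := is_deriveD (is_derive_cst (1:R) t 1) (is_derive_id t 1); move/is_derive_eq; apply; rewrite add0r //.
  have := @is_derive1_comp _ (mono a.2) (fun s : R => 1 + s) t _ _ (is_derive_mono a.2 (1 + t)) dB; move/is_derive_eq; apply; ring.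
have := is_deriveZ a.1.1 (is_deriveM d1 d2); move/is_derive_eq; apply.
by rewrite /val_terms /der_term !big_cons big_nil /term_val /GRing.scale /=; ring.
Qed.

Lemma val_terms_out l t : 1 <= `|t| -> val_terms l t = 0.
Proof.
move=> t1; rewrite /val_terms big1 // => a _; rewrite /term_val /mono.
by move: t1; rewrite ler_normr; case: ltP => h1; case: ltP => h2; rewrite ?mulr0 ?mul0r ?mulr0 // => /orP[]; lra.
Qed.

Lemma val_terms_bound l : exists2 M, 0 <= M & forall t, `|val_terms l t| <= M.
Proof.
exists (\sum_(a <- l) `|a.1.1| * (a.1.2`!%:R * a.2`!%:R)).
  by apply: sumr_ge0 => a _; rewrite !mulr_ge0.
move=> t; apply: (le_trans (ler_norm_sum _ _ _)); apply: ler_sum => a _.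
rewrite /term_val normrM ler_wpM2l // ger0_norm ?mulr_ge0 ?mono_ge0 //.
by rewrite ler_pM ?mono_ge0 // mono_le.
Qed.

Definition sbump (k : nat) : R -> R := val_terms (iter k der_terms [:: (1, 0%N, 0%N)]).

Lemma is_derive_sbump k (t : R) : is_derive t 1 (sbump k) (sbump k.+1 t).
Proof. exact: is_derive_val_terms. Qed.

Lemma sbump_out k t : 1 <= `|t| -> sbump k t = 0.
Proof. exact: val_terms_out. Qed.

Lemma sbump0_ge0 t : 0 <= sbump 0 t.
Proof. by rewrite /sbump /val_terms big_seq1 /term_val /= mul1r mulr_ge0 ?mono_ge0. Qed.

Lemma sbump0_ge t : `|t| <= 1 / 2 -> expR (- 2) ^+ 2 <= sbump 0 t.
Proof.
rewrite ler_norml => /andP[t1 t2].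
rewrite /sbump /val_terms big_seq1 /term_val /= mul1r /mono !expr0 !mul1r.
rewrite !ifT; [|lra|lra].
by rewrite expr2 ler_pM ?expR_ge0 // ler_expR lerN2 invf_ple ?posrE //; lra.
Qed.

Lemma sbump_bound k : exists2 M, 0 <= M & forall t, `|sbump k t| <= M.
Proof. exact: val_terms_bound. Qed.
End mono.

Lemma mvt_between {R : realType} (f df : R -> R) (a b : R) :
  (forall s : R, is_derive s 1 f (df s)) ->
  exists2 c, `|c - a| <= `|b - a| & f b - f a = df c * (b - a).
Proof.
move=> H.
have cf x y : {within `[x, y], continuous f}.
  by apply: derivable_within_continuous => s _; have [] := H s.
have [ab|/ltW ba] := leP a b.
  have [c] := MVT_segment ab (fun s _ => H s) (cf a b).
  rewrite in_itv /= => /andP[ac cb] ->; exists c => //.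
  by rewrite !ger0_norm ?subr_ge0 // lerB.
have [c] := MVT_segment ba (fun s _ => H s) (cf b a).
rewrite in_itv /= => /andP[bc ca] E; exists c; last first.
  by rewrite -opprB E -mulrN opprB.
by rewrite distrC [leRHS]distrC !ger0_norm ?subr_ge0 // lerB.
Qed.

Section kernel.
Context {R : realType} {d' : nat}.
Local Notation d := d'.+1.
Local Notation T := (vec R d').
Implicit Types (k : 'I_d -> nat) (x u h : 'rV[R]_d) (e : R).

(* [e ^+ |k|] times the derivative of order [k] of the product bump of scale [e]. *)
Definition kern e k x : R := \prod_(i < d) sbump (k i) (x ord0 i / e).

Definition incr k (i : 'I_d) : 'I_d -> nat := fun j => (k j + (j == i))%N.

Lemma kern_out e k x : 0 < e -> e <= `|x| -> kern e k x = 0.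
Proof.
move=> e0 ex; have [i xi] : exists i, e <= `|x ord0 i|.
  apply: contrapT => /forallNP H; move: ex; rewrite leNgt => /negP; apply.
  by apply/norm_ltP => // i; rewrite ltNge; apply/negP.
rewrite /kern (bigD1 i) //= sbump_out ?mul0r //.
by rewrite normrM normfV (gtr0_norm e0) ler_pdivlMr // mul1r.
Qed.

Lemma kern_bound k : exists2 M, 0 <= M & forall e x, `|kern e k x| <= M.
Proof.
have H i : exists M, 0 <= M /\ forall t : R, `|sbump (k i) t| <= M.
  by have [M M0 HM] := @sbump_bound R (k i); exists M.
exists (\prod_(i < d) sval (cid (H i))).
  by apply: prodr_ge0 => i _; have [] := svalP (cid (H i)).
move=> e x; rewrite /kern normr_prod; apply: ler_prod => i _.
by rewrite normr_ge0 /=; have [_] := svalP (cid (H i)); apply.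
Qed.

Lemma is_derive_kern_line e k u h (t : R) :
  is_derive t 1 (fun t : R => kern e k (t *: h + u))
    (\sum_(i < d) h ord0 i / e * kern e (incr k i) (t *: h + u)).
Proof.
rewrite /kern; move: (index_enum_uniq 'I_d); elim: (index_enum _) => [|a s IH].
  move=> _; under eq_fun do rewrite big_nil.
  by rewrite big_nil; exact: is_derive_cst.
move=> /= /andP[aNs us].
under eq_fun do rewrite big_cons.
have da : is_derive t 1 (fun t : R => sbump (k a) ((t *: h + u) ord0 a / e))
    (h ord0 a / e * sbump (k a).+1 ((t *: h + u) ord0 a / e)).
  have dl : is_derive t 1 (fun t : R => (t *: h + u) ord0 a / e) (h ord0 a / e).
    have := is_deriveD (is_deriveZ (h ord0 a / e) (is_derive_id t (1:R))) (is_derive_cst (u ord0 a / e) t 1).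
    rewrite (_ : _ + _ = (fun t : R => (t *: h + u) ord0 a / e)); last first.
      by apply/funext => r; rewrite /= !mxE !fctE /= /GRing.scale /= mulrDl; ring.
    by move=> /is_derive_eq; apply; rewrite addr0 /GRing.scale /= mulr1.
  have := @is_derive1_comp _ (sbump (k a)) _ t _ _ (is_derive_sbump (k a) _) dl.
  by move=> /is_derive_eq; apply; rewrite mulrC.
have := is_deriveM da (IH us); move=> /is_derive_eq; apply.
rewrite !big_cons /GRing.scale /= addrC; congr (_ + _).
  rewrite /incr eqxx addn1 -!mulrA mulrC -!mulrA; congr (_ * (_ * _)).
  congr (_ * _); apply: eq_big_seq => j js.
  by case: eqP => [ja|_]; [rewrite -ja js in aNs|rewrite addn0].
rewrite mulr_sumr; apply: eq_big_seq => i is'.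
rewrite big_cons /incr; case: eqP => [ia|_]; first by rewrite ia is' in aNs.
by rewrite addn0; ring.
Qed.

Lemma norm_sum_coord_le (c : 'I_d -> R) (h : 'rV[R]_d) (M : R) :
  (forall i, `|c i| <= M) -> `|\sum_(i < d) h ord0 i * c i| <= d%:R * M * `|h|.
Proof.
move=> cM; apply: (le_trans (ler_norm_sum _ _ _)).
apply: (@le_trans _ _ (\sum_(i < d) (`|h| * M))).
  by apply: ler_sum => i _; rewrite normrM ler_pM // coord_le_norm.
by rewrite sumr_const card_ord -mulr_natl; lra.
Qed.

Lemma kern_lip e k : 0 < e ->
  exists2 L, 0 <= L & forall u u', `|kern e k u' - kern e k u| <= L * `|u' - u|.
Proof.
move=> e0.
have H i : exists M, 0 <= M /\ forall x, `|kern e (incr k i) x| <= M.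
  by have [M M0 HM] := kern_bound (incr k i); exists M.
pose M := \sum_i sval (cid (H i)).
have HM i x : `|e^-1 * kern e (incr k i) x| <= e^-1 * M.
  rewrite normrM normfV (gtr0_norm e0) ler_wpM2l ?invr_ge0 ?(ltW e0)//.
  have [_ /(_ x) h] := svalP (cid (H i)); apply: (le_trans h).
  rewrite /M (bigD1 i) //= lerDl sumr_ge0 // => j _.
  by have [] := svalP (cid (H j)).
have M0 : 0 <= e^-1 * M by apply: le_trans (HM ord0 0).
exists (d%:R * (e^-1 * M)); first by rewrite mulr_ge0.
move=> u u'.
have [c _] := mvt_between 0 1 (is_derive_kern_line e k u (u' - u)).
rewrite scale1r subrK scale0r add0r subr0 mulr1 => ->.
under eq_bigr do rewrite -mulrA.
exact: norm_sum_coord_le.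
Qed.

Lemma kern_continuous e k : 0 < e -> continuous (kern e k).
Proof.
move=> e0 x; have [L L0 HL] := kern_lip k e0.
by apply: (continuous_at_lip L0) => y _; exact: HL.
Qed.

(** The constant is uniform in [u]; this is what permits differentiation of convolutions under the
    integral. *)
Lemma kern_taylor e k h : 0 < e ->
  exists2 C, 0 <= C & forall u (t : R),
  `|kern e k (t *: h + u) - kern e k u -
     t * \sum_(i < d) h ord0 i / e * kern e (incr k i) u| <= C * t ^+ 2.
Proof.
move=> e0.
have H i : exists L, 0 <= L /\ forall u u', `|kern e (incr k i) u' - kern e (incr k i) u| <= L * `|u' - u|.
  by have [L ? ?] := kern_lip (incr k i) e0; exists L.
pose L i := sval (cid (H i)).
have L0 i : 0 <= L i by have [] := svalP (cid (H i)).
exists (\sum_i `|h ord0 i / e| * (L i * `|h|)).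
  by apply: sumr_ge0 => i _; rewrite !mulr_ge0.
move=> u t.
have [c] := mvt_between 0 t (is_derive_kern_line e k u h).
rewrite !subr0 scale0r add0r => ct ->.
rewrite [t * _]mulrC -mulrBl -sumrB normrM expr2.
rewrite -[t * t]/(t ^+ 2) -(real_normK (num_real t)) expr2 mulrA ler_wpM2r //.
rewrite mulr_suml; apply: (le_trans (ler_norm_sum _ _ _)); apply: ler_sum => i _.
rewrite -mulrBr normrM -!mulrA ler_wpM2l //.
have [_ /(_ u (c *: h + u)) HL] := svalP (cid (H i)).
rewrite addrK normrZ in HL; apply: (le_trans HL).
by rewrite -/(L i) ler_wpM2l // mulrC ler_wpM2l.
Qed.

Lemma kern0_ge0 e x : 0 <= kern e (fun=> 0%N) x.
Proof. by apply: prodr_ge0 => i _; exact: sbump0_ge0. Qed.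

Lemma kern0_ge e x : 0 < e -> `|x| < e / 2 ->
  (expR (- 2) ^+ 2) ^+ d <= kern e (fun=> 0%N) x.
Proof.
move=> e0 xe; rewrite -[X in _ ^+ X]card_ord -prodr_const /kern.
apply: ler_prod => i _; rewrite exprn_ge0 ?expR_ge0 //=; apply: sbump0_ge.
rewrite normrM normfV (gtr0_norm e0) ler_pdivrMr // mulrAC mul1r.
by rewrite mulrC (le_trans (coord_le_norm x i)) // ltW // mulrC.
Qed.
End kernel.

(* The stock [done] is very slow on failure for goals [measurable_fun _ _] over [vec R d]. *)
Ltac full_done :=
  trivial; hnf; intros; solve
   [ do ![solve [trivial | simple refine (@sym_equal _ _ _ _); trivial]
         | discriminate | contradiction | split]
   | match goal with H : ~ _ |- _ => solve [case H; trivial] end ].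
Ltac done ::=
  intros; lazymatch goal with
  | |- measurable_fun _ (fun=> ?c) => exact: measurable_cst
  | |- measurable_fun _ (cst _) => exact: measurable_cst
  | |- measurable_fun _ (@Num.norm _ _) => exact: normr_measurable
  | |- measurable_fun _ abse => exact: abse_measurable
  | |- measurable_fun _ EFin => exact: EFin_measurable
  | |- measurable_fun _ _ => assumption
  | |- _ => full_done
  end.

Section Rintegral_sum.
Context {dd} {S : measurableType dd} {R : realType} (m : {measure set S -> \bar R}).

Lemma integrable_EFinB (f g : S -> R) : m.-integrable setT (EFin \o f) ->
  m.-integrable setT (EFin \o g) -> m.-integrable setT (EFin \o (fun x => f x - g x)).
Proof. by move=> If Ig; have := integrableB measurableT If Ig; apply: eq_integrable. Qed.

Lemma integrable_EFinD (f g : S -> R) : m.-integrable setT (EFin \o f) ->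
  m.-integrable setT (EFin \o g) -> m.-integrable setT (EFin \o (fun x => f x + g x)).
Proof. by move=> If Ig; have := integrableD measurableT If Ig; apply: eq_integrable. Qed.

Lemma integrable_EFinZ (f : S -> R) (c : R) : m.-integrable setT (EFin \o f) ->
  m.-integrable setT (EFin \o (fun x => c * f x)).
Proof. by move=> If; have := integrableZl measurableT c If; apply: eq_integrable. Qed.

Lemma integrable_fin_sum (I : Type) (s : seq I) (f : I -> S -> R) :
  (forall i, m.-integrable setT (EFin \o f i)) ->
  m.-integrable setT (EFin \o (fun x => \sum_(i <- s) f i x)).
Proof.
move=> If; have := @integrable_sum _ S R m setT measurableT _ s xpredT _ (fun i _ => If i).
by rewrite /comp; under eq_fun do rewrite sumEFin.
Qed.

Lemma Rintegral_sum (I : Type) (s : seq I) (f : I -> S -> R) :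
  (forall i, m.-integrable setT (EFin \o f i)) ->
  \int[m]_x (\sum_(i <- s) f i x) = \sum_(i <- s) \int[m]_x f i x.
Proof.
move=> If; elim: s => [|i s IH].
  by rewrite big_nil; under eq_Rintegral do rewrite big_nil; rewrite Rintegral_cst // mul0r.
rewrite big_cons -IH -RintegralD //; last exact: integrable_fin_sum.
by apply: eq_Rintegral => x _; rewrite big_cons.
Qed.
End Rintegral_sum.

(** * Convolution of locally integrable functions with the bump *)

Section locint.
Context {R : realType} {d' : nat}.
Local Notation d := d'.+1.
Local Notation T := (vec R d').

Definition locint (F : 'rV[R]_d -> R) := measurable_fun setT (F : T -> R) /\
  forall r, (\int[@mu R d']_(y in cube 0 r) `|(F y)%:E| < +oo)%E.

Definition massin (F : 'rV[R]_d -> R) r : R :=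
  fine (\int[@mu R d']_(y in cube 0 r) `|(F y)%:E|)%E.

Lemma massin_ge0 F r : 0 <= massin F r.
Proof. by rewrite fine_ge0 // integral_ge0. Qed.

Lemma massinE F r : locint F ->
  (massin F r)%:E = (\int[@mu R d']_(y in cube 0 r) `|(F y)%:E|)%E.
Proof.
by move=> [_ F1]; rewrite fineK // ge0_fin_numE ?F1 // integral_ge0.
Qed.

Lemma locint_bounded_mul F (psi : 'rV[R]_d -> R) (B r : R) :
  locint F -> measurable_fun setT (psi : T -> R) ->
  (forall y, `|psi y| <= B) -> (forall y, r <= `|y| -> psi y = 0) ->
  (@mu R d').-integrable setT (fun y : T => (F y * psi y)%:E) /\
  `|\int[@mu R d']_y (F y * psi y)| <= B * massin F r.
Proof.
move=> lF mpsi psiB psi0; have [mF _] := lF.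
have B0 : 0 <= B by apply: le_trans (psiB 0).
have mabs : measurable_fun setT (fun y : T => `|(F y)%:E|%E : \bar R).
  by apply: measurableT_comp => //; exact/measurable_EFinP.
have H : (\int[@mu R d']_y `|(F y * psi y)%:E| <= (B * massin F r)%:E)%E.
  rewrite EFinM massinE // -ge0_integralZl //; last 2 first.
  - exact: measurable_cube.
  - exact: measurable_funS mabs.
  rewrite [leRHS]integral_mkcond; apply: le_int => y _ //.
  rewrite /patch; case: ifPn => [_|yr].
    by rewrite -EFinM lee_fin normrM mulrC ler_wpM2r.
  rewrite psi0 ?mulr0 ?abse0 // leNgt; apply: contra yr => yr.
  by rewrite inE /cube /= subr0.
have I : (@mu R d').-integrable setT (fun y : T => (F y * psi y)%:E).
  apply/integrableP; split; first by apply/measurable_EFinP; exact: measurable_funM.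
  by apply: le_lt_trans H _; rewrite ltry.
split => //.
have := le_normr_Rintegral measurableT I.
move=> /le_trans; apply.
rewrite /Rintegral -lee_fin fineK //.
by rewrite ge0_fin_numE ?integral_ge0 //; apply: le_lt_trans H _; rewrite ltry.
Qed.

(** The order [k] of the derivative of the kernel is a parameter, so that the family is closed under
    differentiation up to factors e^(-1). The kernel is not normalised here. *)
Definition cvl (F : 'rV[R]_d -> R) e k x : R :=
  \int[@mu R d']_y (F y * kern e k (x - y)).

Lemma measurable_kern e k (x : 'rV[R]_d) : 0 < e ->
  measurable_fun setT (fun y : T => kern e k (x - (y : 'rV[R]_d))).
Proof.
move=> e0; apply: (@measurable_comp_continuous R d' _ T (fun y => x - y)); last exact: kern_continuous.
move=> i; under eq_fun do rewrite !mxE.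
by apply: measurable_funB => //; exact: measurable_coord.
Qed.

Lemma integrable_cvl F e k x : locint F -> 0 < e ->
  (@mu R d').-integrable setT (fun y : T => (F y * kern e k (x - y))%:E).
Proof.
move=> lF e0; have [M M0 HM] := @kern_bound R d' k.
have [] // := @locint_bounded_mul F (fun y => kern e k (x - y)) M (`|x| + e) lF.
- exact: measurable_kern.
- move=> y xy; apply: kern_out => //.
  have := lerB_normD y (- x); rewrite normrN distrC; move: xy; lra.
Qed.

(** The error of the first-order expansion of the kernel is at most C * t^2 and lives on a fixed
    cube, so after integration against F it is still quadratic in t; no limit is taken under the
    integral. *)
Lemma is_derive_cvl F e k x h : locint F -> 0 < e ->
  is_derive x h (cvl F e k) (\sum_(i < d) h ord0 i / e * cvl F e (incr k i) x).
Proof.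
move=> lF e0; have [C C0 HC] := @kern_taylor R d' e k h e0.
(* For |t| <= 1 all the kernels involved vanish outside the cube of half side |x| + e + |h| about
   0. *)
apply: (@is_derive_quadratic _ _ _ _ _ _ (C * massin F (`|x| + e + `|h|))) => t t1.
pose g i y := F y * (h ord0 i / e * kern e (incr k i) (x - y)).
have Ig i : (@mu R d').-integrable setT (fun y : T => (g i y)%:E).
  rewrite /g; under eq_fun do rewrite mulrCA EFinM.
  by apply: integrableZl => //; exact: integrable_cvl.
have I1 x' := integrable_cvl k x' lF e0.
have mk x' k' := measurable_kern k' x' e0.
rewrite (_ : cvl F e k (t *: h + x) - cvl F e k x - t * \sum_(i < d) _ =
  \int[@mu R d']_y (F y * (kern e k (t *: h + (x - y)) - kern e k (x - y) -
     t * \sum_(i < d) h ord0 i / e * kern e (incr k i) (x - y)))).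
  rewrite -mulrA mulrCA.
  apply: (le_trans (locint_bounded_mul lF (B := C * t ^+ 2) (r := `|x| + e + `|h|) _ _ _).2).
  - apply: measurable_funB.
      apply: measurable_funB; last exact: mk.
      by under eq_fun do rewrite addrA; exact: mk.
    apply: measurable_funM; first exact: measurable_cst.
    apply: measurable_sum => i.
    by apply: measurable_funM; [exact: measurable_cst|exact: mk].
  - by move=> y; exact: HC.
  - move=> y yr.
    have h0 : 0 <= `|h| by [].
    have xye : e <= `|x - y|.
      by have := lerB_normD y (- x); rewrite normrN distrC; move: yr; lra.
    have thxye : e <= `|t *: h + (x - y)|.
      rewrite [t *: h + _]addrC; have := lerB_normD (x - y) (t *: h); rewrite normrZ.
      have := ler_wpM2r h0 t1; rewrite mul1r.
      have := lerB_normD y (- x); rewrite normrN distrC; move: yr; lra.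
    rewrite !kern_out // subrr sub0r big1 ?mulr0 ?oppr0 // => i _.
    by rewrite kern_out ?mulr0.
  by rewrite mulrC.
have -> : t * (\sum_(i < d) h ord0 i / e * cvl F e (incr k i) x) =
    \int[@mu R d']_y (t * \sum_(i < d) g i y).
  rewrite RintegralZl //; last first.
    exact: (integrable_fin_sum _ Ig).
  congr (t * _); rewrite Rintegral_sum; last exact: Ig.
  apply: eq_bigr => i _; rewrite /g.
  rewrite /cvl -RintegralZl //; last exact: integrable_cvl.
  by apply: eq_Rintegral => y _; rewrite mulrCA.
rewrite /cvl -RintegralB //; [|exact: I1|exact: I1].
rewrite -RintegralB //; last 2 first.
- apply: integrable_EFinB; exact: I1.
- apply: integrable_EFinZ.
  exact: (integrable_fin_sum _ Ig).
apply: eq_Rintegral => y _.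
rewrite [RHS]mulrBr mulrBr [t *: h + (x - y)]addrA; congr (_ - _).
by rewrite mulrCA [F y * _]mulr_sumr.
Qed.

Lemma cvl_continuous F e k : locint F -> 0 < e -> continuous (cvl F e k).
Proof.
move=> lF e0 x; have [L L0 HL] := @kern_lip R d' e k e0.
apply: (@continuous_at_lip _ _ _ _ (L * massin F (`|x| + e + 1))).
  by rewrite mulr_ge0 // massin_ge0.
move=> z zx.
rewrite /cvl -RintegralB //; [|exact: integrable_cvl|exact: integrable_cvl].
under eq_Rintegral do rewrite -mulrBr.
apply: (le_trans (locint_bounded_mul lF (B := L * `|z - x|) (r := `|x| + e + 1) _ _ _).2).
- by apply: measurable_funB; exact: measurable_kern.
- move=> y; have := HL (x - y) (z - y).
  by rewrite opprB addrA subrK.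
- move=> y yr.
  have h1 : e <= `|x - y|.
    by have := lerB_normD y (- x); rewrite normrN distrC; move: yr; lra.
  have h2 : e <= `|z - y|.
    have := lerB_normD y (- z); rewrite normrN distrC.
    have := lerB_normD z (- x); rewrite normrN; move: yr zx; lra.
  by rewrite !kern_out // subrr.
by rewrite mulrAC.
Qed.
End locint.

Lemma int_indicE {dd} {S : measurableType dd} {R : realType} (m : {measure set S -> \bar R})
  (A : set S) (g : S -> R) :
  (\int[m]_(x in A) (g x)%:E = \int[m]_x (\1_A x * g x)%:E)%E.
Proof.
rewrite integral_mkcond; apply: eq_integral => x _; rewrite /patch indicE.
by case: ifPn => _; rewrite ?mul1r ?mul0r.
Qed.

Section mollify.
Context {R : realType} {d' : nat}.
Local Notation d := d'.+1.
Local Notation T := (vec R d').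
Local Notation mu := (@mu R d').

Definition k0 : 'I_d -> nat := fun=> 0%N.

Lemma kern0_even (e : R) (x : 'rV[R]_d) : kern e k0 (- x) = kern e k0 x.
Proof.
apply: eq_bigr => i _; rewrite mxE mulNr.
have E (t : R) : sbump (k0 i) t = mono 0 (1 - t) * mono 0 (1 + t).
  by rewrite /k0 /sbump /val_terms big_seq1 /term_val /= mul1r.
by rewrite !E opprK mulrC.
Qed.

Definition Kint (e : R) : R := \int[mu]_y kern e k0 (y : 'rV[R]_d).

Lemma locint1 : locint (cst 1 : 'rV[R]_d -> R).
Proof.
split=> // r; under eq_integral do rewrite /= normr1.
by rewrite integral_cst ?mul1e; [exact: mu_cube_fin|exact: measurable_cube].
Qed.

Lemma integrable_kern (e : R) k (x : 'rV[R]_d) : 0 < e ->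
  mu.-integrable setT (fun y : T => (kern e k (x - y))%:E).
Proof.
move=> e0; have := integrable_cvl k x locint1 e0.
by under eq_fun do rewrite /cst mul1r.
Qed.

Lemma measurable_kern_id (e : R) k : 0 < e -> measurable_fun setT (fun y : T => kern e k y).
Proof. by move=> e0; apply: measurable_continuous; exact: kern_continuous. Qed.

Lemma KintE (e : R) : 0 < e -> (\int[mu]_y (kern e k0 y)%:E = (Kint e)%:E)%E.
Proof.
move=> e0; rewrite /Kint /Rintegral fineK //; apply: integrable_fin_num => //.
have := integrable_kern k0 0 e0.
by under eq_fun do rewrite sub0r kern0_even.
Qed.

Lemma int_kernr (e : R) (y : 'rV[R]_d) : 0 < e ->
  (\int[mu]_x (kern e k0 (x - y))%:E = (Kint e)%:E)%E.
Proof.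
move=> e0; rewrite -(KintE e0).
apply: (@int_translate R d' (fun x => (kern e k0 x)%:E) (- y)).
  by apply/measurable_EFinP; exact: measurable_kern_id.
by move=> x; rewrite lee_fin kern0_ge0.
Qed.

Lemma int_kernl (e : R) (x : 'rV[R]_d) : 0 < e ->
  (\int[mu]_y (kern e k0 (x - y))%:E = (Kint e)%:E)%E.
Proof.
move=> e0; rewrite -(int_kernr x e0); apply: eq_integral => y _.
by rewrite -kern0_even opprB.
Qed.

Lemma Kint_gt0 (e : R) : 0 < @mu1 R d' -> 0 < e -> 0 < Kint e.
Proof.
move=> m0 e0; rewrite -lte_fin -(KintE e0).
pose c : R := (expR (- 2) ^+ 2) ^+ d.
have c0 : 0 < c by rewrite !exprn_gt0 ?expR_gt0.
apply: (@lt_le_trans _ _ (c%:E * mu (cube 0 (e / 2)))%E).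
  by rewrite mu_cube ?divr_gt0 // -EFinM lte_fin !mulr_gt0 // exprn_gt0 // divr_gt0.
rewrite -integral_cst; last exact: measurable_cube.
rewrite integral_mkcond; apply: le_int => x _.
  by rewrite /patch; case: ifPn => // _; rewrite lee_fin ltW.
rewrite /patch; case: ifPn => [|_]; last by rewrite lee_fin kern0_ge0.
by rewrite inE /cube /= subr0 => xe; rewrite lee_fin; exact: kern0_ge.
Qed.

Lemma measurable_kern2 (e : R) k : 0 < e ->
  measurable_fun setT (fun z : T * T => kern e k (z.1 - z.2 : 'rV[R]_d)).
Proof.
move=> e0; apply: (@measurable_comp_continuous R d' _ _ (fun z : T * T => z.1 - z.2 : 'rV[R]_d)); last exact: kern_continuous.
move=> i; under eq_fun do rewrite !mxE.
apply: measurable_funB.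
  exact: (measurableT_comp (measurable_coord i) measurable_fst).
exact: (measurableT_comp (measurable_coord i) measurable_snd).
Qed.

Lemma cvl_norm_le (F : 'rV[R]_d -> R) (e : R) (x : 'rV[R]_d) : locint F -> 0 < e ->
  (`|(cvl F e k0 x)%:E| <= \int[mu]_y (`|F y| * kern e k0 (x - y))%:E)%E.
Proof.
move=> lF e0; have I := integrable_cvl k0 x lF e0.
rewrite /= EFin_normr_Rintegral //.
apply: (le_trans (le_abse_integral _ measurableT _)); first by case/integrableP: I.
apply: le_int => y _; first exact: abse_ge0.
by rewrite /= lee_fin normrM (ger0_norm (kern0_ge0 _ _)).
Qed.

(** Tonelli, integrating the kernel in x first. [A'] contains the e-neighbourhood of [A]: the
    localised form serves for the whole space and for cubes. *)
Lemma int_cvl_le (F : 'rV[R]_d -> R) (e : R) (A A' : set 'rV[R]_d) :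
  locint F -> 0 < e -> measurable (A : set T) -> measurable (A' : set T) ->
  (forall x y, A x -> `|x - y| < e -> A' y) ->
  (\int[mu]_(x in A) `|(cvl F e k0 x)%:E| <= (Kint e)%:E * \int[mu]_(y in A') `|(F y)%:E|)%E.
Proof.
move=> lF e0 mA mA' AA'; have [mF _] := lF.
have mabs : measurable_fun setT (fun y : T => `|F y|) by apply: measurableT_comp.
pose f (z : T * T) : \bar R := (\1_A' z.2 * `|F z.2| * kern e k0 (z.1 - z.2 : 'rV[R]_d))%:E.
have f0 z : (0 <= f z)%E by rewrite lee_fin !mulr_ge0 // kern0_ge0.
have mf : measurable_fun setT f.
  apply/measurable_EFinP; apply: measurable_funM; last exact: measurable_kern2.
  apply: measurable_funM.
    by apply: (measurableT_comp _ measurable_snd); exact: measurable_indic.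
  exact: (measurableT_comp mabs measurable_snd).
apply: (@le_trans _ _ (\int[mu]_x \int[mu]_y f (x, y))%E).
  rewrite integral_mkcond; apply: le_int => x _.
    by rewrite /patch; case: ifPn => // _; exact: abse_ge0.
  rewrite /patch; case: ifPn => [/set_mem Ax|_]; last exact: integral_ge0.
  apply: (le_trans (cvl_norm_le x lF e0)).
  apply: le_int => y _; first by rewrite lee_fin mulr_ge0 // kern0_ge0.
  rewrite /f /= lee_fin indicE.
  have [xy|xy] := ltP `|x - y| e; last by rewrite kern_out // !mulr0.
  by rewrite mem_set ?mul1r //; exact: AA' xy.
rewrite fubini_tonelli //.
have K0 : 0 <= Kint e.
  by rewrite -lee_fin -KintE // integral_ge0 // => z _; rewrite lee_fin kern0_ge0.
rewrite [X in (_ * X)%E](int_indicE _ _ (fun y : T => `|F y|)) -ge0_integralZl.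
- apply: le_int => y _; first by apply: integral_ge0.
  rewrite /f /=; under eq_integral do rewrite EFinM.
  rewrite ge0_integralZl.
  + rewrite int_kernr // muleC; apply: lee_wpmul2l; first by rewrite lee_fin.
    by [].
  + exact: measurableT.
  + apply/measurable_EFinP.
    apply: (@measurable_comp_continuous R d' _ T (fun z => z - y)); last exact: kern_continuous.
    move=> i; under eq_fun do rewrite !mxE.
    by apply: measurable_funB; [exact: measurable_coord|exact: measurable_cst].
  + by move=> x _; rewrite lee_fin kern0_ge0.
  + by rewrite lee_fin mulr_ge0.
- exact: measurableT.
- apply/measurable_EFinP; apply: measurable_funM => //; exact: measurable_indic.
- by move=> y _; rewrite lee_fin mulr_ge0.
- by rewrite lee_fin.
Qed.

Definition moll (F : 'rV[R]_d -> R) (e : R) (x : 'rV[R]_d) : R := cvl F e k0 x / Kint e.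

Lemma int_moll_le (F : 'rV[R]_d -> R) (e : R) (A A' : set 'rV[R]_d) :
  0 < @mu1 R d' -> locint F -> 0 < e -> measurable (A : set T) -> measurable (A' : set T) ->
  (forall x y, A x -> `|x - y| < e -> A' y) ->
  (\int[mu]_(x in A) `|(moll F e x)%:E| <= \int[mu]_(y in A') `|(F y)%:E|)%E.
Proof.
move=> m0 lF e0 mA mA' AA'; have Kg := Kint_gt0 m0 e0.
have := int_cvl_le lF e0 mA mA' AA'.
rewrite -lee_pdivrMl //; apply: le_trans.
rewrite -ge0_integralZl.
- apply: le_int => x _; first exact: abse_ge0.
  by rewrite /moll /= -EFinM lee_fin normrM normfV (gtr0_norm Kg) mulrC.
- exact: mA.
- apply/measurable_EFinP; apply: measurable_funTS; apply: measurableT_comp => //.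
  by apply: measurable_continuous; exact: cvl_continuous.
- by move=> x _; exact: abse_ge0.
- by rewrite lee_fin invr_ge0 ltW.
Qed.

Definition L1 (F : 'rV[R]_d -> R) := mu.-integrable setT (fun y : T => (F y)%:E).

Lemma L1_locint F : L1 F -> locint F.
Proof.
move=> /integrableP[mF F1]; split; first exact/measurable_EFinP.
move=> r; apply: le_lt_trans F1; apply: le_int_subset => // x _; exact: abse_ge0.
Qed.

Lemma mollD F G e x : locint F -> locint G -> 0 < e ->
  moll (fun y => F y + G y) e x = moll F e x + moll G e x.
Proof.
move=> lF lG e0; rewrite /moll -mulrDl; congr (_ / _).
rewrite /cvl -RintegralD; [|exact: measurableT|exact: integrable_cvl|exact: integrable_cvl].
by apply: eq_Rintegral => y _; rewrite mulrDl.
Qed.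

Lemma mollZ F (c : R) e x : locint F -> 0 < e ->
  moll (fun y => c * F y) e x = c * moll F e x.
Proof.
move=> lF e0; rewrite /moll mulrA; congr (_ / _).
rewrite /cvl -RintegralZl; [|exact: measurableT|exact: integrable_cvl].
by apply: eq_Rintegral => y _; rewrite mulrA.
Qed.

(** The property is verified for indicators of boxes and then carried to all of L^1 by linearity and
    density. *)
Definition L1cvg (F : 'rV[R]_d -> R) := L1 F /\
  forall del, 0 < del -> exists2 e0, 0 < e0 & forall e, 0 < e -> e < e0 ->
    (\int[mu]_x `|(moll F e x - F x)%:E| <= del%:E)%E.

End mollify.

Import HBSimple.

(** * Convergence of mollifications in L1 *)

Section L1_convergence.
Context {R : realType} {d' : nat}.
Local Notation d := d'.+1.
Local Notation T := (vec R d').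
Local Notation mu := (@mu R d').
Hypothesis m0 : 0 < @mu1 R d'.
Implicit Types F G H : 'rV[R]_d -> R.

Lemma cvge0_small (u : nat -> \bar R) (tau : R) : 0 < tau ->
  u n @[n --> \oo] --> 0%E -> exists n, (u n <= tau%:E)%E.
Proof.
move=> t0 /fine_cvgP[fu cu].
have /cvgrPdist_lt/(_ _ t0) lu := cu.
have [n [un]] : exists n, (u n \is a fin_num /\ `|0 - fine (u n)| < tau).
  near \oo => n; exists n; split; near: n; [exact: fu|exact: lu].
rewrite sub0r normrN => h; exists n; rewrite -(fineK un) lee_fin.
by rewrite (le_trans (ler_norm _)) // ltW.
Unshelve. all: by end_near. Qed.

Definition nrm1 F : \bar R := (\int[mu]_x `|(F x)%:E|)%E.

Lemma nrm1_triangle F G H : measurable_fun setT (G : T -> R) ->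
  measurable_fun setT (H : T -> R) -> (forall x, `|F x| <= `|G x| + `|H x|) ->
  (nrm1 F <= nrm1 G + nrm1 H)%E.
Proof.
move=> mG mH FGH; rewrite /nrm1 -ge0_integralD.
- by apply: le_int => x _ //=; rewrite lee_fin.
- exact: measurableT.
- by [].
- by apply: measurableT_comp => //; exact/measurable_EFinP.
- by [].
- by apply: measurableT_comp => //; exact/measurable_EFinP.
Qed.

Lemma L1P F : measurable_fun setT (F : T -> R) -> (nrm1 F < +oo)%E -> L1 F.
Proof. by move=> mF F1; apply/integrableP; split => //; exact/measurable_EFinP. Qed.

Lemma L1_measurable F : L1 F -> measurable_fun setT (F : T -> R).
Proof. by move=> /integrableP[mF _]; exact/measurable_EFinP. Qed.

Lemma L1_nrm1 F : L1 F -> (nrm1 F < +oo)%E.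
Proof. by move=> /integrableP[]. Qed.

Lemma moll_measurable F e : locint F -> 0 < e -> measurable_fun setT (moll F e : T -> R).
Proof.
move=> lF e0; apply: measurable_funM => //.
by apply: measurable_continuous; exact: cvl_continuous.
Qed.

Lemma nrm1_moll_le F e : locint F -> 0 < e -> (nrm1 (moll F e) <= nrm1 F)%E.
Proof.
by move=> lF e0; apply: (@int_moll_le R d' F e setT setT) => //; exact: measurableT.
Qed.

Lemma L1B F G : L1 F -> L1 G -> L1 (fun x => F x - G x).
Proof. exact: integrable_EFinB. Qed.

Lemma L1D F G : L1 F -> L1 G -> L1 (fun x => F x + G x).
Proof. exact: integrable_EFinD. Qed.

Lemma L1Z F (c : R) : L1 F -> L1 (fun x => c * F x).
Proof. exact: integrable_EFinZ. Qed.

(** The three-epsilon argument; mollification is a contraction of L^1, so the error F - G is not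
    enlarged. *)
Lemma L1cvg_lim F : L1 F -> (forall tau, 0 < tau -> exists2 G, L1cvg G &
   (nrm1 (fun x => F x - G x)%R <= tau%:E)%E) -> L1cvg F.
Proof.
move=> LF HF; split => // del del0.
have del3 : 0 < del / 3 by rewrite divr_gt0.
have [G [LG cG] FG] := HF _ del3.
have [e0 e00 He] := cG _ del3; exists e0 => // e ep ee.
have LFG := L1B LF LG.
have mmF := moll_measurable (L1_locint LF) ep.
have mmG := moll_measurable (L1_locint LG) ep.
have mmFG := moll_measurable (L1_locint LFG) ep.
have mF := L1_measurable LF; have mG := L1_measurable LG.
have -> : del%:E = (del / 3 + (del / 3 + del / 3))%:E by congr (_%:E); field.
rewrite EFinD; apply: (le_trans (@nrm1_triangle _ (moll (fun x => F x - G x) e)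
   (fun x => (moll G e x - G x) - (F x - G x)) _ _ _)) => //.
- by apply: measurable_funB; apply: measurable_funB.
- move=> x.
  have -> : moll F e x - F x = moll (fun x => F x - G x) e x + ((moll G e x - G x) - (F x - G x)).
    rewrite (_ : moll F e x = moll (fun x => F x - G x) e x + moll G e x); first by ring.
    rewrite -(mollD _ (L1_locint LFG) (L1_locint LG) ep).
    by congr moll; apply/funext => y; rewrite subrK.
  exact: ler_normD.
apply: leeD; first exact: (le_trans (nrm1_moll_le (L1_locint LFG) ep) FG).
rewrite EFinD; apply: (le_trans (@nrm1_triangle _ (fun x => moll G e x - G x) (fun x => F x - G x) _ _ _)).
- exact: measurable_funB.
- exact: measurable_funB.
- by move=> x; exact: ler_normB.
by apply: leeD => //; exact: He.
Qed.

Lemma L1cvgD F G : L1cvg F -> L1cvg G -> L1cvg (fun x => F x + G x).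
Proof.
move=> [LF cF] [LG cG]; split; first exact: L1D.
move=> del del0; have del2 : 0 < del / 2 by rewrite divr_gt0.
have [e1 e10 H1] := cF _ del2; have [e2 e20 H2] := cG _ del2.
exists (Num.min e1 e2); first by rewrite lt_min e10.
move=> e ep; rewrite lt_min => /andP[ee1 ee2].
have -> : del%:E = (del / 2 + del / 2)%:E by congr (_%:E); field.
rewrite EFinD; apply: (le_trans (@nrm1_triangle _ (fun x => moll F e x - F x) (fun x => moll G e x - G x) _ _ _)).
- by apply: measurable_funB; [apply: moll_measurable => //; exact: L1_locint|exact: L1_measurable].
- by apply: measurable_funB; [apply: moll_measurable => //; exact: L1_locint|exact: L1_measurable].
- move=> x; rewrite mollD //; [|exact: L1_locint|exact: L1_locint].
  by rewrite opprD addrACA; exact: ler_normD.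
by apply: leeD; [exact: H1|exact: H2].
Qed.

Lemma L1cvgZ F (c : R) : L1cvg F -> L1cvg (fun x => c * F x).
Proof.
move=> [LF cF]; split; first exact: L1Z.
move=> del del0.
have c1 : 0 < `|c| + 1 by rewrite ltr_wpDl.
have [e1 e10 H1] := cF _ (divr_gt0 del0 c1).
exists e1 => // e ep ee1.
have := H1 _ ep ee1; rewrite -(@lee_pmul2l _ (`|c| + 1)%:E) //.
rewrite -EFinM mulrCA divff ?gt_eqF // mulr1; apply: le_trans.
rewrite -ge0_integralZl_EFin; first last.
- exact: ltW.
- apply: measurableT_comp => //; apply/measurable_EFinP; apply: measurable_funB.
    by apply: moll_measurable => //; exact: L1_locint.
  exact: L1_measurable.
- by [].
- exact: measurableT.
apply: le_int => x _ //=.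
rewrite mollZ //; last exact: L1_locint.
by rewrite -mulrBr normrM lee_fin ler_wpM2r // lerDl.
Qed.

Lemma L1cvg0 : L1cvg ((fun=> 0) : 'rV[R]_d -> R).
Proof.
have L0 : L1 ((fun=> 0) : 'rV[R]_d -> R).
  apply: L1P; first exact: measurable_cst.
  by rewrite /nrm1; under eq_integral do rewrite abse0; rewrite integral0 ltry.
split => // del del0; exists 1 => // e ep _.
rewrite (_ : (fun x => _) = cst 0%E) ?integral0 ?lee_fin ?ltW //.
apply/funext => x; rewrite /cst -(mul0r (0:R)) (mollZ (F := fun=> 0) 0) ?mul0r ?subrr ?abse0 //; exact: L1_locint.
Qed.

Lemma L1cvg_sum (I : Type) (s : seq I) (f : I -> 'rV[R]_d -> R) :
  (forall i, L1cvg (f i)) -> L1cvg (fun x => \sum_(i <- s) f i x).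
Proof.
move=> Hf; elim: s => [|i s IH].
  by under eq_fun do rewrite big_nil; exact: L1cvg0.
by under eq_fun do rewrite big_cons; exact: L1cvgD.
Qed.

Lemma measurable_box (a b : 'rV[R]_d) : measurable (box a b : set T).
Proof.
rewrite (_ : box a b = \bigcap_(i in [set: 'I_d])
  ((fun x : T => (x : 'rV[R]_d) ord0 i) @^-1` `[a ord0 i, b ord0 i[%classic)).
  apply: fin_bigcap_measurable => // i _; rewrite -[X in measurable X]setTI.
  by apply: measurable_coord => //; exact: measurable_itv.
apply/seteqP; split => x /= H i; first by move=> _ /=; rewrite in_itv /=; exact: H.
by have := H i I; rewrite /= in_itv.
Qed.

(** The part near the box of the e-neighbourhood of the hyperplane x_i = t. Widening the other sides
    by 1 makes it contain the e-neighbourhood of a face for all e <= 1, with volume linear in e. *)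
Definition slab (a b : 'rV[R]_d) (i : 'I_d) (t e : R) : set 'rV[R]_d :=
  box (\row_j if j == i then t - e else a ord0 j - 1)
      (\row_j if j == i then t + e else b ord0 j + 1).

Lemma mu_slab a b i t e : 0 < e ->
  (mu (slab a b i t e : set T) <= (2 * e * \prod_(j < d | j != i) Num.max (b ord0 j - a ord0 j + 2) 0)%:E)%E.
Proof.
move=> e0; rewrite muE; apply: (le_trans (lstar_box _ _)); rewrite lee_fin.
rewrite /boxvol (bigD1 i) //= !mxE eqxx.
rewrite (_ : t + e - (t - e) = 2 * e); last by ring.
have e2 : 0 < 2 * e by rewrite mulr_gt0.
rewrite (max_l (ltW e2)) ler_pM2l //.
rewrite le_eqVlt; apply/orP; left; apply/eqP; apply: eq_bigr => j ji.
by rewrite !mxE (negbTE ji); congr (Num.max _ _); ring.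
Qed.

Lemma moll_locally_cst F e x : locint F -> 0 < e ->
  (forall y, `|x - y| < e -> F y = F x) -> moll F e x = F x.
Proof.
move=> lF e0 H; have Kg := Kint_gt0 m0 e0.
rewrite /moll /cvl (_ : (fun y : T => F y * kern e k0 (x - y)) = (fun y : T => F x * kern e k0 (x - y))); last first.
  apply/funext => y; have [xy|xy] := ltP `|x - y| e; first by rewrite H.
  by rewrite kern_out // !mulr0.
rewrite RintegralZl; [|exact: measurableT|exact: integrable_kern].
by rewrite /Rintegral int_kernl // mulfK // gt_eqF.
Qed.

Lemma moll_indic_bounds (E : set T) e x : measurable E -> locint (\1_E : 'rV[R]_d -> R) -> 0 < e ->
  0 <= moll (\1_E) e x <= 1.
Proof.
move=> mE lE e0; have Kg := Kint_gt0 m0 e0.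
rewrite /moll; apply/andP; split.
  apply: divr_ge0; last exact: ltW.
  apply: Rintegral_ge0 => y _.
  by rewrite mulr_ge0 // kern0_ge0.
rewrite ler_pdivrMr // mul1r.
have -> : @Kint R d' e = \int[mu]_y kern e k0 (x - (y : 'rV[R]_d)).
  by rewrite /Rintegral int_kernl.
apply: le_Rintegral; [exact: measurableT|exact: integrable_cvl|exact: integrable_kern|].
by move=> y _; rewrite ler_piMl ?kern0_ge0.
Qed.

Lemma slab_cover (a b : 'rV[R]_d) (e : R) (x y : 'rV[R]_d) : e <= 1 ->
  (forall i, ~ slab a b i (a ord0 i) e x) -> (forall i, ~ slab a b i (b ord0 i) e x) ->
  `|x - y| < e -> box a b x -> box a b y.
Proof.
move=> e1 Ha Hb xy bx i.
have Hc j : `|x ord0 j - y ord0 j| < e.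
  by have := le_lt_trans (coord_le_norm (x - y) j) xy; rewrite !mxE.
have := bx i; have := Hc i; rewrite ltr_norml => /andP[h1 h2] /andP[h3 h4].
have na : a ord0 i + e <= x ord0 i.
  rewrite leNgt; apply/negP => h; apply: (Ha i) => j; rewrite !mxE.
  have := bx j; case: eqP => [->|_] /andP[? ?]; apply/andP; split; lra.
have nb : x ord0 i < b ord0 i - e.
  rewrite ltNge; apply/negP => h; apply: (Hb i) => j; rewrite !mxE.
  have := bx j; case: eqP => [->|_] /andP[? ?]; apply/andP; split; lra.
by apply/andP; split; lra.
Qed.

Lemma slab_cover_out (a b : 'rV[R]_d) (e : R) (x y : 'rV[R]_d) : e <= 1 ->
  (forall i, ~ slab a b i (a ord0 i) e x) -> (forall i, ~ slab a b i (b ord0 i) e x) ->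
  `|x - y| < e -> box a b y -> box a b x.
Proof.
move=> e1 Ha Hb xy by' i.
have Hc j : `|x ord0 j - y ord0 j| < e.
  by have := le_lt_trans (coord_le_norm (x - y) j) xy; rewrite !mxE.
have xj j : a ord0 j - 1 <= x ord0 j < b ord0 j + 1.
  have := by' j; have := Hc j; rewrite ltr_norml => /andP[? ?] /andP[? ?].
  by apply/andP; split; lra.
have := by' i; have := Hc i; rewrite ltr_norml => /andP[h1 h2] /andP[h3 h4].
apply/andP; split.
  rewrite leNgt; apply/negP => h; apply: (Ha i) => j; rewrite !mxE.
  have := xj j; case: eqP => [->|_] /andP[? ?]; apply/andP; split; lra.
rewrite ltNge; apply/negP => h; apply: (Hb i) => j; rewrite !mxE.
have := xj j; case: eqP => [->|_] /andP[? ?]; apply/andP; split; lra.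
Qed.

Lemma nrm1_indic (E : set T) : measurable E -> nrm1 (\1_E : 'rV[R]_d -> R) = mu E.
Proof.
move=> mE; rewrite -[in RHS](setIT E) -integral_indic //.
by apply: eq_integral => x _; rewrite /= ger0_norm.
Qed.

Lemma L1_indic (E : set T) : measurable E -> (mu E < +oo)%E -> L1 (\1_E : 'rV[R]_d -> R).
Proof.
move=> mE fE; apply: L1P; first exact: measurable_indic.
by rewrite nrm1_indic.
Qed.

Lemma mu_box_fin a b : (mu (box a b : set T) < +oo)%E.
Proof. by rewrite muE (le_lt_trans (lstar_box _ _)) // ltry. Qed.

(** Mollification changes the indicator only in the slabs around the 2d faces, by at most 1, and
    their total measure is at most a constant times e. *)
Lemma L1cvg_box a b : L1cvg (\1_(box a b) : 'rV[R]_d -> R).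
Proof.
have mB := measurable_box a b.
have LB := L1_indic mB (mu_box_fin a b).
split=> // del del0.
pose P i := \prod_(j < d | j != i) Num.max (b ord0 j - a ord0 j + 2) 0 : R.
have P0 i : 0 <= P i by apply: prodr_ge0 => j _; rewrite le_max lexx orbT.
pose C := \sum_(i < d) 4 * P i.
have C0 : 0 <= C by apply: sumr_ge0 => i _; rewrite mulr_ge0.
exists (Num.min 1 (del / (C + 1))).
  by rewrite lt_min ltr01 divr_gt0 // ltr_wpDl.
move=> e e0; rewrite lt_min => /andP[/ltW e1 eC].
have lB := L1_locint LB.
pose f i (x : T) : \bar R := (\1_(slab a b i (a ord0 i) e) x + \1_(slab a b i (b ord0 i) e) x)%:E.
apply: (@le_trans _ _ (\int[mu]_x \sum_(i < d) f i x)%E).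
  apply: le_int => x _ //.
  have [[i xi]|H] := pselect (exists i, slab a b i (a ord0 i) e x \/ slab a b i (b ord0 i) e x).
    apply: (@le_trans _ _ 1%E).
      rewrite lee_fin ler_norml.
      have /andP[h1 h2] := moll_indic_bounds x mB lB e0.
      rewrite indicE; case: (_ \in _) => /=; apply/andP; split; lra.
    rewrite (bigD1 i) //= -[leLHS]adde0; apply: leeD.
      rewrite /f lee_fin !indicE; case: xi => xi; first by rewrite (mem_set xi) lerDl.
      by rewrite (mem_set xi) lerDr.
    by apply: sume_ge0 => j _; rewrite lee_fin addr_ge0.
  have Ha i : ~ slab a b i (a ord0 i) e x by move=> h; apply: H; exists i; left.
  have Hb i : ~ slab a b i (b ord0 i) e x by move=> h; apply: H; exists i; right.
  rewrite moll_locally_cst ?subrr ?abse0 //; last first.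
    move=> y xy; rewrite !indicE; congr ((nat_of_bool _)%:R).
    apply/idP/idP; rewrite !inE; [exact: slab_cover_out xy|exact: slab_cover xy].
  by apply: sume_ge0 => j _; rewrite lee_fin addr_ge0.
rewrite ge0_integral_sum.
- apply: (@le_trans _ _ (\sum_(i < d) (4 * P i * e)%:E)%E).
    apply: lee_sum => i _.
    rewrite /f; under eq_integral do rewrite EFinD.
    rewrite ge0_integralD.
    + rewrite !integral_indic ?setIT; [|exact: measurableT|exact: measurable_box|exact: measurableT|exact: measurable_box].
      apply: (le_trans (leeD (mu_slab _ _ _ _ e0) (mu_slab _ _ _ _ e0))).
      by rewrite -EFinD lee_fin /P; lra.
    + exact: measurableT.
    + by move=> x _; rewrite lee_fin.
    + by apply/measurable_EFinP; apply: measurable_indic; exact: measurable_box.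
    + by move=> x _; rewrite lee_fin.
    + by apply/measurable_EFinP; apply: measurable_indic; exact: measurable_box.
  rewrite sumEFin lee_fin -mulr_suml -/C.
  move: eC; rewrite ltr_pdivlMr ?ltr_wpDl // => eC.
  by rewrite (le_trans _ (ltW eC)) // mulrC ler_pM2l // lerDl.
- exact: measurableT.
- move=> i; apply/measurable_EFinP; apply: measurable_funD; apply: measurable_indic; exact: measurable_box.
- by move=> i x _; rewrite lee_fin addr_ge0.
Qed.

Lemma boxI (a b a' b' : 'rV[R]_d) : box a b `&` box a' b' =
  box (\row_j Num.max (a ord0 j) (a' ord0 j)) (\row_j Num.min (b ord0 j) (b' ord0 j)).
Proof.
apply/seteqP; split => x.
  move=> [h1 h2] i; rewrite !mxE ge_max lt_min.
  by have /andP[-> ->] := h1 i; have /andP[-> ->] := h2 i.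
by move=> h; split => i; have := h i; rewrite !mxE ge_max lt_min => /andP[/andP[? ?] /andP[? ?]]; apply/andP.
Qed.

(** Inclusion-exclusion for a union U and one more box B: U and its intersection with B are both
    unions of n boxes, so the induction runs over all families at once. *)
Lemma L1cvg_boxes (ab : nat -> 'rV[R]_d * 'rV[R]_d) n :
  L1cvg (\1_(\big[setU/set0]_(k < n) box (ab k).1 (ab k).2) : 'rV[R]_d -> R).
Proof.
elim: n ab => [|n IH] ab.
  rewrite big_ord0 (_ : \1_set0 = (fun=> 0)); first exact: L1cvg0.
  by apply/funext => x; rewrite indicE in_set0.
rewrite big_ord_recr /=; set U := \big[setU/set0]_(k < n) _; set B := box _ _.
pose ab' k := (\row_j Num.max ((ab k).1 ord0 j) ((ab n).1 ord0 j) : 'rV[R]_d,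
               \row_j Num.min ((ab k).2 ord0 j) ((ab n).2 ord0 j) : 'rV[R]_d).
have UB : U `&` B = \big[setU/set0]_(k < n) box (ab' k).1 (ab' k).2.
  rewrite /U -(bigcup_mkord n (fun k => box (ab k).1 (ab k).2)) -(bigcup_mkord n (fun k => box (ab' k).1 (ab' k).2)) setI_bigcupl; apply: eq_bigcupr => k _.
  by rewrite boxI.
have H1 : L1cvg (\1_U : 'rV[R]_d -> R) by exact: IH.
have H2 : L1cvg (\1_B : 'rV[R]_d -> R) by exact: L1cvg_box.
have H3 : L1cvg (\1_(U `&` B) : 'rV[R]_d -> R) by rewrite UB; exact: IH.
have := L1cvgD (L1cvgD H1 H2) (L1cvgZ (-1) H3).
congr L1cvg; apply/funext => x; rewrite !indicE in_setU in_setI mulN1r.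
by case: (x \in U); case: (x \in B) => /=; ring.
Qed.

(** The definition of the outer measure provides a cover of E by boxes with little excess, and the
    tail of its series is small: a finite union of boxes is close to E in L^1. *)
Lemma L1cvg_indic (E : set T) : measurable E -> (mu E < +oo)%E ->
  L1cvg (\1_E : 'rV[R]_d -> R).
Proof.
move=> mE fE; apply: L1cvg_lim; first exact: L1_indic.
move=> tau tau0; have t2 : 0 < tau / 2 by rewrite divr_gt0.
have fE' : lstar (E : set 'rV[R]_d) \is a fin_num by rewrite ge0_fin_numE // lstar_ge0.
have [_ [ab Eab <-] sab] := lb_ereal_inf_adherent t2 fE'.
rewrite -/(lstar _) in sab.
pose B k : set T := box (ab k).1 (ab k).2.
have mB k : measurable (B k) by exact: measurable_box.
have muB k : (mu (B k) <= (boxvol (ab k).1 (ab k).2)%:E)%E by rewrite muE; exact: lstar_box.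
have sfin : (\sum_(k <oo) (boxvol (ab k).1 (ab k).2)%:E < +oo)%E.
  by apply: lt_trans sab _; rewrite lte_add_pinfty // ltry.
have := nneseries_tail_cvg sfin (fun k _ => _).
move=> /(_ (fun k => _)) tailcvg.
have {}tailcvg : (\sum_(N <= k <oo) (boxvol (ab k).1 (ab k).2)%:E)%E @[N --> \oo] --> (0 : \bar R)%E.
  by apply: tailcvg => k; rewrite lee_fin boxvol_ge0.
have [N HN] : exists N, (\sum_(N <= k <oo) (boxvol (ab k).1 (ab k).2)%:E <= (tau / 2)%:E)%E by exact: cvge0_small.
pose U := \bigcup_k B k; pose UN := \big[setU/set0]_(k < N) B k.
exists (\1_UN : 'rV[R]_d -> R); first exact: L1cvg_boxes.
have mU : measurable U by exact: bigcupT_measurable.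
have mUN : measurable UN by exact: bigsetU_measurable.
have EU : E `<=` U by [].
have -> : tau%:E = ((tau / 2)%:E + (tau / 2)%:E)%E by rewrite -EFinD; congr (_%:E); field.
apply: (le_trans (@nrm1_triangle _ (\1_(U `\` E)) (\1_(U `\` UN)) _ _ _)).
- by apply: measurable_indic; exact: measurableD.
- by apply: measurable_indic; exact: measurableD.
- move=> x; rewrite !indicE !in_setD.
  have hE : x \in E -> x \in U by rewrite !inE; exact: EU.
  have hU : x \in UN -> x \in U.
    by rewrite !inE /UN -bigcup_mkord => -[k _ ?]; exists k.
  move: hE hU; case: (x \in E); case: (x \in UN); case: (x \in U) => //= h1 h2;
    rewrite ?(h1 isT) ?(h2 isT) //; try (by have := h1 isT); try (by have := h2 isT);
    rewrite ?subrr ?subr0 ?sub0r ?normrN ?normr1 ?normr0 ?addr0 ?add0r //.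
apply: leeD.
- rewrite nrm1_indic; last exact: measurableD.
  have EUt : (mu U <= mu E + (tau / 2)%:E)%E.
    apply: le_trans (ltW sab).
    apply: (le_trans (outer_measure_sigma_subadditive (@lstar R d) B)).
    by apply: lee_nneseries => // k _; exact: muB.
  have fU : (mu U < +oo)%E by rewrite (le_lt_trans EUt) // lte_add_pinfty // ltry.
  rewrite measureD // setIidr // leeBlDl //.
- rewrite nrm1_indic; last exact: measurableD.
  apply: le_trans HN.
  apply: (@le_trans _ _ (mu (\bigcup_(k in ~` `I_N) B k))).
    apply: le_measure; rewrite ?inE; [exact: measurableD|exact: bigcup_measurable|].
    move=> x [[k _ Bx] nx]; exists k => // kN; apply: nx.
    by rewrite /UN -bigcup_mkord; exists k.
  apply: (le_trans (outer_measure_sigma_subadditive_tail (@lstar R d) N _)).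
  apply: lee_nneseries => // k _; exact: muB.
Qed.

Lemma L1cvg_sfun (g : {sfun T >-> R}) : L1 (g : 'rV[R]_d -> R) -> L1cvg (g : 'rV[R]_d -> R).
Proof.
move=> Lg.
rewrite (_ : (g : 'rV[R]_d -> R) = fun x => \sum_(y <- finmap.enum_fset (fset_set (range g))) y * \1_(g @^-1` [set y]) x); last first.
  by apply/funext => x; rewrite fimfunE fsbig_finite.
apply: L1cvg_sum => y.
have [->|y0] := eqVneq y 0.
  by under eq_fun do rewrite mul0r; exact: L1cvg0.
have my : measurable (g @^-1` [set y] : set T) by [].
apply: L1cvgZ; apply: L1cvg_indic => //.
have := L1_nrm1 Lg; apply: contraTT; rewrite -!leNgt !leye_eq => /eqP muy.
rewrite -leye_eq.
apply: (@le_trans _ _ (\int[mu]_(x in g @^-1` [set y]) `|y|%:E)%E).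
  have -> := @integral_cst _ T R mu _ my `|y|%:E.
  by move: muy => /= ->; rewrite gt0_muley // lte_fin normr_gt0.
rewrite /nrm1 integral_mkcond; apply: le_int => x _.
  by rewrite /patch; case: ifPn => // _.
by rewrite /patch; case: ifPn => [/set_mem /= <-|_]; rewrite ?lee_fin.
Qed.

Lemma L1_L1cvg F : L1 F -> L1cvg F.
Proof.
move=> LF; apply: L1cvg_lim => // tau tau0.
have [g [Lg _ gcvg]] := approximation_sfun_integrable measurableT LF.
have [n] : exists n, (\int[mu]_x `|(F x)%:E - (g n x)%:E| <= tau%:E)%E by exact: cvge0_small.
move=> Hn; exists (g n : 'rV[R]_d -> R); last exact: Hn.
by apply: L1cvg_sfun; exact: Lg.
Qed.

End L1_convergence.

(** * Poincare inequalities *)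

Lemma is_derive_line {R : realType} {V : normedModType R} (w : V -> R) (y v : V) (t l : R) :
  is_derive (y + t *: v) v w l -> is_derive t 1 (fun s : R => w (y + s *: v)) l.
Proof.
move=> [dw Dw].
have E : (fun h : R => h^-1 *: (((fun s : R => w (y + s *: v)) \o shift t) (h *: (1 : R)) - w (y + t *: v))) =
  (fun h : R => h^-1 *: ((w \o shift (y + t *: v)) (h *: v) - w (y + t *: v))).
  apply/funext => h /=; congr (_ *: (w _ - _)).
  by rewrite scalerDl addrCA [h *: 1]mulr1.
by split; [rewrite /derivable E|rewrite /derive E].
Qed.

Section poincare.
Context {R : realType} {d' : nat}.
Local Notation d := d'.+1.
Local Notation T := (vec R d').
Local Notation mu := (@mu R d').
Local Notation leb := (@lebesgue_measure R).
Implicit Types (w u : 'rV[R]_d -> R) (H G : 'I_d -> 'rV[R]_d -> R) (x y c : 'rV[R]_d).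

(** The gradient is a datum, and derivatives in all directions are demanded, since the fundamental
    theorem of calculus is used along segments and the chain rule under cut-offs. *)
Definition C1 u G := [/\ continuous u, forall i, continuous (G i) &
  forall x h, is_derive x h u (\sum_(i < d) h ord0 i * G i x)].

Definition gsum G x : R := \sum_(i < d) `|G i x|.

Lemma gsum_ge0 G x : 0 <= gsum G x.
Proof. by apply: sumr_ge0. Qed.

Lemma gsum_continuous G : (forall i, continuous (G i)) -> continuous (gsum G).
Proof.
move=> cG x; apply: continuous_big; first exact: add_continuous.
by move=> i _ y; exact: (cvg_norm (cG i y)).
Qed.

Lemma abs_dot_le (h : 'rV[R]_d) G x : `|\sum_(i < d) h ord0 i * G i x| <= `|h| * gsum G x.
Proof.
apply: (le_trans (ler_norm_sum _ _ _)); rewrite /gsum mulr_sumr; apply: ler_sum => i _.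
by rewrite normrM ler_wpM2r // coord_le_norm.
Qed.

(** Splitting a segment at its midpoint lets each half be parametrised with the opposite endpoint
    fixed and a dilation factor t >= 1/2, so the change of variables costs at most 2^d. With the
    whole segment t would come near 0, where t^(-d) is not integrable. *)
Definition mid x y : 'rV[R]_d := 2^-1 *: (x + y).

Let I12 : set R := `[2^-1, 1]%classic.

Lemma line_continuous (f : 'rV[R]_d -> R) (y v : 'rV[R]_d) :
  continuous f -> continuous (fun t : R => f (y + t *: v)).
Proof.
move=> cf t; apply: (@continuous_comp _ _ _ (fun t : R => y + t *: v) f); last exact: cf.
apply: cvgD; first exact: cvg_cst.
exact: (cvgZr_tmp (cvg_id)).
Qed.

Lemma line_bound w H x y : C1 w H ->
  (`|w x - w (mid x y)|%:E <=
    \int[leb]_(t in I12) (`|(x - y)%R| * gsum H (y + t *: (x - y)))%:E)%E.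
Proof.
move=> [cw cH dw]; set v := x - y.
pose phi (t : R) := w (y + t *: v).
pose psi (t : R) := \sum_(i < d) v ord0 i * H i (y + t *: v).
have dphi (t : R) : is_derive t 1 phi (psi t) by apply: is_derive_line; exact: dw.
have cphi : continuous phi by exact: line_continuous.
have cpsi : continuous psi.
  apply: continuous_big; [exact: add_continuous|move=> i _ t].
  apply: cvgM; first exact: cvg_cst.
  exact: (line_continuous (cH i)).
have e1 : phi 1 = w x by rewrite /phi /v scale1r addrC subrK.
have e2 : phi (2^-1) = w (mid x y).
  by rewrite /phi /mid /v; congr w; apply/rowP => i; rewrite !mxE; field.
have h12 : 2^-1 < 1 :> R by rewrite invf_lt1 // ltr1n.
have mI : measurable I12 by exact: measurable_itv.
rewrite -e1 -e2 -abse_EFin EFinB -(@continuous_FTC2 _ psi phi _ _ h12); first last.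
- by move=> t _; have := @derive_val _ _ _ _ _ _ _ (dphi t); rewrite derive1E.
- split.
  + by move=> t _; have [] := dphi t.
  + by apply: cvg_at_right_filter; exact: cphi.
  + by apply: cvg_at_left_filter; exact: cphi.
- exact: continuous_subspaceT.
have mpsi : measurable_fun I12 (EFin \o psi).
  apply/measurable_EFinP; apply: measurable_funTS.
  exact: continuous_measurable_fun.
apply: (le_trans (le_abse_integral leb mI mpsi)).
by apply: le_int => t _ //=; rewrite lee_fin abs_dot_le.
Qed.

Lemma cube_convex c r x y (t : R) : cube c r x -> cube c r y -> 0 <= t <= 1 ->
  cube c r (t *: x + (y - t *: y)).
Proof.
move=> xc yc /andP[t0 t1]; rewrite /cube /=.
have -> : t *: x + (y - t *: y) - c = t *: (x - c) + (1 - t) *: (y - c).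
  by apply/rowP => i; rewrite !mxE; ring.
have t1' : 0 <= 1 - t by rewrite subr_ge0.
apply: (le_lt_trans (ler_normD _ _)); rewrite !normrZ (ger0_norm t0) (ger0_norm t1').
move: xc yc; rewrite /cube /=; set a := `|x - c|; set b := `|y - c| => xc yc.
have [->|t0'] := eqVneq t 0; first by rewrite mul0r add0r subr0 mul1r.
have h1 : t * a < t * r by rewrite ltr_pM2l // lt_def t0'.
have h2 : (1 - t) * b <= (1 - t) * r by rewrite ler_wpM2l // ltW.
by rewrite (_ : r = t * r + (1 - t) * r) ?ltr_leD //; ring.
Qed.

Lemma measurable_indicT c r : measurable_fun setT (\1_(cube c r) : T -> R).
Proof. by apply: measurable_indic; exact: measurable_cube. Qed.

(** The contraction towards y maps the cube into itself by convexity, and its Jacobian t^d is at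
    least 2^(-d). *)
Lemma star_int c r y t (P : 'rV[R]_d -> R) : I12 t -> cube c r y ->
  measurable_fun setT (P : T -> R) -> (forall x, 0 <= P x) ->
  (\int[mu]_x (\1_(cube c r) (x : 'rV[R]_d) * P (y + t *: ((x : 'rV[R]_d) - y)))%:E <=
   (2 ^+ d)%:E * \int[mu]_x (\1_(cube c r) x * P x)%:E)%E.
Proof.
rewrite /I12 /= in_itv /= => /andP[th t1] yc mP P0.
have t0 : 0 < t by rewrite (lt_le_trans _ th) // invr_gt0.
have mF : measurable_fun setT (fun x : T => (\1_(cube c r) x * P x)%:E).
  by apply/measurable_EFinP; apply: measurable_funM => //; exact: measurable_indicT.
have F0 x : (0 <= (\1_(cube c r) x * P x)%:E)%E by rewrite lee_fin mulr_ge0.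
apply: (@le_trans _ _ (\int[mu]_x (\1_(cube c r) (t *: (x : 'rV[R]_d) + (y - t *: y)) * P (t *: (x : 'rV[R]_d) + (y - t *: y)))%:E)%E).
  apply: le_int => x _; first by rewrite lee_fin mulr_ge0.
  have -> : y + t *: (x - y) = t *: x + (y - t *: y) by apply/rowP => i; rewrite !mxE; ring.
  rewrite lee_fin ler_wpM2r // !indicE.
  case: (boolP (x \in cube c r)) => // /set_mem xc.
  by rewrite mem_set //; apply: cube_convex => //; rewrite (ltW t0).
rewrite (@int_affine _ _ (fun x => (\1_(cube c r) x * P x)%:E) t (y - t *: y) t0 mF F0).
rewrite lee_wpmul2r //; first by apply: integral_ge0 => x _; exact: F0.
rewrite lee_fin -exprVn; apply: lerXn2r; rewrite ?nnegrE ?invr_ge0 ?(ltW t0) //.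
by rewrite -[leRHS]invrK lef_pV2 ?posrE ?invr_gt0.
Qed.

Lemma measurable_pair_continuous (f : 'rV[R]_d -> R) (a b : R) : continuous f ->
  measurable_fun setT (fun z : T * T => f (a *: (z.1 : 'rV[R]_d) + b *: (z.2 : 'rV[R]_d))).
Proof.
move=> cf; apply: (@measurable_comp_continuous _ _ _ (T * T)%type (fun z => a *: (z.1 : 'rV[R]_d) + b *: (z.2 : 'rV[R]_d)) _ f cf).
move=> i; rewrite (_ : (fun s => _) = (fun s : T * T => a * (s.1 : 'rV[R]_d) ord0 i + b * (s.2 : 'rV[R]_d) ord0 i)); last first.
  by apply/funext => s; rewrite !mxE.
apply: measurable_funD; apply: measurable_funM.
- exact: measurable_cst.
- exact: (measurableT_comp (measurable_coord i) measurable_fst).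
- exact: measurable_cst.
- exact: (measurableT_comp (measurable_coord i) measurable_snd).
Qed.

Lemma half_poincare c r w H y : C1 w H -> 0 < r -> cube c r y ->
  (\int[mu]_x (\1_(cube c r) x * `|w x - w (mid x y)|)%:E <=
    (r * 2 ^+ d)%:E * \int[mu]_x (\1_(cube c r) x * gsum H x)%:E)%E.
Proof.
move=> CH r0 yc; have [cw cH dw] := CH; set Q := cube c r.
have cg := gsum_continuous cH.
have mI : measurable I12 by exact: measurable_itv.
(* The factor 2 * r bounds |x - y| in the cube; the length 1/2 of [I12] will reduce it to r. *)
pose f (z : T * R) := (\1_Q z.1 * (\1_I12 z.2 * (2 * r * gsum H (y + z.2 *: ((z.1 : 'rV[R]_d) - y)))))%:E.
have f0 z : (0 <= f z)%E.
  by rewrite lee_fin !mulr_ge0 ?gsum_ge0 // ltW.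
have mf : measurable_fun setT f.
  apply/measurable_EFinP; apply: measurable_funM.
    exact: (measurableT_comp (measurable_indicT c r) measurable_fst).
  apply: measurable_funM.
    exact: (measurableT_comp (measurable_indic mI) measurable_snd).
  apply: measurable_funM; first exact: measurable_cst.
  apply: (@measurable_comp_continuous _ _ _ (T * R)%type (fun z => y + z.2 *: ((z.1 : 'rV[R]_d) - y)) _ _ cg).
  move=> i; rewrite (_ : (fun s => _) = (fun s : T * R => y ord0 i + s.2 * ((s.1 : 'rV[R]_d) ord0 i - y ord0 i))); last first.
    by apply/funext => s; rewrite !mxE.
  apply: measurable_funD; first exact: measurable_cst.
  apply: measurable_funM; first exact: measurable_snd.
  apply: measurable_funB; last exact: measurable_cst.
  exact: (measurableT_comp (measurable_coord i) measurable_fst).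
apply: (@le_trans _ _ (\int[mu]_x \int[leb]_t f (x, t))%E).
  apply: le_int => x _; first by rewrite lee_fin mulr_ge0.
  rewrite indicE; case: (boolP (x \in Q)) => [/set_mem xc|_] /=; last first.
    by rewrite mul0r; apply: integral_ge0 => t _; exact: f0.
  rewrite mul1r; apply: (le_trans (line_bound x y CH)).
  rewrite int_indicE; apply: le_int => t _; first by rewrite lee_fin !mulr_ge0 ?gsum_ge0.
  rewrite /f lee_fin /= (indicE _ Q) mem_set // mul1r ler_wpM2l // ler_wpM2r ?gsum_ge0 //.
  rewrite (_ : x - y = (x - c) - (y - c)); last by rewrite opprB addrA subrK.
  apply: (le_trans (ler_normB _ _)); rewrite mulr2n mulrDl mul1r.
  by apply: lerD; apply: ltW.
rewrite (@fubini_tonelli _ _ _ _ _ mu leb f mf f0).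
apply: (@le_trans _ _ (\int[leb]_(t in I12) ((2 * r * 2 ^+ d)%:E * \int[mu]_x (\1_(cube c r) x * gsum H x)%:E))%E).
  rewrite [leRHS]integral_mkcond; apply: le_int => t _; first by apply: integral_ge0 => x _; exact: f0.
  rewrite /patch; case: ifPn => tI; last first.
    rewrite integral0_eq // => x _.
    by rewrite /f /= (indicE _ I12) (negbTE tI) mul0r mulr0.
  have := star_int (set_mem tI) yc (measurable_continuous cg) (gsum_ge0 H).
  rewrite -(@lee_pmul2l _ (2 * r)%:E) ?lte_fin ?mulr_gt0 // muleA -EFinM; apply: le_trans.
  rewrite -ge0_integralZl_EFin; first last.
  - by rewrite mulr_ge0 // ltW.
  - apply/measurable_EFinP; apply: measurable_funM; first exact: measurable_indicT.
    rewrite (_ : (fun x => _) = (fun x => gsum H (t *: x + (y - t *: y)))).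
      apply: (measurableT_comp (measurable_continuous cg)).
      apply: measurable_affine.
      by move: (set_mem tI); rewrite /I12 /= in_itv /= => /andP[h _]; rewrite (lt_le_trans _ h) // invr_gt0.
    by apply/funext => x; congr (gsum H); apply/rowP => i; rewrite !mxE; ring.
  - by move=> x _; rewrite lee_fin mulr_ge0 ?gsum_ge0.
  - exact: measurableT.
  apply: le_int => x _; first exact: f0.
  by rewrite /f /= (indicE _ I12) tI mul1r -EFinM lee_fin mulrCA.
rewrite integral_cst //.
rewrite [X in (_ * X <= _)%E](_ : _ = (2^-1)%:E); last first.
  apply: etrans (lebesgue_measure_itv `[2^-1 : R, 1]) _.
  rewrite /= lte_fin invf_lt1 // ltr1n -EFinD.
  by congr (_%:E); field.
rewrite muleAC -EFinM lee_wpmul2r //.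
  by apply: integral_ge0 => x _; rewrite lee_fin mulr_ge0 // gsum_ge0.
by rewrite lee_fin le_eqVlt; apply/orP; left; apply/eqP; field.
Qed.

(** The midpoint is inserted between x and y, and the two halves are symmetric. The double integral
    contains no mean value of w: in the applications one variable is restricted to the zero set of
    the function, or to a smaller cube. *)
Lemma poincare2 c r w H : C1 w H -> 0 < r ->
  (\int[mu]_x \int[mu]_y (\1_(cube c r) x * (\1_(cube c r) y * `|w x - w y|))%:E <=
   (2 * (r * 2 ^+ d) * (@mu1 R d' * r ^+ d))%:E * \int[mu]_x (\1_(cube c r) x * gsum H x)%:E)%E.
Proof.
move=> CH r0; have [cw cH dw] := CH; set Q := cube c r.
set K := (\int[mu]_x (\1_Q x * gsum H x)%:E)%E.
have K0 : (0 <= K)%E by apply: integral_ge0 => x _; rewrite lee_fin mulr_ge0 // gsum_ge0.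
pose f (z : T * T) := (\1_Q z.1 * (\1_Q z.2 * `|w z.1 - w (mid z.1 z.2)|))%:E.
have f0 z : (0 <= f z)%E by rewrite lee_fin !mulr_ge0.
have mQ1 : measurable_fun setT (fun z : T * T => \1_Q z.1 : R).
  exact: (measurableT_comp (measurable_indicT c r) measurable_fst).
have mQ2 : measurable_fun setT (fun z : T * T => \1_Q z.2 : R).
  exact: (measurableT_comp (measurable_indicT c r) measurable_snd).
have mw1 : measurable_fun setT (fun z : T * T => w z.1 : R).
  exact: (measurableT_comp (measurable_continuous cw) measurable_fst).
have mf : measurable_fun setT f.
  apply/measurable_EFinP; apply: measurable_funM => //; apply: measurable_funM => //.
  apply: measurableT_comp => //; apply: measurable_funB => //.
  have := measurable_pair_continuous 2^-1 2^-1 cw.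
  by congr (measurable_fun _ _); apply/funext => z; rewrite /mid scalerDr.
have mf' : measurable_fun setT (fun z => f (z.2, z.1)).
  by apply: (measurableT_comp mf); exact: measurable_swap.
have half y : (\int[mu]_x f (x, y) <= (\1_Q y)%:E * ((r * 2 ^+ d)%:E * K))%E.
  rewrite indicE; case: (boolP (y \in Q)) => [/set_mem yc|yQ] /=.
    rewrite mul1e; apply: le_trans (half_poincare CH r0 yc).
    apply: le_int => x _; first exact: f0.
    by rewrite /f /= (indicE _ _ y) mem_set // mul1r.
  rewrite mul0e integral0_eq // => x _.
  by rewrite /f /= (indicE _ _ y) (negbTE yQ) mul0r mulr0.
have fin : (\int[mu]_y ((\1_Q y)%:E * ((r * 2 ^+ d)%:E * K)) = ((r * 2 ^+ d) * (@mu1 R d' * r ^+ d))%:E * K)%E.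
  have rd0 : (0 <= (r * 2 ^+ d)%:E)%E by rewrite lee_fin mulr_ge0 // ltW.
  rewrite ge0_integralZr; [|exact: measurableT| |by move=> x _; rewrite lee_fin|exact: mule_ge0].
    rewrite integral_indic ?setIT; [|exact: measurableT|exact: measurable_cube].
    by rewrite [X in (X * _)%E](mu_cube c r0) muleA -EFinM mulrC.
  by apply/measurable_EFinP; exact: measurable_indicT.
have m1 (g : T * T -> \bar R) : measurable_fun setT g -> (forall z, 0 <= g z)%E ->
  measurable_fun setT (fun x : T => \int[mu]_(y in [set: T]) g (x, y))%E.
  by move=> mg g0; exact: (@measurable_fun_fubini_tonelli_F _ _ _ _ _ mu g mg g0).
have m2 (x : T) (g : T * T -> \bar R) : measurable_fun setT g -> measurable_fun setT (fun y : T => g (x, y)).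
  by move=> mg; exact: (measurableT_comp mg (pair1_measurable x)).
apply: (@le_trans _ _ (\int[mu]_x (\int[mu]_y f (x, y) + \int[mu]_y f (y, x)))%E).
  apply: le_int => x _.
    by apply: integral_ge0 => y _; rewrite lee_fin !mulr_ge0.
  rewrite -ge0_integralD; first last.
  - exact: (m2 x _ mf').
  - by move=> y _; exact: f0.
  - exact: (m2 x _ mf).
  - by move=> y _; exact: f0.
  - exact: measurableT.
  apply: le_int => y _; first by rewrite lee_fin !mulr_ge0.
  rewrite /f /= -EFinD lee_fin [X in _ <= _ + X]mulrCA -mulrDr -mulrDr.
  rewrite ler_wpM2l // ler_wpM2l //.
  rewrite (_ : mid y x = mid x y); last by rewrite /mid addrC.
  by rewrite [X in _ <= _ + X]distrC; exact: ler_distD.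
rewrite ge0_integralD; first last.
- exact: (m1 _ mf').
- by move=> x _; apply: integral_ge0 => y _; exact: f0.
- exact: (m1 _ mf).
- by move=> x _; apply: integral_ge0 => y _; exact: f0.
- exact: measurableT.
have -> : (2 * (r * 2 ^+ d) * (@mu1 R d' * r ^+ d))%:E = (((r * 2 ^+ d) * (@mu1 R d' * r ^+ d))%:E + ((r * 2 ^+ d) * (@mu1 R d' * r ^+ d))%:E)%E.
  by rewrite -EFinD; congr (_%:E); ring.
have C0 : (0 <= ((r * 2 ^+ d) * (@mu1 R d' * r ^+ d))%:E)%E.
  by rewrite lee_fin !mulr_ge0 ?exprn_ge0 ?mu1_ge0 // ltW.
rewrite ge0_muleDl // -fin; apply: leeD.
  rewrite (@fubini_tonelli _ _ _ _ _ mu mu f mf f0).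
  by apply: le_int => y _; [apply: integral_ge0 => x _; exact: f0|exact: half].
by apply: le_int => y _; [apply: integral_ge0 => x _; exact: f0|exact: half].
Qed.

End poincare.

Lemma is_derive_from_line {R : realType} {V : normedModType R} (w : V -> R) (y v : V) (l : R) :
  is_derive (0 : R) 1 (fun s : R => w (y + s *: v)) l -> is_derive y v w l.
Proof.
move=> [dw Dw].
have E : (fun h : R => h^-1 *: (((fun s : R => w (y + s *: v)) \o shift 0) (h *: (1 : R)) - w (y + 0 *: v))) =
  (fun h : R => h^-1 *: ((w \o shift y) (h *: v) - w y)).
  apply/funext => h /=; rewrite scale0r !addr0; congr (_ *: (w _ - _)).
  by rewrite [h *: 1]mulr1 addrC.
by split; [rewrite /derivable -E|rewrite /derive -E].
Qed.

Section arith.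
Context {R : realType}.

Let pow_neq0 (x : R) n : 0 < x -> x ^+ n != 0.
Proof. by move=> x0; rewrite expf_neq0 // gt_eqF. Qed.

(** The identities of this section balance the powers of the radius against volumes of cubes in
    [weighted_poincare]. *)
Lemma lower_average_const (m L r w : R) n : 0 < r ->
  m * L ^+ n / 2 ^+ (n + n).+1 * (w / r) = (2 * r)^-1 ^+ n.+1 * w * (m * (L / 2 * r) ^+ n).
Proof.
move=> r0; rewrite exprVn !exprMn exprVn !exprS exprD.
have := pow_neq0 n r0; have := @pow_neq0 2 n (ltr0Sn R 1); move: r0 => /gt_eqF/negbT.
by move: (2 ^+ n) (r ^+ n) (L ^+ n) => a b c r0 a0 b0; field; rewrite r0 a0 b0.
Qed.

Lemma upper_average_const (m L r g : R) n : 0 < r ->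
  4 * L * 2 ^+ n * ((2 ^+ (n + n)) * L ^+ n * m) * g =
  4 * L * 2 ^+ n * ((r / 2)^-1 ^+ n * g) * (m * (2 * L * r) ^+ n).
Proof.
move=> r0; rewrite exprVn !exprMn exprVn exprD.
have := pow_neq0 n r0; have := @pow_neq0 2 n (ltr0Sn R 1).
by move: (2 ^+ n) (r ^+ n) (L ^+ n) => a b c a0 b0; field; rewrite a0 b0.
Qed.

Lemma average_const_ratio (m L : R) n : 0 < L -> 0 < m ->
  (m * L ^+ n / 2 ^+ (n + n).+1)^-1 * (4 * L * 2 ^+ n * ((2 ^+ (n + n)) * L ^+ n * m)) =
  8 * 32 ^+ n * L.
Proof.
move=> L0 m0; have -> : 32 = 2 * 2 * 2 * 2 * 2 :> R by ring.
rewrite !exprMn exprS exprD.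
have := pow_neq0 n L0; have := @pow_neq0 2 n (ltr0Sn R 1); move: m0 => /gt_eqF/negbT.
by move: (2 ^+ n) (L ^+ n) => a b m0 a0 b0; field; rewrite m0 a0 b0.
Qed.

End arith.

(** * A Poincare inequality weighted by a slowly varying radius *)

Section weighted_poincare.
Context {R : realType} {d' : nat}.
Local Notation d := d'.+1.
Local Notation T := (vec R d').
Local Notation mu := (@mu R d').
Hypothesis m0 : 0 < @mu1 R d'.
Implicit Types (w u : 'rV[R]_d -> R) (H G : 'I_d -> 'rV[R]_d -> R) (x y c : 'rV[R]_d).

Lemma C1_comp u G (th dth : R -> R) : C1 u G ->
  (forall s : R, is_derive s 1 th (dth s)) -> continuous dth ->
  C1 (fun x => th (u x)) (fun i x => dth (u x) * G i x).
Proof.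
move=> [cu cG du] dt cdt; split.
- move=> x; apply: (@continuous_comp _ _ _ u th); first exact: cu.
  by apply: differentiable_continuous; apply/derivable1_diffP; have [] := dt (u x).
- move=> i x; apply: continuousM; last exact: cG.
  by apply: (@continuous_comp _ _ _ u dth); [exact: cu|exact: cdt].
- move=> x h; apply: is_derive_from_line.
  have du0 : is_derive (0 : R) 1 (fun s : R => u (x + s *: h)) (\sum_(i < d) h ord0 i * G i x).
    by apply: is_derive_line; rewrite scale0r addr0; exact: du.
  have dt0 : is_derive (u (x + 0 *: h)) 1 th (dth (u x)).
    by rewrite scale0r addr0; exact: dt.
  have := is_derive1_comp (f := th) (g := fun s : R => u (x + s *: h)) (x := 0) dt0 du0.
  move/is_derive_eq; apply; rewrite mulr_sumr; apply: eq_bigr => i _ /=.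
  by rewrite /GRing.scale /=; ring.
Qed.

Lemma gsum_scale (b : 'rV[R]_d -> R) G x : gsum (fun i x => b x * G i x) x = `|b x| * gsum G x.
Proof. by rewrite /gsum mulr_sumr; apply: eq_bigr => i _; rewrite normrM. Qed.

(** By Chebyshev |u| exceeds [a] on at most half of the cube, so w vanishes on the other half.
    Restricting one variable of [poincare2] to this zero set turns the difference |w x - w y| into
    |w y|. *)
Lemma vanish_poincare c r a w u H : C1 w H -> 0 < r -> 0 < a -> continuous u ->
  (forall y, `|u y| <= a -> w y = 0) ->
  (\int[mu]_y (\1_(cube c r) y * `|u y|)%:E <= (a / 2 * (@mu1 R d' * r ^+ d))%:E)%E ->
  (\int[mu]_y (\1_(cube c r) y * `|w y|)%:E <=
    (4 * (r * 2 ^+ d))%:E * \int[mu]_y (\1_(cube c r) y * gsum H y)%:E)%E.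
Proof.
move=> CH r0 a0 cu w0 hu; have [cw cH dw] := CH; set Q := cube c r.
have mQ : measurable (Q : set T) by exact: measurable_cube.
have miQ : measurable_fun setT (\1_Q : T -> R) by exact: measurable_indicT.
set V := @mu1 R d' * r ^+ d in hu *.
have V0 : 0 < V by rewrite mulr_gt0 ?exprn_gt0.
have muQ : mu Q = V%:E by exact: mu_cube.
pose Z : set T := Q `&` [set y | `|u y| <= a].
have ma : measurable ([set y | `|u y| <= a] : set T).
  rewrite (_ : [set y | `|u y| <= a] = (fun y : T => `|u y|) @^-1` `]-oo, a]%classic).
    rewrite -[X in measurable X]setTI.
    have mnu : measurable_fun setT (fun y : T => `|u y|).
      by apply: measurableT_comp => //; exact: measurable_continuous.
    exact: mnu.
  by apply/seteqP; split => y /=; rewrite in_itv.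
have mZ : measurable Z by exact: measurableI.
have hZ : (mu (Q `\` Z) <= (V / 2)%:E)%E.
  rewrite -(@lee_pmul2l _ a%:E) //.
  rewrite -EFinM (_ : a * (V / 2) = a / 2 * V); last by ring.
  apply: le_trans hu; rewrite -integral_cst; last exact: measurableD.
  rewrite (int_indicE mu (Q `\` Z) (fun=> a)); apply: le_int => y _.
    by rewrite lee_fin mulr_ge0 // ltW.
  rewrite lee_fin !indicE; have [|] := boolP (y \in Q `\` Z); last by rewrite mul0r mulr_ge0.
  rewrite inE => -[Qy nZ]; rewrite mem_set // !mul1r.
  by rewrite leNgt; apply/negP => h; apply: nZ; split=> //; exact: ltW.
have hZ2 : ((V / 2)%:E <= mu Z)%E.
  have : mu Q = (mu Z + mu (Q `\` Z))%E.
    by rewrite (measureDI mu mQ mZ) setIA setIid addeC.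
  move: hZ; rewrite muQ.
  have : (mu Z <= V%:E)%E by rewrite -muQ le_measure ?inE // => y [].
  have := measure_ge0 mu Z; have := measure_ge0 mu (Q `\` Z).
  case: (mu Z) => // z; case: (mu (Q `\` Z)) => // q; rewrite -EFinD !lee_fin => _ _ _ h [].
  by lra.
set K := (\int[mu]_y (\1_Q y * gsum H y)%:E)%E.
set K2 := (\int[mu]_y (\1_Q y * `|w y|)%:E)%E.
have K20 : (0 <= K2)%E by apply: integral_ge0 => y _; rewrite lee_fin mulr_ge0.
have main : ((V / 2)%:E * K2 <= (2 * (r * 2 ^+ d) * V)%:E * K)%E.
  apply: le_trans (poincare2 c CH r0).
  apply: (@le_trans _ _ (\int[mu]_x ((\1_Z x)%:E * K2))%E).
    rewrite ge0_integralZr; [|exact: measurableT| |by move=> x _; rewrite lee_fin|by []].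
      rewrite integral_indic ?setIT; [|exact: measurableT|exact: mZ].
      by apply: lee_wpmul2r.
    by apply/measurable_EFinP; exact: measurable_indic.
  apply: le_int => x _; first by rewrite mule_ge0 ?lee_fin.
  rewrite /K2 -ge0_integralZl_EFin; first last.
  - by [].
  - apply/measurable_EFinP; apply: measurable_funM => //.
    by apply: measurableT_comp => //; exact: measurable_continuous.
  - by move=> y _; rewrite lee_fin mulr_ge0.
  - exact: measurableT.
  apply: le_int => y _; first by rewrite -EFinM lee_fin !mulr_ge0.
  rewrite -EFinM lee_fin (indicE _ Z); have [|] := boolP (x \in Z); last by rewrite mul0r !mulr_ge0.
  by rewrite inE => -[Qx ux]; rewrite (indicE _ _ x) mem_set // !mul1r (w0 x ux) sub0r normrN.
have V20 : 0 < V / 2 by rewrite divr_gt0.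
rewrite -(@lee_pmul2l _ (V / 2)%:E) // muleA -EFinM (_ : V / 2 * _ = 2 * (r * 2 ^+ d) * V) //.
by field.
Qed.

Variables (L : R) (rho : 'rV[R]_d -> R).
Hypotheses (L1 : 1 <= L) (rho0 : forall x, 0 < rho x)
  (rho_lip : forall x y, 4 * L * `|rho x - rho y| <= `|x - y|).

Lemma rho_continuous : continuous rho.
Proof.
move=> x; apply: (@continuous_at_lip _ _ _ _ 1) => // y _.
have := rho_lip y x; have : `|rho y - rho x| <= L * `|rho y - rho x| by rewrite ler_peMl.
have := normr_ge0 (rho y - rho x); lra.
Qed.

Lemma rho_inv_continuous n : continuous (fun x => (rho x)^-1 ^+ n).
Proof.
move=> x; apply: (@continuous_comp _ _ _ (fun x => (rho x)^-1) (fun t => t ^+ n)).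
  apply: continuousV; last exact: rho_continuous.
  by rewrite gt_eqF.
exact: exprn_continuous.
Qed.

(** A displacement by 2 * L * rho y changes [rho] by less than half of rho y; this is the purpose of
    the Lipschitz constant 1 / (4 * L). *)
Lemma rho_comparable x y : `|y - x| < 2 * L * rho y -> rho x <= 2 * rho y /\ rho y <= 2 * rho x.
Proof.
move=> h; have := rho_lip x y; rewrite distrC => h2.
have L0 : 0 < L by rewrite (lt_le_trans ltr01).
have : `|rho y - rho x| < rho y / 2.
  rewrite -(@ltr_pM2l _ (4 * L)) ?mulr_gt0 // (le_lt_trans h2) // distrC (lt_le_trans h) //.
  by rewrite le_eqVlt; apply/orP; left; apply/eqP; field.
rewrite ltr_norml => /andP[h3 h4]; have := rho0 y; have := rho0 x; split; lra.
Qed.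

(* The indicator of [z.2 \in cube z.1 (L * rho z.1)], in a visibly jointly measurable form. *)
Definition near (z : T * T) : R := \1_(`]0, +oo[%classic) (L * rho z.1 - `|(z.2 : 'rV[R]_d) - z.1|).

Lemma near_indic x y : near (x, y) = \1_(cube x (L * rho x)) y.
Proof.
rewrite /near /= !indicE; congr ((nat_of_bool _)%:R).
by apply/idP/idP; rewrite !inE /cube /= in_itv /= andbT subr_gt0.
Qed.

Lemma measurable_near : measurable_fun setT near.
Proof.
apply: (measurableT_comp (f := (\1_(`]0, +oo[%classic) : R -> R))).
  by apply: measurable_indic; exact: measurable_itv.
apply: measurable_funB.
  apply: measurable_funM => //.
  exact: (measurableT_comp (measurable_continuous rho_continuous) measurable_fst).
have := @measurable_pair_continuous R d' (fun x => `|x|) (-1) 1 (@norm_continuous _ _).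
congr (measurable_fun _ _); apply/funext => z.
by rewrite scaleN1r scale1r addrC.
Qed.

Lemma near_lower x y : `|x - y| < L / 2 * rho y -> near (x, y) = 1.
Proof.
move=> h; rewrite near_indic indicE mem_set // /cube /=.
have L0 : 0 < L by rewrite (lt_le_trans ltr01).
have r0 := rho0 y.
have h4 : L / 2 * rho y <= 2 * L * rho y.
  by rewrite ler_pM2r //; lra.
have := @rho_comparable x y _; rewrite distrC => /(_ (lt_le_trans h h4))[_ hh].
rewrite (lt_le_trans h) //.
have -> : L / 2 * rho y = L * (rho y / 2) by ring.
by rewrite ler_pM2l // ; lra.
Qed.

Lemma near_upper x y : near (x, y) <= \1_(cube y (2 * L * rho y)) x.
Proof.
rewrite near_indic indicE; case: (boolP (y \in _)) => // /set_mem; rewrite /cube /= => h.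
have L0 : 0 < L by rewrite (lt_le_trans ltr01).
have : rho x <= 2 * rho y.
  have := rho_lip x y; rewrite distrC => h2.
  have : `|rho y - rho x| < rho x / 4.
    rewrite -(@ltr_pM2l _ (4 * L)) ?mulr_gt0 // (le_lt_trans h2) // distrC (lt_le_trans h) //.
    by rewrite le_eqVlt; apply/orP; left; apply/eqP; field.
  rewrite ltr_norml => /andP[h3 h4]; have := rho0 y; have := rho0 x; lra.
move=> hr; rewrite indicE mem_set //= distrC (lt_le_trans h) //.
by rewrite (_ : 2 * L * rho y = L * (2 * rho y)) ?ler_pM2l //; ring.
Qed.

(** [vanish_poincare] on the cube of half side L * rho x about x is multiplied by (rho x)^(-d-1) and
    integrated in x. After exchanging the integrals, the slow variation of [rho] turns the inner
    ones into constants times |w y| / rho y on the left and the gradient at y on the right. *)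
Lemma weighted_poincare a w u H : C1 w H -> 0 < a -> continuous u ->
  (forall y, `|u y| <= a -> w y = 0) ->
  (forall x, \int[mu]_y (\1_(cube x (L * rho x)) y * `|u y|)%:E <=
     (a / 2 * (@mu1 R d' * (L * rho x) ^+ d))%:E)%E ->
  (\int[mu]_y (`|w y| / rho y)%:E <=
    (8 * 32 ^+ d * L)%:E * \int[mu]_y (gsum H y)%:E)%E.
Proof.
move=> CH a0 cu w0 hu; have [cw cH dw] := CH.
have L0 : 0 < L by rewrite (lt_le_trans ltr01).
have cg := gsum_continuous cH.
pose f (z : T * T) := ((rho z.1)^-1 ^+ d.+1 * (near z * `|w z.2|))%:E.
pose g (z : T * T) := (4 * L * 2 ^+ d * ((rho z.1)^-1 ^+ d * (near z * gsum H z.2)))%:E.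
have near0 z : 0 <= near z by [].
have mr n : measurable_fun setT (fun z : T * T => (rho z.1)^-1 ^+ n).
  have cr := rho_inv_continuous (n := n).
  exact: (measurableT_comp (measurable_continuous cr) measurable_fst).
have rn n x : 0 <= (rho x)^-1 ^+ n by rewrite exprn_ge0 // invr_ge0 ltW.
have f0 z : (0 <= f z)%E by rewrite lee_fin mulr_ge0 ?rn // mulr_ge0.
have hc : 0 <= 4 * L * 2 ^+ d by rewrite mulr_ge0 ?exprn_ge0 // mulr_ge0 // ltW.
have g0 z : (0 <= g z)%E by rewrite lee_fin mulr_ge0 // mulr_ge0 ?rn // mulr_ge0 // gsum_ge0.
have mf : measurable_fun setT f.
  apply/measurable_EFinP; apply: measurable_funM; first exact: mr.
  apply: measurable_funM; first exact: measurable_near.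
  apply: measurableT_comp => //.
  exact: (measurableT_comp (measurable_continuous cw) measurable_snd).
have mg : measurable_fun setT g.
  apply/measurable_EFinP; apply: measurable_funM; first exact: measurable_cst.
  apply: measurable_funM; first exact: mr.
  apply: measurable_funM; first exact: measurable_near.
  exact: (measurableT_comp (measurable_continuous cg) measurable_snd).
have fg : (\int[mu]_y \int[mu]_x f (x, y) <= \int[mu]_y \int[mu]_x g (x, y))%E.
  rewrite -(@fubini_tonelli _ _ _ _ _ mu mu f mf f0) -(@fubini_tonelli _ _ _ _ _ mu mu g mg g0).
  apply: le_int => x _; first by apply: integral_ge0 => y _; exact: f0.
  have := vanish_poincare CH (mulr_gt0 L0 (rho0 x)) a0 cu w0 (hu x).
  rewrite -(@lee_pmul2l _ ((rho x)^-1 ^+ d.+1)%:E) ?lte_fin ?exprn_gt0 ?invr_gt0 //.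
  rewrite muleA -EFinM.
  have -> : (rho x)^-1 ^+ d.+1 * (4 * (L * rho x * 2 ^+ d)) = 4 * L * 2 ^+ d * (rho x)^-1 ^+ d.
    by rewrite exprS; field; rewrite gt_eqF.
  rewrite -!ge0_integralZl_EFin; [| exact: measurableT | | | | exact: measurableT | | | ].
  - move=> h; apply: le_trans (le_trans _ h) _; apply: le_int => y _.
    + exact: f0.
    + by rewrite /f /= near_indic -EFinM.
    + by rewrite -EFinM lee_fin mulr_ge0 // mulr_ge0 ?rn ?hc // gsum_ge0.
    + by rewrite /g /= near_indic -EFinM (mulrA (4 * L * 2 ^+ d)).
  - by move=> y _; rewrite lee_fin mulr_ge0 ?gsum_ge0.
  - apply/measurable_EFinP; apply: measurable_funM; first exact: measurable_indicT.
    exact: measurable_continuous.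
  - by rewrite mulr_ge0 ?rn.
  - by move=> y _; rewrite lee_fin mulr_ge0.
  - apply/measurable_EFinP; apply: measurable_funM; first exact: measurable_indicT.
    by apply: measurableT_comp => //; exact: measurable_continuous.
  - by [].
(* Lower bound: all x within L / 2 * rho y of y have y in their cube, and satisfy rho x <= 2 * rho
   y. *)
pose c1 := @mu1 R d' * L ^+ d / 2 ^+ (d + d).+1.
have c10 : 0 < c1 by rewrite divr_gt0 ?exprn_gt0 // mulr_gt0 ?exprn_gt0.
have lowf y : ((c1 * (`|w y| / rho y))%:E <= \int[mu]_x f (x, y))%E.
  have ry := rho0 y.
  pose b := (2 * rho y)^-1 ^+ d.+1 * `|w y|.
  have b0 : 0 <= b by rewrite mulr_ge0 // exprn_ge0 // invr_ge0 mulr_ge0 // ltW.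
  have hl : 0 < L / 2 * rho y by rewrite mulr_gt0 // divr_gt0.
  have -> : (c1 * (`|w y| / rho y))%:E = (\int[mu]_(x in cube y (L / 2 * rho y)) b%:E)%E.
    rewrite (@integral_cst _ T R mu _ (measurable_cube y (L / 2 * rho y)) b%:E).
    rewrite [X in (_ * X)%E](mu_cube y hl) -EFinM; congr (_%:E).
    exact: lower_average_const.
  rewrite (int_indicE mu _ (fun=> b)); apply: le_int => x _; first by rewrite lee_fin mulr_ge0.
  rewrite indicE; have [/set_mem|_] := boolP (x \in _); last by rewrite mul0r; exact: f0.
  rewrite /cube /= => h; rewrite /f /= near_lower // !mul1r lee_fin ler_wpM2r //.
  apply: lerXn2r; rewrite ?nnegrE ?invr_ge0 ?mulr_ge0 ?(ltW (rho0 _)) //.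
  rewrite lef_pV2 ?posrE ?mulr_gt0 //.
  have hy : `|y - x| < 2 * L * rho y by rewrite distrC (lt_le_trans h) // ler_pM2r //; lra.
  by have [] := rho_comparable hy.
(* Upper bound: only points x within 2 * L * rho y of y can have y in their cube, and they satisfy
   rho x >= rho y / 2. *)
pose c2 := 4 * L * 2 ^+ d * ((2 ^+ (d + d)) * L ^+ d * @mu1 R d').
have c20 : 0 <= c2 by rewrite mulr_ge0 // mulr_ge0 ?mu1_ge0 // mulr_ge0 ?exprn_ge0 // ltW.
have upg y : (\int[mu]_x g (x, y) <= (c2 * gsum H y)%:E)%E.
  have ry := rho0 y.
  pose b := 4 * L * 2 ^+ d * ((rho y / 2)^-1 ^+ d * gsum H y).
  have hl : 0 < 2 * L * rho y by rewrite !mulr_gt0.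
  have b0 : 0 <= b by rewrite /b mulr_ge0 // mulr_ge0 ?gsum_ge0 // exprn_ge0 // invr_ge0 divr_ge0 // ltW.
  have -> : (c2 * gsum H y)%:E = (\int[mu]_(x in cube y (2 * L * rho y)) b%:E)%E.
    rewrite (@integral_cst _ T R mu _ (measurable_cube y (2 * L * rho y)) b%:E).
    rewrite [X in (_ * X)%E](mu_cube y hl) -EFinM; congr (_%:E).
    exact: upper_average_const.
  rewrite (int_indicE mu _ (fun=> b)); apply: le_int => x _; first exact: g0.
  have := near_upper x y; rewrite !indicE; have [/set_mem|_] := boolP (x \in _); last first.
    move=> h; have nz : near (x, y) = 0 by apply/eqP; rewrite eq_le h near0.
    by rewrite /g nz !(mul0r, mulr0).
  rewrite /cube /= => h hn; rewrite mul1r lee_fin /b.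
  rewrite ler_wpM2l //; apply: ler_pM => //; first by rewrite mulr_ge0 ?gsum_ge0.
    apply: lerXn2r; rewrite ?nnegrE ?invr_ge0 ?divr_ge0 ?(ltW (rho0 _)) //.
    rewrite lef_pV2 ?posrE ?divr_gt0 //.
    have hy : `|y - x| < 2 * L * rho y by rewrite distrC.
    have [_ ?] := rho_comparable hy; lra.
  by rewrite ler_piMl ?gsum_ge0.
have : (c1%:E * \int[mu]_y (`|w y| / rho y)%:E <= c2%:E * \int[mu]_y (gsum H y)%:E)%E.
  rewrite -!ge0_integralZl_EFin; [| exact: measurableT | | | | exact: measurableT | | | ].
  - apply: le_trans (le_trans _ fg) _; apply: le_int => y _ //.
    + by rewrite -EFinM lee_fin mulr_ge0 ?(ltW c10) // divr_ge0 // ltW.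
    + by rewrite -EFinM; exact: lowf.
    + by apply: integral_ge0 => x _; exact: g0.
  - by move=> y _; rewrite lee_fin gsum_ge0.
  - by apply/measurable_EFinP; exact: measurable_continuous.
  - by [].
  - by move=> y _; rewrite lee_fin divr_ge0 // ltW.
  - apply/measurable_EFinP; apply: measurable_funM.
      by apply: measurableT_comp => //; exact: measurable_continuous.
    exact: (measurable_continuous (@rho_inv_continuous 1)).
  - exact: ltW.
rewrite -(@lee_pmul2l _ (c1^-1)%:E) ?lte_fin ?invr_gt0 // !muleA -!EFinM.
rewrite mulVf ?gt_eqF // mul1e.
by rewrite average_const_ratio.
Qed.

End weighted_poincare.

(** * The level sum for p = 1 *)

Section truncation.
Context {R : realType}.
Implicit Types a b s t : R.

Definition pos2 s : R := Num.max s 0 ^+ 2.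

Lemma pos2_taylor s h : `|pos2 (s + h) - pos2 s - h * (2 * Num.max s 0)| <= h ^+ 2.
Proof.
rewrite /pos2 /Num.max; case: (ltP s 0); case: (ltP (s + h) 0) => h1 h2; rewrite ler_norml; apply/andP; split; nra.
Qed.

(* A C1 substitute for [max (|s| - a) 0]: its derivative has absolute value [ramp a s], which is
   monotone in [a], so that the derivatives of the differences [psi a - psi b] telescope. *)
Definition psi a s : R :=
  (pos2 (s - a) + pos2 (- s - a) - pos2 (s - 2 * a) - pos2 (- s - 2 * a)) / (2 * a).

Definition dpsi a s : R :=
  (Num.max (s - a) 0 - Num.max (- s - a) 0 - Num.max (s - 2 * a) 0 + Num.max (- s - 2 * a) 0) / a.

Definition ramp a s : R := (Num.max (`|s| - a) 0 - Num.max (`|s| - 2 * a) 0) / a.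

Lemma is_derive_psi a s : 0 < a -> is_derive s 1 (psi a) (dpsi a s).
Proof.
move=> a0; apply: (@is_derive_quadratic _ _ _ _ _ _ (2 / a)) => h _.
rewrite [h *: 1]mulr1 /psi /dpsi.
have h1 := pos2_taylor (s - a) h; have h2 := pos2_taylor (- s - a) (- h).
have h3 := pos2_taylor (s - 2 * a) h; have h4 := pos2_taylor (- s - 2 * a) (- h).
rewrite -(@ler_pM2l _ (2 * a)) ?mulr_gt0 // -[X in X * `|_|]gtr0_norm ?mulr_gt0 // -normrM.
have -> : h + s - a = s - a + h by ring.
have -> : - (h + s) - a = - s - a + - h by ring.
have -> : h + s - 2 * a = s - 2 * a + h by ring.
have -> : - (h + s) - 2 * a = - s - 2 * a + - h by ring.
move: h1 h2 h3 h4; rewrite sqrrN.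
move: (pos2 (s - a + h)) (pos2 (s - a)) (pos2 (- s - a + - h)) (pos2 (- s - a)).
move: (pos2 (s - 2 * a + h)) (pos2 (s - 2 * a)) (pos2 (- s - 2 * a + - h)) (pos2 (- s - 2 * a)).
move: (Num.max (s - a) 0) (Num.max (- s - a) 0) (Num.max (s - 2 * a) 0) (Num.max (- s - 2 * a) 0).
move=> m1 m2 m3 m4 p1 p2 p3 p4 p5 p6 p7 p8.
have -> : 2 * a * ((p5 + p7 - p1 - p3) / (2 * a) - (p6 + p8 - p2 - p4) / (2 * a) - h * ((m1 - m2 - m3 + m4) / a))
  = (p5 + p7 - p1 - p3) - (p6 + p8 - p2 - p4) - 2 * h * (m1 - m2 - m3 + m4).
  by field; rewrite gt_eqF.
have -> : 2 * a * (2 / a * h ^+ 2) = 4 * h ^+ 2 by field; rewrite gt_eqF.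
rewrite !ler_norml => /andP[? ?] /andP[? ?] /andP[? ?] /andP[? ?].
by apply/andP; split; lra.
Qed.

Lemma continuous_ramp c (eps : R) : continuous (fun s => Num.max (eps * s - c) 0).
Proof.
move=> s; apply: (@continuous_at_lip _ _ _ _ `|eps|) => // y _.
rewrite -normrM mulrBr /Num.max.
move: (eps * y) (eps * s) => p q.
have h3 := ler_norm (p - q); have h4 := ler_norm (q - p).
rewrite (distrC q p) in h4.
rewrite ler_norml; case: (ltP (p - c) 0); case: (ltP (q - c) 0) => h1 h2; apply/andP; split; lra.
Qed.

Lemma continuous_dpsi a : continuous (dpsi a).
Proof.
have -> : dpsi a = (fun s => (Num.max (1 * s - a) 0 - Num.max (-1 * s - a) 0 -
    Num.max (1 * s - 2 * a) 0 + Num.max (-1 * s - 2 * a) 0) / a).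
  by apply/funext => s; rewrite mul1r mulN1r.
move=> s; apply: cvgM; last exact: cvg_cst.
apply: cvgD; [apply: cvgB; [apply: cvgB|]|]; exact: continuous_ramp.
Qed.

Lemma psi_lower a s : 0 < a -> `|s| - 2 * a <= psi a s.
Proof.
move=> a0; rewrite /psi ler_pdivlMr ?mulr_gt0 // /pos2 /Num.max.
case: (ltP (s - a) 0); case: (ltP (- s - a) 0); case: (ltP (s - 2 * a) 0); case: (ltP (- s - 2 * a) 0);
 case: (ler0P s) => *; nra.
Qed.

Lemma psi_small a s : `|s| <= a -> psi a s = 0.
Proof.
move=> h; have a0 : 0 <= a by rewrite (le_trans _ h).
move: h; rewrite ler_norml => /andP[h1 h2].
rewrite /psi /pos2 !max_r; [ring|lra|lra|lra|lra].
Qed.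

Lemma dpsi_ramp a s : 0 < a -> dpsi a s = (if 0 <= s then 1 else -1) * ramp a s.
Proof.
move=> a0; rewrite /dpsi /ramp; case: (ler0P s) => h; case: (lerP 0 s) => h2; try lra;
  rewrite mulrA; congr (_ / a); rewrite /Num.max.
- have -> : s = 0 by apply/eqP; rewrite eq_le h.
  rewrite oppr0 !sub0r.
  have -> : - a < 0 by rewrite oppr_lt0.
  have -> : - (2 * a) < 0 by rewrite oppr_lt0 mulr_gt0.
  ring.
- by case: (ltP (s - a) 0); case: (ltP (s - 2 * a) 0); case: (ltP (- s - a) 0); case: (ltP (- s - 2 * a) 0) => *; lra.
- by case: (ltP (s - a) 0); case: (ltP (s - 2 * a) 0); case: (ltP (- s - a) 0); case: (ltP (- s - 2 * a) 0) => *; lra.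
Qed.

Lemma ramp_ge0 a s : 0 < a -> 0 <= ramp a s.
Proof.
move=> a0; apply: divr_ge0; last exact: ltW.
rewrite /Num.max; case: (ltP (`|s| - a) 0); case: (ltP (`|s| - 2 * a) 0) => *; lra.
Qed.

Lemma ramp_le1 a s : 0 < a -> ramp a s <= 1.
Proof.
move=> a0; rewrite ler_pdivrMr //.
rewrite /Num.max; case: (ltP (`|s| - a) 0); case: (ltP (`|s| - 2 * a) 0) => *; lra.
Qed.

Lemma ramp_anti a b s : 0 < a -> a <= b -> ramp b s <= ramp a s.
Proof.
move=> a0 ab; have b0 : 0 < b by exact: lt_le_trans ab.
rewrite /ramp ler_pdivrMr // mulrAC ler_pdivlMr //.
have := normr_ge0 s; move: `|s| => t t0; rewrite /Num.max.
case: (ltP (t - a) 0); case: (ltP (t - 2 * a) 0); case: (ltP (t - b) 0); case: (ltP (t - 2 * b) 0) => *; nra.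
Qed.

Lemma abs_dpsi a s : 0 < a -> `|dpsi a s| = ramp a s.
Proof.
move=> a0; rewrite dpsi_ramp // normrM (ger0_norm (ramp_ge0 s a0)).
by case: ifP; rewrite ?normrN1 ?normr1 mul1r.
Qed.

Lemma abs_dpsiB a b s : 0 < a -> a <= b -> `|dpsi a s - dpsi b s| = ramp a s - ramp b s.
Proof.
move=> a0 ab; have b0 : 0 < b by exact: lt_le_trans ab.
rewrite !dpsi_ramp // -mulrBr normrM (@ger0_norm _ (_ - _)) ?subr_ge0 ?ramp_anti //.
by case: ifP; rewrite ?normrN1 ?normr1 mul1r.
Qed.

End truncation.

Section mass.
Context {R : realType} {d' : nat}.
Local Notation d := d'.+1.
Local Notation T := (vec R d').
Local Notation mu := (@mu R d').
Implicit Types (F : 'rV[R]_d -> R) (c x : 'rV[R]_d) (r : R).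

Definition mass F c r : R := fine (\int[mu]_y (\1_(cube c r) y * `|F y|)%:E)%E.

Definition mean F c r : R := mass F c r / (@mu1 R d' * r ^+ d).

Lemma cube_sub c c' r r' : `|c - c'| + r <= r' -> cube c r `<=` cube c' r'.
Proof.
move=> h y; rewrite /cube /= => hy.
rewrite (_ : y - c' = (c - c') + (y - c)); last by rewrite [RHS]addrC addrA subrK.
by apply: (le_lt_trans (ler_normD _ _)); apply: lt_le_trans h; rewrite ltrD2l.
Qed.

Lemma massE F c r : locint F ->
  (mass F c r)%:E = (\int[mu]_y (\1_(cube c r) y * `|F y|)%:E)%E.
Proof.
move=> [mF fF]; rewrite /mass fineK // ge0_fin_numE; last first.
  by apply: integral_ge0 => y _; rewrite lee_fin mulr_ge0.
apply: le_lt_trans (fF (`|c| + r)).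
rewrite (int_indicE mu _ (fun y => `|F y|)); apply: le_int => y _.
  by rewrite lee_fin mulr_ge0.
rewrite lee_fin ler_wpM2r // !indicE; case: (boolP (y \in cube c r)) => // /set_mem h.
by rewrite mem_set //; apply: cube_sub h; rewrite subr0.
Qed.

Lemma mass_ge0 F c r : 0 <= mass F c r.
Proof. by apply: fine_ge0; apply: integral_ge0 => y _; rewrite lee_fin mulr_ge0. Qed.

Lemma mass_sub F c c' r r' : locint F -> cube c r `<=` cube c' r' -> mass F c r <= mass F c' r'.
Proof.
move=> lF h; rewrite -lee_fin !massE //; apply: le_int => y _; first by rewrite lee_fin mulr_ge0.
rewrite lee_fin ler_wpM2r // !indicE; case: (boolP (y \in cube c r)) => // /set_mem hy.
by rewrite mem_set //; exact: h.
Qed.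

Lemma massE_mean F c r : 0 < @mu1 R d' -> 0 < r -> mass F c r = mean F c r * (@mu1 R d' * r ^+ d).
Proof. by move=> m0 r0; rewrite /mean divfK // gt_eqF // mulr_gt0 // exprn_gt0. Qed.

Lemma mean_ge0 F c r : 0 <= r -> 0 <= mean F c r.
Proof. by move=> r0; rewrite divr_ge0 ?mass_ge0 // mulr_ge0 ?mu1_ge0 // exprn_ge0. Qed.

End mass.

Lemma seq_argmax {I : eqType} (k : I -> nat) (l : seq I) i0 : i0 \in l ->
  exists2 j, j \in l & forall i, i \in l -> (k i <= k j)%N.
Proof.
elim: l i0 => // a l IH i0 _; case: l IH => [_|b l IH].
  by exists a; rewrite ?mem_head // => i; rewrite inE => /eqP ->.
have [j jl hj] := IH b (mem_head _ _).
case: (leqP (k a) (k j)) => h.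
  exists j; first by rewrite inE jl orbT.
  by move=> i; rewrite inE => /orP[/eqP ->//|]; exact: hj.
exists a; first exact: mem_head.
by move=> i; rewrite inE => /orP[/eqP ->//|/hj hi]; exact: (leq_trans hi (ltnW h)).
Qed.

(** Here q stands for a quotient of radii. For q <= 1 the root of order al is taken, which suffices
    because al <= d; for q > 1 the root of order d, where K >= 1 allows K^(1/d) to be replaced by
    K^(1/al). *)
Lemma radius_arith {R : realType} (q K al : R) (d n : nat) : 0 < q -> 1 <= K -> 0 < al -> al <= d%:R ->
  (q <= 1 -> (2 ^+ d) ^+ n <= K * q `^ al) -> (1 < q -> (2 ^+ d) ^+ n <= K * q ^+ d) ->
  2 ^+ n <= K `^ (al^-1) * q.
Proof.
move=> q0 K1 al0 ald h1 h2; set k1 := K `^ (al^-1).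
have K0 : 0 < K by rewrite (lt_le_trans ltr01).
have k0 : 0 < k1 by rewrite powR_gt0.
have k1al : k1 `^ al = K by rewrite /k1 -powRrM mulVf ?gt_eqF // powRr1 // ltW.
have k11 : 1 <= k1 by rewrite -(powRr0 K) ler_powR // invr_ge0 ltW.
have n1 : 1 <= 2 ^+ n :> R by rewrite exprn_ege1 // ler1n.
have d0 : (0 < d)%N by rewrite -(ltr0n R) (lt_le_trans al0).
have kq : 0 <= k1 * q by rewrite mulr_ge0 // ltW.
have [q1|q1] := leP q 1.
  have : (2 ^+ n) `^ al <= (k1 * q) `^ al.
    rewrite (powRM al (ltW k0) (ltW q0)) k1al; apply: (le_trans _ (h1 q1)).
    by rewrite exprAC -[leRHS]powR_mulrn ?ler_powR // (le_trans _ n1).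
  rewrite !leNgt; apply: contraNN => h; apply: gt0_ltr_powR; by rewrite ?nnegrE // (le_trans _ n1).
have : (2 ^+ n) ^+ d <= (k1 * q) ^+ d.
  rewrite exprMn exprAC; apply: (le_trans (h2 q1)).
  rewrite ler_wpM2r ?exprn_ge0 ?(ltW q0) // -[leLHS]k1al -(powR_mulrn _ (ltW k0)).
  exact: ler_powR.
by rewrite ler_pXn2r // nnegrE // (le_trans _ n1).
Qed.

Section radius_function.
Context {R : realType} {d' : nat}.
Local Notation d := d'.+1.
Local Notation P := ('rV[R]_d * R)%type.
Implicit Types (x y : 'rV[R]_d) (v : P).

Lemma min_lip (K a b a' b' D : R) : 0 < K -> K * `|a - a'| <= D -> K * `|b - b'| <= D ->
  K * `|Num.min a b - Num.min a' b'| <= D.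
Proof.
move=> K0; rewrite -!ler_pdivlMl // !ler_norml => /andP[? ?] /andP[? ?].
by rewrite /Num.min; case: (ltP a b); case: (ltP a' b') => ? ?; apply/andP; split; lra.
Qed.

(* [rho] is the least [v.2 + |x - v.1| / (4 * L)] over [v \in F]. *)
Lemma exists_radius (L : R) (F : seq P) v0 : 1 <= L -> v0 \in F -> {in F, forall v, 0 < v.2} ->
  exists rho : 'rV[R]_d -> R, [/\ forall x, 0 < rho x,
    forall x y, 4 * L * `|rho x - rho y| <= `|x - y|,
    forall x, exists2 v, v \in F & rho x = v.2 + `|x - v.1| / (4 * L) &
    forall x v, v \in F -> rho x <= v.2 + `|x - v.1| / (4 * L)].
Proof.
move=> L1 + hF; have L0 : 0 < 4 * L by rewrite mulr_gt0 // (lt_le_trans ltr01).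
have glip v x y : 4 * L * `|v.2 + `|x - v.1| / (4 * L) - (v.2 + `|y - v.1| / (4 * L))| <= `|x - y|.
  rewrite (_ : _ - _ = (`|x - v.1| - `|y - v.1|) / (4 * L)); last by field; rewrite gt_eqF // (lt_le_trans ltr01).
  rewrite normrM (@gtr0_norm _ (4 * L)^-1) ?invr_gt0 // mulrCA divff ?gt_eqF // mulr1.
  rewrite (le_trans (ler_dist_dist _ _)) // opprB addrA subrK //.
have g0 v x : 0 < v.2 -> 0 < v.2 + `|x - v.1| / (4 * L).
  by move=> h; rewrite ltr_pwDl // divr_ge0 // ltW.
elim: F v0 hF => // v [|w F] IH v0 hF _.
  exists (fun x => v.2 + `|x - v.1| / (4 * L)); split => //.
  - by move=> x; apply: g0; apply: hF; exact: mem_head.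
  - by move=> x; exists v => //; exact: mem_head.
  - by move=> x v'; rewrite inE => /eqP ->.
have [|rho [r0 rl re rle]] := IH w _ (mem_head _ _).
  by move=> z zF; apply: hF; rewrite inE zF orbT.
exists (fun x => Num.min (v.2 + `|x - v.1| / (4 * L)) (rho x)); split.
- by move=> x; rewrite lt_min r0 g0 // hF // mem_head.
- by move=> x y; exact: min_lip.
- move=> x; rewrite /Num.min; case: ifP => _; first by exists v => //; exact: mem_head.
  by have [z zF ->] := re x; exists z => //; rewrite inE zF orbT.
- move=> x z; rewrite inE ge_min => /orP[/eqP ->|zF]; first by rewrite lexx.
  by rewrite rle ?orbT.
Qed.

End radius_function.

(** * The level sum for a finite family of cubes *)

Section core.
Context {R : realType} {d' : nat}.
Local Notation d := d'.+1.
Local Notation T := (vec R d').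
Local Notation mu := (@mu R d').
Local Notation P := ('rV[R]_d * R)%type.
Hypothesis m0 : 0 < @mu1 R d'.
(** [kap] is the level, a natural number counted from the base value [Lam]. [hopt] is what is kept
    of the maximality of the balls, and [hdis] is the outcome of the Vitali selection. *)
Variables (f : 'rV[R]_d -> R) (al C1c Lam : R) (s : seq P) (kap : P -> nat).
Hypotheses (Lf : L1 f) (al0 : 0 < al) (ald : al <= d%:R) (C1c1 : 1 <= C1c) (Lam0 : 0 < Lam).
Hypotheses (us : uniq s) (hr : {in s, forall v, 0 < v.2})
  (hlev : {in s, forall v, Lam * (2 ^+ d) ^+ kap v <= mean f v.1 v.2 < Lam * (2 ^+ d) ^+ (kap v).+1})
  (hopt : {in s, forall v (r : R), v.2 <= r -> mean f v.1 r <= C1c * (v.2 / r) `^ al * mean f v.1 v.2})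
  (hdis : {in s &, forall v w, kap v = kap w -> (cube v.1 v.2 `&` cube w.1 w.2) !=set0 -> v = w}).

Definition k1 : R := (C1c * 3 ^+ d) `^ (al^-1).

Let K1 : 1 <= C1c * 3 ^+ d.
Proof. by rewrite mulr_ege1 // exprn_ege1 // ler1n. Qed.

Lemma k1_ge1 : 1 <= k1.
Proof. by rewrite -(powRr0 (C1c * 3 ^+ d)) ler_powR // invr_ge0 ltW. Qed.

Let k10 : 0 < k1.
Proof. by rewrite (lt_le_trans ltr01) // k1_ge1. Qed.

(** The cube of w lies in the dilate of v of half side v.2 + 2 * w.2. The high level of w forces the
    mean over this dilate up, the optimality of v keeps it down, so w.2 must be small compared with
    v.2. For equal levels v = w by [hdis]. *)
Lemma radius_growth v w x : v \in s -> w \in s -> (kap v <= kap w)%N ->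
  cube v.1 v.2 x -> cube w.1 w.2 x -> 2 ^+ (kap w - kap v) * w.2 <= 2 * k1 * v.2.
Proof.
move=> vs ws kvw xv xw; have v0 := hr vs; have w0 := hr ws.
move: kvw; rewrite leq_eqVlt => /orP[/eqP kvw|kvw].
  have -> : v = w by apply: hdis => //; exists x.
  rewrite subnn mul1r ler_peMl //; last by rewrite mulr_ege1 ?k1_ge1 // ler1n.
  exact: ltW (hr ws).
pose r := v.2 + 2 * w.2; have r0 : 0 < r by rewrite addr_gt0 // mulr_gt0.
have mLr : mass f w.1 w.2 <= mass f v.1 r.
  apply: mass_sub; first exact: L1_locint.
  apply: cube_sub; rewrite /r.
  have : `|w.1 - v.1| < w.2 + v.2.
    rewrite (_ : w.1 - v.1 = (x - v.1) - (x - w.1)); last first.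
      by rewrite opprB [RHS]addrC addrA subrK.
    by rewrite [w.2 + _]addrC (le_lt_trans (ler_normB _ _)) // ltrD.
  lra.
have vr : v.2 <= r by rewrite /r; lra.
have ho := hopt vs vr.
have /andP[_ hv] := hlev vs; have /andP[hw _] := hlev ws.
pose A : R := 2 ^+ d; have A0 : 0 < A by rewrite exprn_gt0.
(* One level is lost because the mean over v is only known to be below the next level; the factor 2
   in the conclusion pays for it. *)
pose n := (kap w - kap v).-1.
have kw : kap w = (n + (kap v).+1)%N by rewrite addnS -addSn prednK ?subn_gt0 // subnK // ltnW.
have main : A ^+ n * w.2 ^+ d <= C1c * (v.2 / r) `^ al * r ^+ d.
  have h1 : mean f w.1 w.2 * w.2 ^+ d <= mean f v.1 r * r ^+ d.
    rewrite -(@ler_pM2l _ (@mu1 R d')) //.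
    rewrite [leLHS]mulrCA [leRHS]mulrCA -!massE_mean //.
  have h2 : Lam * A ^+ kap w * w.2 ^+ d <= mean f w.1 w.2 * w.2 ^+ d.
    by rewrite ler_wpM2r // exprn_ge0 // ltW.
  have h3 : mean f v.1 r * r ^+ d <= C1c * (v.2 / r) `^ al * (Lam * A ^+ (kap v).+1) * r ^+ d.
    rewrite ler_wpM2r ?exprn_ge0 ?(ltW r0) // (le_trans ho) // ler_wpM2l ?(ltW hv) //.
    by rewrite mulr_ge0 ?powR_ge0 // (le_trans ler01).
  have h4 := le_trans h2 (le_trans h1 h3).
  have Ak0 : 0 < Lam * A ^+ (kap v).+1 by rewrite mulr_gt0 ?exprn_gt0.
  rewrite -(@ler_pM2l _ (Lam * A ^+ (kap v).+1)) //.
  apply: le_trans (le_trans h4 _); rewrite le_eqVlt; apply/orP; left; apply/eqP.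
    by rewrite kw exprD; ring.
  by ring.
pose q := v.2 / w.2; have q0 : 0 < q by rewrite divr_gt0.
have mainq : A ^+ n <= C1c * (v.2 / r) `^ al * (r / w.2) ^+ d.
  by rewrite expr_div_n mulrA ler_pdivlMr ?exprn_gt0.
have c0 : 0 <= C1c by rewrite (le_trans ler01).
have vw : v.2 = q * w.2 by rewrite /q divfK // gt_eqF.
have rw : r / w.2 = q + 2 by rewrite /r /q; field; rewrite gt_eqF.
have hA : q <= 1 -> A ^+ n <= C1c * 3 ^+ d * q `^ al.
  move=> q1; apply: (le_trans mainq); rewrite mulrAC.
  rewrite -!mulrA; apply: ler_wpM2l => //; apply: ler_pM; rewrite ?powR_ge0 ?exprn_ge0 ?rw //; try lra.
    by apply: lerXn2r; rewrite ?nnegrE; lra.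
  apply: ge0_ler_powR; rewrite ?nnegrE ?(ltW al0) ?divr_ge0 ?ltW //.
  by rewrite /q ltr_pM2l // ltf_pV2 ?posrE //; rewrite /r; lra.
have hB : 1 < q -> A ^+ n <= C1c * 3 ^+ d * q ^+ d.
  move=> q1; apply: (le_trans mainq).
  rewrite -!mulrA; apply: ler_wpM2l => //.
  rewrite -exprMn -[leRHS]mul1r; apply: ler_pM; rewrite ?powR_ge0 ?exprn_ge0 ?rw //; try lra.
    rewrite -[leRHS](_ : 1 `^ al = 1); last by rewrite powR1.
    apply: ge0_ler_powR; rewrite ?nnegrE ?(ltW al0) ?divr_ge0 ?(ltW v0) ?(ltW r0) //.
    by rewrite ler_pdivrMr // mul1r.
  by apply: lerXn2r; rewrite ?nnegrE; lra.
have := @radius_arith R q (C1c * 3 ^+ d) al d n q0 K1 al0 ald hA hB; rewrite -/k1 => h.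
have -> : (kap w - kap v)%N = n.+1 by rewrite /n prednK ?subn_gt0.
rewrite exprS -!mulrA ler_pM2l // -ler_pdivlMr //.
by rewrite -mulrA.
Qed.

(** Here j has the highest level among the cubes at x. By [radius_growth] the weight of v is at most
    2 * k1 * 2^(kap v - kap j) / j.2, and cubes sharing a point have distinct levels, so the sum is
    geometric. *)
Lemma overlap_bound m x j : j \in s -> (kap j <= m)%N ->
  (forall v, v \in s -> (kap v <= m)%N -> cube v.1 v.2 x -> (kap v <= kap j)%N) ->
  cube j.1 j.2 x ->
  \sum_(v <- [seq v <- s | (kap v <= m)%N && (x \in cube v.1 v.2)]) v.2^-1 <= 4 * k1 / j.2.
Proof.
move=> js jm hj xj; set l := [seq _ <- s | _]; have j0 := hr js.
have lP v : v \in l -> [/\ v \in s, (kap v <= m)%N & cube v.1 v.2 x].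
  by rewrite mem_filter => /andP[/andP[-> /set_mem ?] ->].
have b0 : 0 <= 2 * k1 / (2 ^+ kap j * j.2).
  by rewrite divr_ge0 ?mulr_ge0 ?exprn_ge0 ?ltW.
apply: (@le_trans _ _ (\sum_(v <- l) 2 * k1 / (2 ^+ kap j * j.2) * 2 ^+ kap v)).
  rewrite big_seq [leRHS]big_seq; apply: ler_sum => v vl.
  have [vs vm xv] := lP _ vl; have v0 := hr vs; have kvj := hj _ vs vm xv.
  have := radius_growth vs js kvj xv xj.
  rewrite -[in X in _ -> _ <= _ / (X * _) * _](subnK kvj) exprD.
  have : 0 < (2 : R) ^+ (kap v) by rewrite exprn_gt0.
  have : 0 < (2 : R) ^+ (kap j - kap v) by rewrite exprn_gt0.
  move: (2 ^+ kap v) (2 ^+ (kap j - kap v)) => a b a0 bb h.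
  have -> : 2 * k1 / (b * a * j.2) * a = 2 * k1 / (b * j.2).
    by field; rewrite !gt_eqF.
  by rewrite ler_pdivlMr ?mulr_gt0 // mulrC ler_pdivrMr.
rewrite -mulr_sumr.
apply: (@le_trans _ _ (2 * k1 / (2 ^+ kap j * j.2) * (2 ^+ (kap j).+1 / (2 - 1)))).
  apply: ler_wpM2l => //; apply: geo_sum.
  - by rewrite ltr1n.
  - by rewrite filter_uniq.
  - move=> v w /lP[vs _ xv] /lP[ws _ xw] kvw.
    by apply: hdis => //; exists x.
  - by move=> v /lP[vs vm xv]; exact: hj.
have : 0 < (2 : R) ^+ (kap j) by rewrite exprn_gt0.
rewrite exprS.
move: (2 ^+ kap j) => a a0; rewrite le_eqVlt; apply/orP; left; apply/eqP.
by field; rewrite !gt_eqF //; lra.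
Qed.

(** Chosen so that C1c * Lc^(-al) * 2^d * 5^d <= 1/32. The factor 2^d is the width of a level, 5^d
    the cost of moving the centre in [mass_near]. *)
Definition Lc : R := Num.max 1 ((32 * 5 ^+ d * C1c * 2 ^+ d) `^ (al^-1)).

Lemma Lc_ge1 : 1 <= Lc.
Proof. by rewrite /Lc le_max lexx. Qed.

Let c0 : 0 < C1c.
Proof. by rewrite (lt_le_trans ltr01). Qed.

Let L0 : 0 < Lc.
Proof. by rewrite (lt_le_trans ltr01) // Lc_ge1. Qed.

Lemma Lc_al : 32 * 5 ^+ d * C1c * 2 ^+ d <= Lc `^ al.
Proof.
set K := 32 * 5 ^+ d * C1c * 2 ^+ d.
have K0 : 0 < K by rewrite /K !mulr_gt0 ?exprn_gt0.
have -> : K = (K `^ al^-1) `^ al by rewrite -powRrM mulVf ?gt_eqF // powRr1 // ltW.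
by apply: ge0_ler_powR; rewrite ?nnegrE ?powR_ge0 ?(ltW L0) ?(ltW al0) // /Lc le_max lexx orbT.
Qed.

(** The radius r is Lc times the term of v in the radius function. The cube about x lies in a cube
    about v.1 of half side at most 5 * r and at least Lc * v.2, over which optimality makes the mean
    small. *)
Lemma mass_near v x m : v \in s -> (kap v <= m)%N ->
  forall r, r = Lc * (v.2 + `|x - v.1| / (4 * Lc)) ->
  mass f x r <= Lam * (2 ^+ d) ^+ m / 32 * (@mu1 R d' * r ^+ d).
Proof.
move=> vs vm r rdef; have v0 := hr vs; set t := `|x - v.1| in rdef.
have t0 : 0 <= t by exact: normr_ge0.
have rE : r = Lc * v.2 + t / 4 by rewrite rdef; field; rewrite gt_eqF.
have lv : v.2 <= Lc * v.2 by rewrite ler_peMl ?Lc_ge1 // ltW.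
have r0 : 0 < r by rewrite rE; lra.
pose rb := r + t; have rb0 : 0 < rb by rewrite /rb; lra.
have rb5 : rb <= 5 * r by rewrite /rb rE; lra.
have vrb : v.2 <= rb by rewrite /rb rE; lra.
have h1 : mass f x r <= mass f v.1 rb.
  by apply: mass_sub; [exact: L1_locint|apply: cube_sub; rewrite /rb addrC].
have ho := hopt vs vrb; have /andP[_ hv] := hlev vs.
pose A : R := 2 ^+ d; have A1 : 1 <= A by rewrite exprn_ege1 // ler1n.
have A0 : 0 < A by rewrite exprn_gt0.
have p1 : (v.2 / rb) `^ al <= (Lc `^ al)^-1.
  have -> : (Lc `^ al)^-1 = Lc^-1 `^ al by rewrite -powRN -(powR_inv1 (ltW L0)) -powRrM mulN1r.
  apply: ge0_ler_powR; rewrite ?nnegrE ?invr_ge0 ?(ltW al0) ?(ltW L0) ?divr_ge0 ?(ltW v0) ?(ltW rb0) //.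
  by rewrite ler_pdivrMr // ler_pdivlMl // /rb rE; lra.
have p2 : mean f v.1 v.2 <= Lam * A ^+ m * A.
  apply: (le_trans (ltW hv)); rewrite -mulrA -exprSr ler_pM2l //.
  by apply: ler_weXn2l.
have La : 0 < Lc `^ al by rewrite powR_gt0.
have p3 : mean f v.1 rb <= C1c * (Lc `^ al)^-1 * (Lam * A ^+ m * A).
  apply: (le_trans ho); apply: ler_pM => //.
  - by rewrite mulr_ge0 ?powR_ge0 // ltW.
  - by rewrite mean_ge0 // ltW.
  - by rewrite ler_pM2l.
apply: (le_trans h1); rewrite (massE_mean _ _ m0 rb0).
apply: (@le_trans _ _ (C1c * (Lc `^ al)^-1 * (Lam * A ^+ m * A) * (@mu1 R d' * (5 * r) ^+ d))).
  apply: ler_pM => //; rewrite ?mean_ge0 ?(ltW rb0) //.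
    by rewrite mulr_ge0 ?mu1_ge0 // exprn_ge0 // ltW.
  by rewrite ler_pM2l //; apply: lerXn2r; rewrite ?nnegrE ?(ltW rb0) // mulr_ge0 // ltW.
rewrite exprMn.
have -> : C1c / Lc `^ al * (Lam * A ^+ m * A) * (@mu1 R d' * (5 ^+ d * r ^+ d)) =
  (C1c * A * 5 ^+ d / Lc `^ al) * (Lam * A ^+ m * (@mu1 R d' * r ^+ d)) by ring.
have -> : Lam * A ^+ m / 32 * (@mu1 R d' * r ^+ d) = 32^-1 * (Lam * A ^+ m * (@mu1 R d' * r ^+ d)) by ring.
rewrite ler_pM2r; last by rewrite !mulr_gt0 ?exprn_gt0.
rewrite ler_pdivrMr // ler_pdivlMl //; apply: le_trans Lc_al.
by rewrite le_eqVlt; apply/orP; left; apply/eqP; rewrite /A; ring.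
Qed.

Section approximation.
(** u is so close to f in L^1 that even on the smallest cube of the family the error is 1/32 of the
    lowest level. *)
Variables (eps rmin : R) (u : 'rV[R]_d -> R) (G : 'I_d -> 'rV[R]_d -> R).
Hypotheses (CG : C1 u G) (uf : (nrm1 (fun x => u x - f x)%R <= eps%:E)%E)
  (rmin0 : 0 < rmin) (hrmin : {in s, forall v, rmin <= v.2})
  (heps : eps <= Lam / 32 * (@mu1 R d' * rmin ^+ d)).

(** With one eighth of the level, [psi (lvl m)] loses at most a quarter of the level, while the two
    errors of 1/32, from [mass_near] and from u - f, add up to lvl m / 2 as [weighted_poincare]
    requires. *)
Definition lvl (m : nat) : R := Lam * (2 ^+ d) ^+ m / 8.

Let mf : measurable_fun setT (f : T -> R).
Proof. exact: L1_measurable. Qed.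

Let mu_ : measurable_fun setT (u : T -> R).
Proof. by case: CG => cu _ _; exact: measurable_continuous. Qed.

Let A1 m : 1 <= (2 ^+ d) ^+ m :> R.
Proof. by rewrite exprn_ege1 // exprn_ege1 // ler1n. Qed.

Lemma lvl_gt0 m : 0 < lvl m.
Proof. by rewrite /lvl divr_gt0 // mulr_gt0 // exprn_gt0 // exprn_gt0. Qed.

Lemma lvl_mono m : lvl m <= lvl m.+1.
Proof.
rewrite /lvl ler_pM2r // ler_pM2l // (exprS (2 ^+ d)) ler_peMl ?exprn_ge0 ?exprn_ge0 //.
by rewrite exprn_ege1 // ler1n.
Qed.

Lemma eps_small (r : R) m : rmin <= r -> eps <= Lam * (2 ^+ d) ^+ m / 32 * (@mu1 R d' * r ^+ d).
Proof.
move=> hrr; apply: (le_trans heps); apply: ler_pM.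
- by rewrite divr_ge0 // ltW.
- by rewrite mulr_ge0 ?mu1_ge0 // exprn_ge0 // ltW.
- by rewrite ler_pM2r // ler_pMr.
- by rewrite ler_pM2l //; apply: lerXn2r; rewrite ?nnegrE // ?(ltW rmin0) // (le_trans (ltW rmin0)).
Qed.

Lemma int_indic_triangle (F1 F2 F3 : 'rV[R]_d -> R) c r :
  measurable_fun setT (F2 : T -> R) -> measurable_fun setT (F3 : T -> R) ->
  (forall y, `|F1 y| <= `|F2 y| + `|F3 y|) ->
  (\int[mu]_y (\1_(cube c r) y * `|F1 y|)%:E <=
   \int[mu]_y (\1_(cube c r) y * `|F2 y|)%:E + \int[mu]_y (\1_(cube c r) y * `|F3 y|)%:E)%E.
Proof.
move=> m2 m3 h.
have mi (F : 'rV[R]_d -> R) : measurable_fun setT (F : T -> R) ->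
  measurable_fun setT (fun y : T => (\1_(cube c r) y * `|F y|)%:E).
  move=> mF; apply/measurable_EFinP; apply: measurable_funM; first exact: measurable_indicT.
  exact: measurableT_comp.
rewrite -ge0_integralD; [|exact: measurableT| |exact: mi| |exact: mi].
- apply: le_int => y _; first by rewrite lee_fin mulr_ge0.
  by rewrite -EFinD lee_fin -mulrDr ler_wpM2l.
- by move=> y _; rewrite lee_fin mulr_ge0.
- by move=> y _; rewrite lee_fin mulr_ge0.
Qed.

Let int_uf c r : (\int[mu]_y (\1_(cube c r) y * `|u y - f y|)%:E <= eps%:E)%E.
Proof.
apply: le_trans uf; apply: le_int => y _; first by rewrite lee_fin mulr_ge0.
by rewrite lee_fin indicE; case: (_ \in _); rewrite ?mul1r ?mul0r.
Qed.

Lemma int_near v x m : v \in s -> (kap v <= m)%N ->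
  forall r, r = Lc * (v.2 + `|x - v.1| / (4 * Lc)) ->
  (\int[mu]_y (\1_(cube x r) y * `|u y|)%:E <= (lvl m / 2 * (@mu1 R d' * r ^+ d))%:E)%E.
Proof.
move=> vs vm r rdef; have h := mass_near vs vm rdef.
apply: (le_trans (@int_indic_triangle u f (fun y => u y - f y) x r _ _ _)) => //.
- exact: measurable_funB.
- by move=> y; rewrite -[X in `|X|](subrK (f y)) addrC; exact: ler_normD.
rewrite -massE; last exact: L1_locint.
have v0 := hr vs.
have hr' : rmin <= r.
  apply: (le_trans (hrmin vs)); rewrite rdef mulrDr ler_wpDr //.
    by rewrite mulr_ge0 ?divr_ge0 ?mulr_ge0 // ltW.
  by rewrite ler_peMl ?Lc_ge1 // ltW.
apply: (@le_trans _ _ ((Lam * (2 ^+ d) ^+ m / 32 * (@mu1 R d' * r ^+ d))%:E + (Lam * (2 ^+ d) ^+ m / 32 * (@mu1 R d' * r ^+ d))%:E)%E).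
  apply: leeD; first by rewrite lee_fin.
  by apply: (le_trans (int_uf x r)); rewrite lee_fin; exact: eps_small.
by rewrite -EFinD lee_fin /lvl le_eqVlt; apply/orP; left; apply/eqP; field.
Qed.

(** [weighted_poincare] is applied with the radius function of the cubes of level at most m: at
    every x the minimum is attained by one of them, and [int_near] then controls the average of |u|
    at scale Lc * rho x. Pointwise the weights of these cubes add up to at most 8 * k1 / rho. *)
Lemma level_bound m (th dth : R -> R) : (forall t : R, is_derive t 1 th (dth t)) ->
  continuous dth -> (forall t, `|t| <= lvl m -> th t = 0) ->
  (\sum_(v <- s | (kap v <= m)%N) (v.2^-1)%:E * \int[mu]_y (\1_(cube v.1 v.2) y * `|th (u y)|)%:E <=
   (8 * k1 * (8 * 32 ^+ d * Lc))%:E * \int[mu]_y (`|dth (u y)| * gsum G y)%:E)%E.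
Proof.
move=> dt cdt th0.
have Cw := C1_comp CG dt cdt; have [cw _ _] := Cw; have [cu _ _] := CG.
have mth : measurable_fun setT (fun y : T => th (u y)) by exact: measurable_continuous.
have RHS0 : (0 <= (8 * k1 * (8 * 32 ^+ d * Lc))%:E * \int[mu]_y (`|dth (u y)| * gsum G y)%:E)%E.
  apply: mule_ge0; last by apply: integral_ge0 => y _; rewrite lee_fin mulr_ge0 ?gsum_ge0.
  have e32 : 0 <= 32 ^+ d :> R by rewrite exprn_ge0.
  by rewrite lee_fin mulr_ge0 // ?mulr_ge0 // ltW.
rewrite -big_filter; set F := [seq v <- s | _].
have [F0|[v0 v0F]] : F = [::] \/ exists v0, v0 \in F.
  by case: F => [|v0 F']; [left|right; exists v0; exact: mem_head].
  by rewrite F0 big_nil.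
have FP v : v \in F -> v \in s /\ (kap v <= m)%N by rewrite mem_filter => /andP[].
have F2 : {in F, forall v, 0 < v.2} by move=> v /FP[vs _]; exact: hr.
have [rho [r0 rlip rex rle]] := exists_radius Lc_ge1 v0F F2.
have hu x : (\int[mu]_y (\1_(cube x (Lc * rho x)) y * `|u y|)%:E <= (lvl m / 2 * (@mu1 R d' * (Lc * rho x) ^+ d))%:E)%E.
  by have [v /FP[vs vm] ->] := rex x; exact: (int_near vs vm erefl).
have := weighted_poincare m0 Lc_ge1 r0 rlip Cw (lvl_gt0 m) cu (fun y => th0 (u y)) hu.
have -> : (\int[mu]_y (gsum (fun i x => dth (u x) * G i x) y)%:E = \int[mu]_y (`|dth (u y)| * gsum G y)%:E)%E.
  by apply: eq_integral => y _; rewrite gsum_scale.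
have k80 : 0 < 8 * k1 by rewrite mulr_gt0.
rewrite -(@lee_pmul2l _ (8 * k1)%:E) ?lte_fin // muleA -EFinM; apply: le_trans.
have mterm (v : P) : measurable_fun setT (fun y : T => (v.2^-1 * (\1_(cube v.1 v.2) y * `|th (u y)|))%:E).
  apply/measurable_EFinP; apply: measurable_funM; first exact: measurable_cst.
  by apply: measurable_funM; [exact: measurable_indicT|exact: measurableT_comp].
have -> : (\sum_(v <- F) (v.2^-1)%:E * \int[mu]_y (\1_(cube v.1 v.2) y * `|th (u y)|)%:E =
  \int[mu]_y (\sum_(v <- F) (`|v.2^-1| * (\1_(cube v.1 v.2) y * `|th (u y)|))%:E))%E.
  rewrite ge0_integral_sum; first last.
  - by move=> v y _; rewrite lee_fin mulr_ge0 // mulr_ge0.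
  - move=> v; apply/measurable_EFinP; apply: measurable_funM; first exact: measurable_cst.
    by apply: measurable_funM; [exact: measurable_indicT|exact: measurableT_comp].
  - exact: measurableT.
  rewrite big_seq [RHS]big_seq; apply: eq_bigr => v vF.
  have v20 := F2 _ vF.
  rewrite ger0_norm ?invr_ge0 ?(ltW v20) // -ge0_integralZl_EFin //.
  - apply/measurable_EFinP.
    by apply: measurable_funM; [exact: measurable_indicT|exact: measurableT_comp].
  - by rewrite invr_ge0 ltW.
rewrite -ge0_integralZl_EFin; first last.
- exact: ltW.
- apply/measurable_EFinP; apply: measurable_funM; first exact: measurableT_comp.
  exact: (measurable_continuous (@rho_inv_continuous _ _ _ _ Lc_ge1 r0 rlip 1)).
- by move=> y _; rewrite lee_fin divr_ge0 // ltW.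
- exact: measurableT.
apply: le_int => y _.
  by apply: sume_ge0 => v _; rewrite lee_fin mulr_ge0 // mulr_ge0.
rewrite sumEFin -EFinM lee_fin.
have -> : \sum_(v <- F) `|v.2^-1| * (\1_(cube v.1 v.2) y * `|th (u y)|) =
  `|th (u y)| * \sum_(v <- [seq v <- s | (kap v <= m)%N && (y \in cube v.1 v.2)]) v.2^-1.
  rewrite mulr_sumr [RHS]big_filter [RHS]big_mkcondr /=.
  rewrite /F big_filter [LHS]big_seq_cond [RHS]big_seq_cond; apply: eq_bigr => v /andP[vs _].
  rewrite ger0_norm ?invr_ge0 ?(ltW (hr vs)) // indicE.
  by case: (_ \in _); rewrite ?mul1r ?mul0r ?mulr0 // mulrC.
rewrite mulrCA ler_wpM2l //.
set l := [seq v <- s | _].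
have [->|[v1 v1l]] : l = [::] \/ exists v1, v1 \in l.
    by case: l => [|v1 l']; [left|right; exists v1; exact: mem_head].
  by rewrite big_nil divr_ge0 // ltW.
have lP v : v \in l -> [/\ v \in s, (kap v <= m)%N & cube v.1 v.2 y].
  by rewrite mem_filter => /andP[/andP[-> /set_mem ?] ->].
have [j jl hj] := seq_argmax kap v1l; have [js jm yj] := lP _ jl; have j0 := hr js.
apply: (le_trans (@overlap_bound m y j js jm _ yj)).
  by move=> v vs vm yv; apply: hj; rewrite mem_filter vm vs (mem_set yv).
rewrite ler_pdivrMr // mulrAC ler_pdivlMr ?r0 //.
have jF : j \in F by rewrite mem_filter jm.
(* The term of j itself bounds [rho y], as y lies in the cube of j. *)
have : rho y <= 2 * j.2.
  apply: (le_trans (rle y j jF)).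
  have : `|y - j.1| / (4 * Lc) <= j.2.
    rewrite ler_pdivrMr ?mulr_gt0 // (le_trans (ltW yj)) //.
    by rewrite ler_peMr ?(ltW j0) //; have := Lc_ge1; lra.
  lra.
move=> hrho; have := ler_wpM2l (ltW k10) hrho; lra.
Qed.

End approximation.

Lemma exists_min_radius : exists2 rmin, 0 < rmin & {in s, forall v, rmin <= v.2}.
Proof.
elim: s hr => [|v l IH] h; first by exists 1.
have [|r r0 hl] := IH _; first by move=> w wl; apply: h; rewrite inE wl orbT.
exists (Num.min v.2 r); first by rewrite lt_min r0 h ?mem_head.
move=> w; rewrite inE ge_min => /orP[/eqP ->|/hl ->]; first by rewrite lexx.
by rewrite orbT.
Qed.

Definition bv_const : R := 2 / @mu1 R d' * (8 * k1 * (8 * 32 ^+ d * Lc)).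

Lemma bv_const_ge0 : 0 <= bv_const.
Proof.
have e32 : 0 <= 32 ^+ d :> R by rewrite exprn_ge0.
by rewrite /bv_const mulr_ge0 ?divr_ge0 ?mu1_ge0 // mulr_ge0 // ?mulr_ge0 // ltW.
Qed.

(** For a cube of level k, [psi (lvl k)] of u keeps half of the mass and is the sum of the bands
    [th m] with m >= k. Each band is estimated by [level_bound], and the factors |dth m| in front of
    the gradient add up to at most 1. *)
Lemma bv_core (V : R) : (forall eps, 0 < eps -> exists u G, [/\ C1 u G,
     (nrm1 (fun x => u x - f x)%R <= eps%:E)%E & (\int[mu]_y (gsum G y)%:E <= V%:E)%E]) ->
  \sum_(v <- s) Lam * (2 ^+ d) ^+ kap v * v.2 ^+ d' <= bv_const * V.
Proof.
move=> HV; have [rmin rmin0 hrmin] := exists_min_radius.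
pose eps := Lam / 32 * (@mu1 R d' * rmin ^+ d).
have eps0 : 0 < eps by rewrite !mulr_gt0 ?invr_gt0 ?exprn_gt0.
have [u [G [CG uf GV]]] := HV _ eps0; have [cu cG _] := CG.
have heps : eps <= Lam / 32 * (@mu1 R d' * rmin ^+ d) by [].
have mff := L1_measurable Lf.
have muu := measurable_continuous cu.
pose M := (\max_(v <- s) kap v)%N.
have kM v : v \in s -> (kap v <= M)%N by move=> vs; apply: leq_bigmax_seq.
(* Above the top level M the truncation is replaced by 0, so that the telescoping sums end there;
   the last band [th M] is [psi (lvl M)] itself. *)
pose Psi m t := if (m <= M)%N then psi (lvl m) t else 0.
pose dPsi m t := if (m <= M)%N then dpsi (lvl m) t else 0.
pose th m t := Psi m t - Psi m.+1 t.
pose dth m t := dPsi m t - dPsi m.+1 t.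
pose ra m t := if (m <= M)%N then ramp (lvl m) t else 0.
have dP m (t : R) : is_derive t 1 (Psi m) (dPsi m t).
  rewrite /Psi /dPsi; case: ifP => _; last exact: is_derive_cst.
  by apply: is_derive_psi; exact: lvl_gt0.
have dt m (t : R) : is_derive t 1 (th m) (dth m t) by exact: is_deriveB.
have cP m : continuous (dPsi m).
  rewrite /dPsi; case: (m <= M)%N; last by move=> t; exact: cvg_cst.
  exact: continuous_dpsi.
have cdt m : continuous (dth m) by move=> t; apply: cvgB; exact: cP.
have P0 m t : `|t| <= lvl m -> Psi m t = 0.
  by rewrite /Psi => h; case: ifP => // _; rewrite psi_small.
have th0 m t : `|t| <= lvl m -> th m t = 0.
  by move=> h; rewrite /th !P0 ?subrr // (le_trans h) // lvl_mono.
have abs_dth m t : (m <= M)%N -> `|dth m t| = ra m t - ra m.+1 t.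
  move=> mM; rewrite /dth /dPsi /ra mM; case: (leqP m.+1 M) => h.
    by rewrite abs_dpsiB ?lvl_gt0 ?lvl_mono.
  by rewrite !subr0 abs_dpsi ?lvl_gt0.
have sum_dth t : \sum_(0 <= m < M.+1) `|dth m t| <= 1.
  rewrite (@telescope_sumr_eq _ 0 M.+1 (fun m => - ra m t)) //.
    by rewrite /ra ltnn oppr0 sub0r opprK; exact: ramp_le1 (lvl_gt0 _).
  by move=> m /andP[_ mM]; rewrite abs_dth // opprK addrC.
have psi_sum v t : v \in s -> `|psi (lvl (kap v)) t| <= \sum_(0 <= m < M.+1 | (kap v <= m)%N) `|th m t|.
  move=> vs; have -> : psi (lvl (kap v)) t = \sum_(kap v <= m < M.+1) th m t.
    rewrite (@telescope_sumr_eq _ (kap v) M.+1 (fun m => - Psi m t)) ?(leqW (kM v vs)) //.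
      by rewrite /Psi ltnn oppr0 sub0r opprK kM.
    by move=> m _; rewrite /th opprK addrC.
  apply: (le_trans (ler_norm_sum _ _ _)).
  by rewrite (big_nat_widenl _ 0%N).
have mth m : measurable_fun setT (fun y : T => th m (u y)).
  apply: (measurable_continuous (f := fun y => th m (u y))) => y.
  apply: (@continuous_comp _ _ _ u (th m)); first exact: cu.
  by apply: differentiable_continuous; apply/derivable1_diffP; have [] := dt m (u y).
have mpsi m : measurable_fun setT (fun y : T => psi (lvl m) (u y)).
  apply: (measurable_continuous (f := fun y => psi (lvl m) (u y))) => y.
  apply: (@continuous_comp _ _ _ u (psi (lvl m))); first exact: cu.
  by apply: differentiable_continuous; apply/derivable1_diffP; have [] := is_derive_psi (u y) (lvl_gt0 m).
have mi v (F : 'rV[R]_d -> R) : measurable_fun setT (F : T -> R) ->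
  measurable_fun setT (fun y : T => (\1_(cube v.1 v.2) y * `|F y|)%:E).
  move=> mF; apply/measurable_EFinP; apply: measurable_funM; first exact: measurable_indicT.
  exact: measurableT_comp.
(* Let B be the level. Of the mean of f, at least B, a quarter of B is lost to 2 * lvl k and B / 32
   to u - f, so more than B / 2 is left. The volume supplies v.2^d, hence the weight 1 / v.2. *)
have step1 v : v \in s -> ((Lam * (2 ^+ d) ^+ kap v * v.2 ^+ d')%:E <=
   (2 / @mu1 R d')%:E * ((v.2^-1)%:E * \int[mu]_y (\1_(cube v.1 v.2) y * `|psi (lvl (kap v)) (u y)|)%:E))%E.
  move=> vs; have v0 := hr vs; set k := kap v.
  set I := (\int[mu]_y _)%E.
  set B := Lam * (2 ^+ d) ^+ k.
  have B0 : 0 < B by rewrite /B mulr_gt0 // exprn_gt0 // exprn_gt0.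
  set X := @mu1 R d' * v.2 ^+ d; have X0 : 0 < X by rewrite mulr_gt0 // exprn_gt0.
  have h1 : ((B * X)%:E <= (mass f v.1 v.2)%:E)%E.
    have /andP[hm _] := hlev vs.
    by rewrite lee_fin (massE_mean _ _ m0 v0) ler_pM2r.
  have h2 : ((mass f v.1 v.2)%:E <= I + (B / 4 * X + B / 32 * X)%:E)%E.
    rewrite massE; last exact: L1_locint.
    have fs y : `|f y| <= `|psi (lvl k) (u y)| + `|2 * lvl k + `|u y - f y| |.
      have l0 := lvl_gt0 k.
      have := psi_lower (u y) l0; have := ler_norm (psi (lvl k) (u y)).
      have : 0 <= 2 * lvl k + `|u y - f y| by rewrite addr_ge0 // mulr_ge0 // ltW.
      move=> /ger0_norm ->.
      have : `|f y| <= `|u y| + `|u y - f y|.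
        by rewrite -[f y](subKr (u y)) (le_trans (ler_normB _ _)) // subKr.
      lra.
    apply: (le_trans (@int_indic_triangle f (fun y => psi (lvl k) (u y)) (fun y => 2 * lvl k + `|u y - f y|) _ _ _ _ fs)).
    - exact: mpsi.
    - apply: measurable_funD; first exact: measurable_cst.
      by apply: measurableT_comp => //; exact: measurable_funB.
    apply: leeD => //.
    apply: (@le_trans _ _ (\int[mu]_y ((2 * lvl k * \1_(cube v.1 v.2) y)%:E + `|(u y - f y)%:E|))%E).
      apply: le_int => y _; first by rewrite lee_fin mulr_ge0.
      have l0 := lvl_gt0 k.
      rewrite ger0_norm; last by rewrite addr_ge0 // mulr_ge0 // ltW.
      rewrite /abse -EFinD lee_fin indicE; case: (_ \in _); first by rewrite mul1r mulr1.
      by rewrite mul0r mulr0 add0r.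
    have l0 : 0 <= 2 * lvl k by rewrite mulr_ge0 // ltW // lvl_gt0.
    rewrite ge0_integralD; [|exact: measurableT| | | |].
    - rewrite EFinD; apply: leeD.
        under eq_integral do rewrite EFinM.
        rewrite ge0_integralZl_EFin //.
          rewrite integral_indic ?setIT; [|exact: measurableT|exact: measurable_cube].
          rewrite [X in (_ * X)%E](mu_cube v.1 v0) -EFinM lee_fin -/X /lvl -/B.
          by rewrite le_eqVlt; apply/orP; left; apply/eqP; field.
        by apply/measurable_EFinP; exact: measurable_indicT.
      by apply: (le_trans uf); rewrite lee_fin; exact: (@eps_small eps rmin rmin0 heps v.2 k (hrmin v vs)).
    - by move=> y _; rewrite lee_fin mulr_ge0.
    - apply/measurable_EFinP; apply: measurable_funM; first exact: measurable_cst.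
      exact: measurable_indicT.
    - by [].
    - by apply: measurableT_comp => //; apply/measurable_EFinP; exact: measurable_funB.
  have h3 : ((B / 2 * X)%:E <= I)%E.
    have : ((B * X - (B / 4 * X + B / 32 * X))%:E <= I)%E.
      by rewrite EFinB leeBlDr // (le_trans h1).
    apply: le_trans; rewrite lee_fin.
    have := mulr_gt0 B0 X0; lra.
  have c20 : 0 < 2 / @mu1 R d' by rewrite divr_gt0.
  have iv0 : 0 < v.2^-1 by rewrite invr_gt0.
  have := h3; rewrite -(@lee_pmul2l _ (2 / @mu1 R d' * v.2^-1)%:E) ?lte_fin ?(mulr_gt0 c20 iv0) //.
  rewrite -EFinM [in X in _ -> (_ <= X)%E]muleA -EFinM; apply: le_trans.
  rewrite lee_fin /X exprS le_eqVlt; apply/orP; left; apply/eqP.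
  by field; rewrite (gt_eqF m0) (gt_eqF v0).
rewrite -lee_fin -sumEFin.
(* A cube of level k uses the bands m >= k. After the exchange of sums the band m is therefore
   paired exactly with the cubes of level at most m. *)
apply: (@le_trans _ _ (\sum_(v <- s) (2 / @mu1 R d')%:E * (\sum_(0 <= m < M.+1 | (kap v <= m)%N)
   ((v.2^-1)%:E * \int[mu]_y (\1_(cube v.1 v.2) y * `|th m (u y)|)%:E)))%E).
  rewrite big_seq [leRHS]big_seq; apply: lee_sum => v vs; have v0 := hr vs.
  apply: (le_trans (step1 v vs)); apply: lee_wpmul2l; first by rewrite lee_fin divr_ge0 // mu1_ge0.
  rewrite -ge0_sume_distrr; last by move=> m _; apply: integral_ge0 => y _; rewrite lee_fin mulr_ge0.
  apply: lee_wpmul2l; first by rewrite lee_fin invr_ge0 ltW.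
  rewrite -big_filter -ge0_integral_sum.
  - apply: le_int => y _; first by rewrite lee_fin mulr_ge0.
    by rewrite sumEFin lee_fin -mulr_sumr ler_wpM2l // big_filter psi_sum.
  - exact: measurableT.
  - by move=> m; exact: (mi v (fun y => th m (u y)) (mth m)).
  - by move=> m y _; rewrite lee_fin mulr_ge0.
rewrite big_seq -ge0_sume_distrr; last first.
  move=> v vs; apply: sume_ge0 => m _; apply: mule_ge0; first by rewrite lee_fin invr_ge0 ltW // hr.
  by apply: integral_ge0 => y _; rewrite lee_fin mulr_ge0.
rewrite -big_seq (exchange_big_dep xpredT) //=.
have kc0 : 0 <= 8 * k1 * (8 * 32 ^+ d * Lc).
  have e32 : 0 <= 32 ^+ d :> R by rewrite exprn_ge0.
  by rewrite mulr_ge0 // ?mulr_ge0 // ltW.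
apply: (@le_trans _ _ ((2 / @mu1 R d')%:E * (\sum_(0 <= m < M.+1) ((8 * k1 * (8 * 32 ^+ d * Lc))%:E * \int[mu]_y (`|dth m (u y)| * gsum G y)%:E)))%E).
  apply: lee_wpmul2l; first by rewrite lee_fin divr_ge0 // mu1_ge0.
  by apply: lee_sum => m _; exact: (level_bound CG uf rmin0 hrmin heps (dt m) (cdt m) (th0 m)).
rewrite /bv_const -(mulrA (2 / @mu1 R d')) (EFinM (2 / @mu1 R d')) (EFinM (8 * k1 * _)); apply: lee_wpmul2l; first by rewrite lee_fin divr_ge0 // mu1_ge0.
rewrite -ge0_sume_distrr; last first.
  by move=> m _; apply: integral_ge0 => y _; rewrite lee_fin mulr_ge0 ?gsum_ge0.
apply: lee_wpmul2l; first by rewrite lee_fin.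
apply: le_trans GV; rewrite -ge0_integral_sum.
- apply: le_int => y _; first by apply: sume_ge0 => m _; rewrite lee_fin mulr_ge0 ?gsum_ge0.
  by rewrite sumEFin lee_fin -mulr_suml ler_piMl ?gsum_ge0.
- exact: measurableT.
- move=> m; apply/measurable_EFinP; apply: measurable_funM.
    apply: measurableT_comp => //.
    apply: (measurable_continuous (f := fun y => dth m (u y))) => y.
    by apply: (@continuous_comp _ _ _ u (dth m)); [exact: cu|exact: cdt].
  by apply: measurable_continuous; exact: gsum_continuous.
- by move=> m y _; rewrite lee_fin mulr_ge0 ?gsum_ge0.
Qed.

End core.

(** * Weak derivatives and mollification *)

Section smooth_functions.
Context {R : realType} {d' : nat}.
Local Notation d := d'.+1.
Local Notation T := (vec R d').
Local Notation mu := (@mu R d').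
Implicit Types (x y : 'rV[R]_d) (k : 'I_d -> nat).

(** A partial derivative of a member of the family is a multiple of a member, hence so is every
    iterated partial derivative demanded by [smooth]. Applied to the reflected kernels and to
    convolutions. *)
Lemma smooth_family (Phi : ('I_d -> nat) -> 'rV[R]_d -> R) (c : R) :
  (forall k, continuous (Phi k)) ->
  (forall k i x, is_derive x (evec R i) (Phi k) (c * Phi (incr k i) x)) ->
  forall k (a : R), smooth (fun x => a * Phi k x) /\
    forall i x, partial i (fun x => a * Phi k x) x = a * (c * Phi (incr k i) x).
Proof.
move=> cP dP.
have dPa k a i x : is_derive x (evec R i) (fun x => a * Phi k x) (a * (c * Phi (incr k i) x)).
  exact: (@is_deriveZ _ _ _ (Phi k) a x (evec R i) _ (dP k i x)).
have pE k a i : partial i (fun x => a * Phi k x) = (fun x => (a * c) * Phi (incr k i) x).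
  by apply/funext => x; rewrite /partial (@derive_val _ _ _ _ _ _ _ (dPa k a i x)) mulrA.
move=> k a; split; last by move=> i x; rewrite pE mulrA.
have ds s : exists k' a', dpart s (fun x => a * Phi k x) = (fun x => a' * Phi k' x).
  elim: s => [|i s [k' [a' IH]]]; first by exists k, a.
  by exists (incr k' i), (a' * c) => /=; rewrite IH pE.
move=> s; have [k' [a' ->]] := ds s; split.
  by move=> x; apply: continuousM; [exact: cst_continuous|exact: cP].
by move=> i x; have [] := dPa k' a' i x.
Qed.

Lemma enorm_le x : enorm x <= d%:R * `|x|.
Proof.
rewrite /enorm -[leRHS]ger0_norm ?mulr_ge0 // -sqrtr_sqr; apply: ler_wsqrtr.
rewrite exprMn; apply: (@le_trans _ _ (\sum_(i < d) `|x| ^+ 2)).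
  by apply: ler_sum => i _; rewrite -[leLHS]real_normK ?num_real // lerXn2r ?nnegrE // coord_le_norm.
rewrite sumr_const card_ord -[leLHS]mulr_natl ler_wpM2r ?sqr_ge0 // expr2 ler_peMr //.
by rewrite ler1n.
Qed.

Lemma vanish_far (phi : 'rV[R]_d -> R) (r : R) : (forall x, r <= `|x| -> phi x = 0) ->
  exists r', forall x, r' < enorm x -> phi x = 0.
Proof.
move=> h; exists (d%:R * r) => x hx; apply: h.
have : d%:R * r < d%:R * `|x| by exact: lt_le_trans (enorm_le x).
by rewrite ltr_pM2l // => /ltW.
Qed.

Lemma sum_evec (i : 'I_d) (F : 'I_d -> R) : \sum_(j < d) evec R i ord0 j * F j = F i.
Proof.
rewrite (bigD1 i) //= /evec mxE !eqxx mul1r big1 ?addr0 // => j ji.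
by rewrite mxE eqxx (negbTE ji) mul0r.
Qed.

Lemma is_derive_kern_reflect e k x i y :
  is_derive y (evec R i) (fun y => kern e k (x - y)) (- e^-1 * kern e (incr k i) (x - y)).
Proof.
apply: is_derive_from_line.
have := is_derive_kern_line e k (x - y) (- evec R i) 0.
have -> : (fun s : R => kern e k (x - (y + s *: evec R i))) = (fun t : R => kern e k (t *: - evec R i + (x - y))).
  by apply/funext => s; congr kern; rewrite scalerN opprD addrA addrC.
move/is_derive_eq; apply; rewrite scale0r add0r.
under eq_bigr do rewrite mxE -mulrA mulNr.
by rewrite sumrN sum_evec mulNr.
Qed.

Lemma kern_reflect_continuous e k x : 0 < e -> continuous (fun y => kern e k (x - y)).
Proof.
move=> e0 y; have [L L0 hL] := kern_lip k e0.
apply: (@continuous_at_lip _ _ _ _ L) => // z _.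
by apply: (le_trans (hL _ _)); rewrite opprB addrC addrA subrK distrC.
Qed.

Lemma kern_test e x : 0 < e -> test_fun (fun y => kern e k0 (x - y)) /\
  forall i y, partial i (fun y => kern e k0 (x - y)) y = - e^-1 * kern e (incr k0 i) (x - y).
Proof.
move=> e0.
have [h1 h2] := @smooth_family (fun k y => kern e k (x - y)) (- e^-1)
   (fun k => @kern_reflect_continuous e k x e0) (fun k i y => is_derive_kern_reflect e k x i y) k0 1.
have E : (fun y => 1 * kern e k0 (x - y)) = (fun y => kern e k0 (x - y)).
  by apply/funext => y; rewrite mul1r.
rewrite E in h1 h2; split; last by move=> i y; rewrite h2 mul1r.
split => //; apply: (@vanish_far _ (`|x| + e)) => y hy; apply: kern_out => //.
by have := lerB_dist y x; rewrite distrC; lra.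
Qed.

Lemma is_derive_cvl_coord F e k i x : locint F -> 0 < e ->
  is_derive x (evec R i) (cvl F e k) (e^-1 * cvl F e (incr k i) x).
Proof.
move=> lF e0; have := is_derive_cvl k x (evec R i) lF e0.
move/is_derive_eq; apply; under eq_bigr do rewrite -mulrA.
by rewrite sum_evec.
Qed.

Lemma cvl_test F e (a r : R) : locint F -> 0 < e -> (forall x, r <= `|x| -> F x = 0) ->
  test_fun (fun x => a * cvl F e k0 x) /\
  forall i x, partial i (fun x => a * cvl F e k0 x) x = a * (e^-1 * cvl F e (incr k0 i) x).
Proof.
move=> lF e0 hF.
have [h1 h2] := @smooth_family (cvl F e) e^-1
   (fun k => @cvl_continuous _ _ F e k lF e0) (fun k i y => is_derive_cvl_coord k i y lF e0) k0 a.
split => //; split => //; apply: (@vanish_far _ (r + e)) => x hx.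
rewrite /cvl (_ : (fun y => _) = cst 0) ?Rintegral_cst0 ?mulr0 //; first by rewrite /Rintegral integral0 mulr0.
apply/funext => y; have [/hF ->|hy] := leP r `|y|; first by rewrite mul0r.
by rewrite kern_out ?mulr0 //; have := lerB_dist x y; lra.
Qed.

Lemma integsE (h : 'rV[R]_d -> R) : mu.-integrable setT (fun y : T => (h y)%:E) ->
  integs h = (\int[mu]_y h y)%:E.
Proof.
move=> ih; have /integrableP[mh _] := ih.
have mh' : measurable_fun setT (h : T -> R) by exact/measurable_EFinP.
rewrite /Rintegral fineK; last exact: integrable_fin_num.
rewrite /integs integralE; congr (_ - _)%E; rewrite layer_cake.
- by apply: eq_integral => y _; rewrite funeposE EFin_max.
- by apply/measurable_EFinP; apply: measurable_maxr.
- by move=> y; rewrite lee_fin le_max lexx orbT.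
- by apply: eq_integral => y _; rewrite funenegE EFin_max EFinN.
- apply/measurable_EFinP; apply: measurable_maxr => //; exact: measurable_funN.
- by move=> y; rewrite lee_fin le_max lexx orbT.
Qed.

Lemma C1_moll f e : locint f -> 0 < e ->
  C1 (moll f e) (fun i x => (@Kint R d' e)^-1 * (e^-1 * cvl f e (incr k0 i) x)).
Proof.
move=> lf e0; split.
- by move=> x; apply: continuousM; [exact: cvl_continuous|exact: cst_continuous].
- move=> i x; have cc := cvl_continuous (k := incr k0 i) lf e0 (x := x).
  by apply: (continuousM (s := fun=> (@Kint R d' e)^-1) (t := fun x => e^-1 * cvl f e (incr k0 i) x)); [exact: cst_continuous|apply: (continuousM (s := fun=> e^-1)); [exact: cst_continuous|exact: cc]].
- move=> x h; have := @is_deriveZ _ _ _ (cvl f e k0) (@Kint R d' e)^-1 x h _ (is_derive_cvl k0 x h lf e0).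
  have -> : ((@Kint R d' e)^-1 \*: cvl f e k0 = moll f e) by apply/funext => y; rewrite /moll mulrC.
  move/is_derive_eq; apply; rewrite /GRing.scale /= mulr_sumr; apply: eq_bigr => i _; ring.
Qed.

(** The weak formulation is tested with y -> kern (x - y); the minus sign from differentiating in y
    cancels the one from integration by parts. *)
Lemma weak_derivative_cvl (f g : 'rV[R]_d -> R) i e x : locint f -> locint g -> 0 < e ->
  (forall phi, test_fun phi ->
     integs (fun x => f x * partial i phi x) = (- integs (fun x => (g x * phi x)%R))%E) ->
  e^-1 * cvl f e (incr k0 i) x = cvl g e k0 x.
Proof.
move=> lf lg e0 h; have [tk pk] := kern_test x e0.
have := h _ tk.
have -> : (fun y => f y * partial i (fun y => kern e k0 (x - y)) y) =
   (fun y => - e^-1 * (f y * kern e (incr k0 i) (x - y))).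
  by apply/funext => y; rewrite pk mulrCA.
rewrite integsE; last by apply: integrable_EFinZ; exact: integrable_cvl.
rewrite integsE; last exact: integrable_cvl.
rewrite RintegralZl; [|exact: measurableT|exact: integrable_cvl].
rewrite -EFinN => -[]; rewrite -/(cvl f e (incr k0 i) x) -/(cvl g e k0 x) mulNr.
by move/oppr_inj.
Qed.

Lemma C1_moll_weak (f : 'rV[R]_d -> R) (g : 'I_d -> 'rV[R]_d -> R) e :
  locint f -> (forall i, locint (g i)) -> 0 < e ->
  (forall i phi, test_fun phi ->
     integs (fun x => f x * partial i phi x) = (- integs (fun x => (g i x * phi x)%R))%E) ->
  C1 (moll f e) (fun i => moll (g i) e).
Proof.
move=> lf lg e0 h; have := C1_moll lf e0.
congr C1; apply/funext => i; apply/funext => x.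
by rewrite (weak_derivative_cvl x lf (lg i) e0 (h i)) /moll mulrC.
Qed.

End smooth_functions.

Section BV_approximation.
Context {R : realType} {d' : nat}.
Local Notation d := d'.+1.
Local Notation T := (vec R d').
Local Notation mu := (@mu R d').
Hypothesis m0 : 0 < @mu1 R d'.
Implicit Types (x y : 'rV[R]_d) (k : 'I_d -> nat) (f F G : 'rV[R]_d -> R).

Lemma L1_mul_bounded F G (B : R) : L1 F -> measurable_fun setT (G : T -> R) ->
  (forall x, `|G x| <= B) -> L1 (fun x => F x * G x).
Proof.
move=> LF mG GB; have mF := L1_measurable LF.
have B0 : 0 <= B by exact: le_trans (GB 0).
apply: L1P; first exact: measurable_funM.
apply: (@le_lt_trans _ _ (\int[mu]_x (B%:E * `|(F x)%:E|))%E).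
  by apply: le_int => x _ //; rewrite /abse -EFinM lee_fin normrM mulrC ler_wpM2r.
rewrite ge0_integralZl_EFin //; last by apply: measurableT_comp => //; exact/measurable_EFinP.
have := L1_nrm1 LF; have : (0 <= nrm1 F)%E by exact: integral_ge0.
by rewrite -/(nrm1 F); case: (nrm1 F) => // a _ _; rewrite -EFinM ltry.
Qed.

Lemma cvl_bounded F e k : L1 F -> 0 < e -> exists B, forall y, `|cvl F e k y| <= B.
Proof.
move=> LF e0; have [M M0 hM] := @kern_bound R d' k.
exists (M * fine (nrm1 F)) => y.
have ii := integrable_cvl k y (L1_locint LF) e0.
rewrite -lee_fin EFinM fineK; last by rewrite ge0_fin_numE; [exact: L1_nrm1|exact: integral_ge0].
rewrite EFin_normr_Rintegral //; apply: (le_trans (le_abse_integral mu measurableT _)).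
  by have /integrableP[] := ii.
have mF := L1_measurable LF.
rewrite -ge0_integralZl_EFin //; last by apply: measurableT_comp => //; exact/measurable_EFinP.
by apply: le_int => x _ //; rewrite /abse -EFinM lee_fin normrM mulrC ler_wpM2r.
Qed.

Lemma kern_fubini F G e k : L1 F -> L1 G -> 0 < e ->
  \int[mu]_y (F y * cvl G e k y) =
  \int[mu]_x (G x * \int[mu]_y (F y * kern e k (y - x))).
Proof.
move=> LF LG e0; have mF := L1_measurable LF; have mG := L1_measurable LG.
pose h (z : T * T) : \bar R := (F z.1 * (G z.2 * kern e k (z.1 - z.2 : 'rV[R]_d)))%:E.
have [M M0 hM] := @kern_bound R d' k.
have mF1 : measurable_fun setT (fun z : T * T => F z.1) by exact: (measurableT_comp mF measurable_fst).
have mG2 : measurable_fun setT (fun z : T * T => G z.2) by exact: (measurableT_comp mG measurable_snd).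
have mh : measurable_fun setT h.
  apply/measurable_EFinP; apply: measurable_funM => //; apply: measurable_funM => //.
  exact: measurable_kern2.
have ih : (mu \x mu)%E.-integrable setT h.
  apply/integrableP; split => //.
  rewrite (@fubini_tonelli1 _ _ _ _ _ mu mu (fun z => `|h z|%E)) //; last by apply: measurableT_comp.
  apply: (@le_lt_trans _ _ (\int[mu]_y (`|F y|%:E * (M%:E * nrm1 G)))%E).
    apply: le_int => y _; first by apply: integral_ge0 => x _.
    rewrite /nrm1 -!ge0_integralZl_EFin //; first last.
    - apply: measurableT_comp => //; exact/measurable_EFinP.
    - apply/measurable_EFinP; apply: measurable_funM => //; exact: measurableT_comp.
    - by move=> x _; rewrite mule_ge0.
    apply: le_int => x _ //.
    rewrite /h /= -!EFinM lee_fin !normrM ler_wpM2l // mulrC ler_wpM2r //.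
  rewrite ge0_integralZr //; first last.
  - by rewrite mule_ge0 ?lee_fin //; exact: integral_ge0.
  - by apply/measurable_EFinP; exact: measurableT_comp.
  have := L1_nrm1 LF; have := L1_nrm1 LG.
  have : (0 <= nrm1 F)%E by exact: integral_ge0.
  have : (0 <= nrm1 G)%E by exact: integral_ge0.
  rewrite -/(nrm1 F); case: (nrm1 F) => // a; case: (nrm1 G) => // b _ _ _ _.
  by rewrite -!EFinM ltry.
have kc x : continuous (fun y => kern e k (y - x)).
  move=> y; have [L L0 hL] := kern_lip k e0; apply: (@continuous_at_lip _ _ _ _ L) => // z _.
  by apply: (le_trans (hL _ _)); rewrite opprB addrA subrK.
have in1 y : mu.-integrable setT (fun x : T => (G x * kern e k (y - x))%:E).
  by apply: integrable_cvl => //; exact: L1_locint.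
have in2 x : mu.-integrable setT (fun y : T => (F y * kern e k (y - x))%:E).
  apply: (@L1_mul_bounded F (fun y => kern e k (y - x)) M LF) => //.
  by apply: measurable_continuous; exact: kc.
have E := @Fubini _ _ _ _ _ mu mu h ih.
have E1 : (\int[mu]_y (F y * cvl G e k y)%:E = \int[mu]_y \int[mu]_x h (y, x))%E.
  apply: eq_integral => y _.
  rewrite EFinM /cvl /Rintegral fineK; last exact: (integrable_fin_num _ (in1 y)).
  rewrite -integralZl; [|exact: measurableT|exact: in1].
  by apply: eq_integral => x _; rewrite /h /= -EFinM.
have E2 : (\int[mu]_x (G x * \int[mu]_y (F y * kern e k (y - x)))%:E = \int[mu]_x \int[mu]_y h (y, x))%E.
  apply: eq_integral => x _.
  rewrite EFinM /Rintegral fineK; last exact: (integrable_fin_num _ (in2 x)).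
  rewrite -integralZl; [|exact: measurableT|exact: in2].
  by apply: eq_integral => y _; rewrite /h /= -EFinM mulrCA.
exact: (congr1 fine (etrans E1 (etrans E (esym E2)))).
Qed.

Lemma sbump0_even (t : R) : sbump 0 (- t) = sbump 0 t.
Proof.
have E (s : R) : sbump 0 s = mono 0 (1 - s) * mono 0 (1 + s).
  by rewrite /sbump /val_terms big_seq1 /term_val /= mul1r.
by rewrite !E opprK mulrC.
Qed.

Lemma sbump1_odd (t : R) : sbump 1 (- t) = - sbump 1 t.
Proof.
have h1 := is_derive_sbump 0 t.
have hN : is_derive t 1 (fun s : R => - s) (-1).
  apply: (@is_derive_quadratic _ _ _ _ _ _ 0) => h _; rewrite [h *: 1]mulr1 mul0r.
  by rewrite (_ : _ - _ - _ = 0) ?normr0 //; ring.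
have h2 : is_derive t 1 (fun s : R => sbump 0 (- s)) (sbump 1 (- t) * (-1)).
  exact: (is_derive1_comp (is_derive_sbump 0 (- t)) hN).
have E : (fun s : R => sbump 0 (- s)) = sbump 0 by apply/funext => s; rewrite sbump0_even.
rewrite E in h2.
have := @derive_val _ _ _ _ _ _ _ h2; rewrite (@derive_val _ _ _ _ _ _ _ h1) mulrN1 => ->.
by rewrite opprK.
Qed.

Lemma kern1_odd e i x : kern e (incr k0 i) (- x) = - kern e (incr k0 i) x.
Proof.
rewrite /kern (bigD1 i) //= [in RHS](bigD1 i) //= mxE mulNr -[RHS]mulNr; congr (_ * _).
  by rewrite /incr /k0 eqxx addn1 sbump1_odd.
apply: eq_bigr => j ji; rewrite mxE mulNr /incr /k0 (negbTE ji) addn0 sbump0_even //.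
Qed.

Definition sgf (t : R) : R := \1_(`]0, +oo[%classic) t - \1_(`]-oo, 0[%classic) t.

Lemma sgfE t : t * sgf t = `|t|.
Proof.
rewrite /sgf !indicE; have [t0|t0|->] := ltrgt0P t.
- rewrite mem_set ?memNset ?subr0 ?mulr1 //= in_itv /= ?andbT //.
  by apply/negP; rewrite -leNgt ltW.
- rewrite memNset ?mem_set ?sub0r ?mulrN1 //= in_itv /= ?andbT //.
  by apply/negP; rewrite -leNgt ltW.
- by rewrite mul0r.
Qed.

Lemma sgf_le1 t : `|sgf t| <= 1.
Proof.
rewrite /sgf !indicE.
by case: (_ \in _); case: (_ \in _); rewrite ?subrr ?subr0 ?sub0r ?normrN ?normr1 ?normr0.
Qed.

Lemma measurable_sgf : measurable_fun setT sgf.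
Proof. by apply: measurable_funB; apply: measurable_indic; exact: measurable_itv. Qed.

Definition dmoll f e (i : 'I_d) x : R := (@Kint R d' e)^-1 * (e^-1 * cvl f e (incr k0 i) x).

Lemma dmoll_continuous f e i : locint f -> 0 < e -> continuous (dmoll f e i).
Proof. by move=> lf e0; have [_ h _] := C1_moll lf e0; exact: h. Qed.

(* The test field is the mollification of the sign of [dmoll f e i] restricted to a cube. *)
Lemma int_dmoll_cube_le f e i (N : R) : L1 f -> 0 < e ->
  (\int[mu]_(x in cube 0 N) `|(dmoll f e i x)%:E| <= var f)%E.
Proof.
move=> Lf e0; have lf := L1_locint Lf.
have Kg := Kint_gt0 m0 e0; set K := @Kint R d' e in Kg *.
have cG := @dmoll_continuous f e i lf e0; set G := dmoll f e i in cG *.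
have mG : measurable_fun setT (G : T -> R) by exact: measurable_continuous.
pose ps x := \1_(cube 0 N) x * sgf (G x).
have mps : measurable_fun setT (ps : T -> R).
  apply: measurable_funM; first exact: measurable_indicT.
  exact: (measurableT_comp measurable_sgf mG).
have ps1 x : `|ps x| <= \1_(cube 0 N) x.
  by rewrite /ps normrM ger0_norm // ler_piMr // sgf_le1.
have ps0 x : N <= `|x| -> ps x = 0.
  by move=> h; rewrite /ps indicE memNset ?mul0r // /cube /= subr0; apply/negP; rewrite -leNgt.
have Lps : L1 ps.
  apply: L1P => //; apply: (@le_lt_trans _ _ (\int[mu]_x (\1_(cube 0 N) x)%:E)%E).
    by apply: le_int => x _ //=; rewrite lee_fin.
  by rewrite integral_indic ?setIT; [exact: mu_cube_fin|exact: measurableT|exact: measurable_cube].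
have lps := L1_locint Lps.
(* Only the component i is nonzero, so the bound on the Euclidean norm of the field is a sup bound
   on one mollification. *)
pose phi j x := (if j == i then - K^-1 else 0) * cvl ps e k0 x.
have tphi j := cvl_test (if j == i then - K^-1 else 0) lps e0 ps0.
have dphi : (fun x => \sum_(j < d) partial j (phi j) x) = (fun x => - (K^-1 * (e^-1 * cvl ps e (incr k0 i) x))).
  apply/funext => x; rewrite (bigD1 i) //= big1 ?addr0.
    by rewrite [LHS](tphi i).2 eqxx mulNr.
  by move=> j ji; rewrite [LHS](tphi j).2 (negbTE ji) mul0r.
have phi1 x : Num.sqrt (\sum_(j < d) phi j x ^+ 2) <= 1.
  rewrite (bigD1 i) //= big1 ?addr0; last first.
    by move=> j ji; rewrite /phi (negbTE ji) mul0r expr0n.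
  rewrite sqrtr_sqr /phi eqxx normrM normrN normfV (gtr0_norm Kg) ler_pdivrMl // mulr1.
  rewrite -lee_fin; apply: (le_trans (cvl_norm_le x lps e0)).
  rewrite /K -(int_kernl x e0); apply: le_int => y _.
    by rewrite lee_fin mulr_ge0 ?kern0_ge0.
  rewrite lee_fin ler_piMl ?kern0_ge0 // (le_trans (ps1 y)) // indicE.
apply: (@le_trans _ _ (integs (fun x => f x * \sum_(j < d) partial j (phi j) x))); last first.
  by apply: ereal_sup_ubound; exists phi => //; split => // j; exact: (tphi j).1.
have cps k : continuous (cvl ps e k) by exact: cvl_continuous.
have kc x : \int[mu]_y (f y * kern e (incr k0 i) (y - x)) = - cvl f e (incr k0 i) x.
  rewrite /cvl -mulN1r -RintegralZl; [|exact: measurableT|exact: integrable_cvl].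
  by apply: eq_Rintegral => y _; rewrite -opprB kern1_odd mulN1r mulrN.
have [B bps] := cvl_bounded (incr k0 i) Lps e0.
have mc : measurable_fun setT (cvl ps e (incr k0 i) : T -> R) by exact: measurable_continuous.
have Lfc := L1_mul_bounded Lf mc bps.
have E : (fun x => f x * \sum_(j < d) partial j (phi j) x) =
  (fun x => - (K^-1 * e^-1) * (f x * cvl ps e (incr k0 i) x)).
  by apply/funext => x; rewrite (congr1 (fun g => g x) dphi); ring.
rewrite E integsE; last exact: integrable_EFinZ.
rewrite RintegralZl; [|exact: measurableT|exact: Lfc].
(* The derivative passes from the mollified sign to f. The first-order kernel is odd, and the
   resulting minus sign cancels the one built into [phi]. *)
rewrite (kern_fubini (incr k0 i) Lf Lps e0).
have [Mc hMc] := cvl_bounded (incr k0 i) Lf e0.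
have ii2 : mu.-integrable setT (fun x : T => (ps x * cvl f e (incr k0 i) x)%:E).
  apply: (L1_mul_bounded Lps _ hMc).
  by apply: measurable_continuous; exact: cvl_continuous.
under eq_Rintegral do rewrite kc mulrN -mulN1r.
rewrite RintegralZl; [|exact: measurableT|exact: ii2].
rewrite mulN1r mulrNN -RintegralZl; [|exact: measurableT|exact: ii2].
rewrite /Rintegral fineK; last first.
  by apply: integrable_fin_num => //; exact: integrable_EFinZ.
rewrite (int_indicE mu _ (fun x => `|G x|)).
rewrite le_eqVlt; apply/orP; left; apply/eqP; apply: eq_integral => x _; congr (_%:E).
by rewrite -sgfE /ps /G /dmoll; ring.
Qed.

End BV_approximation.

Section approximation.
Context {R : realType} {d' : nat}.
Local Notation d := d'.+1.
Local Notation T := (vec R d').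
Local Notation mu := (@mu R d').
Implicit Types (x y c : 'rV[R]_d) (f F : 'rV[R]_d -> R) (g G : 'I_d -> 'rV[R]_d -> R).

Lemma Lpnorm_int (p : R) (F : 'rV[R]_d -> R) : lmeasurable_fun F ->
  Lpnorm p (fun x => (F x)%:E) = ((\int[mu]_x (`|F x| `^ p)%:E) `^ p^-1)%E.
Proof.
move=> /lmeasurable_funP mF; rewrite /Lpnorm layer_cake.
- by under eq_integral do rewrite abse_EFin poweR_EFin.
- rewrite (_ : (fun x => _) = (fun x : T => (`|F x| `^ p)%:E)); last first.
    by apply/funext => x; rewrite abse_EFin poweR_EFin.
  apply/measurable_EFinP; apply: (measurableT_comp (measurable_powR p)).
  exact: measurableT_comp.
- by move=> x; rewrite poweR_ge0.
Qed.

Lemma Lpnorm_lty (p : R) F : 0 < p -> lmeasurable_fun F ->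
  (Lpnorm p (fun x => (F x)%:E) < +oo)%E -> (\int[mu]_x (`|F x| `^ p)%:E < +oo)%E.
Proof.
move=> p0 mF; rewrite Lpnorm_int //; apply: lty_poweRy.
by rewrite invr_neq0 // gt_eqF.
Qed.

Lemma locint_Lp (p : R) F : 1 <= p -> lmeasurable_fun F ->
  (Lpnorm p (fun x => (F x)%:E) < +oo)%E -> locint F.
Proof.
move=> p1 mF /(Lpnorm_lty (lt_le_trans ltr01 p1) mF) h; move/lmeasurable_funP: mF => mF.
split => // r.
apply: (@le_lt_trans _ _ (\int[mu]_x ((\1_(cube 0 r) x)%:E + (`|F x| `^ p)%:E))%E).
  rewrite (int_indicE mu _ (fun x => `|F x|)); apply: le_int => x _; first by rewrite lee_fin mulr_ge0.
  rewrite -EFinD lee_fin indicE; case: (_ \in _); rewrite ?mul1r ?mul0r ?addr_ge0 ?powR_ge0 //.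
  have [F1|F1] := leP `|F x| 1; first by rewrite (le_trans F1) // lerDl powR_ge0.
  rewrite (@le_trans _ _ (`|F x| `^ p)) ?lerDr //.
  by rewrite -[leLHS]powRr1 // ler_powR // ltW.
rewrite ge0_integralD.
- rewrite integral_indic ?setIT; [|exact: measurableT|exact: measurable_cube].
  by rewrite lte_add_pinfty // mu_cube_fin.
- exact: measurableT.
- by move=> x _; rewrite lee_fin.
- by apply/measurable_EFinP; exact: measurable_indicT.
- by move=> x _; rewrite lee_fin powR_ge0.
- apply/measurable_EFinP; apply: (measurableT_comp (measurable_powR p)).
  exact: measurableT_comp.
Qed.

Lemma L1_Lp1 F : lmeasurable_fun F -> (Lpnorm 1 (fun x => (F x)%:E) < +oo)%E -> L1 F.
Proof.
move=> mF /(Lpnorm_lty ltr01 mF) h; move/lmeasurable_funP: mF => mF; apply: L1P => //.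
by move: h; under eq_integral do rewrite powRr1 //.
Qed.

Hypothesis m0 : 0 < @mu1 R d'.

Lemma int_dmoll_le f e i : L1 f -> 0 < e -> (nrm1 (dmoll f e i) <= var f)%E.
Proof.
move=> Lf e0; have lf := L1_locint Lf.
have mG : measurable_fun setT (fun x : T => `|(dmoll f e i x)%:E|%E).
  apply: measurableT_comp => //; apply/measurable_EFinP.
  by apply: measurable_continuous; exact: dmoll_continuous.
have mono : {homo (fun n : nat => cube (0 : 'rV[R]_d) n%:R : set T) : n m / (n <= m)%N >-> (n <= m)%O}.
  move=> n m nm; rewrite subsetEset; apply: cube_sub.
  by rewrite subrr normr0 add0r ler_nat.
have := @ge0_nondecreasing_set_cvg_integral _ _ R _ (fun x : T => `|(dmoll f e i x)%:E|%E) mu mono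
  (fun n => measurable_cube 0 n%:R) (fun n => measurable_funTS mG) (fun n x _ => abse_ge0 _).
have -> : \bigcup_n (cube (0 : 'rV[R]_d) n%:R : set T) = setT.
  apply/seteqP; split => // x _; exists (Num.bound `|x|) => //.
  by rewrite /cube /= subr0 archi_boundP.
move=> cv; rewrite /nrm1 -(cvg_lim _ cv) //.
apply: lime_le; first by apply/cvg_ex; eexists; exact: cv.
by apply: nearW => n; exact: int_dmoll_cube_le.
Qed.

Lemma nrm1_gsum G : (forall i, measurable_fun setT (G i : T -> R)) ->
  (\int[mu]_x (gsum G x)%:E = \sum_(i < d) nrm1 (G i))%E.
Proof.
move=> mG; rewrite /nrm1 -ge0_integral_sum //.
- by apply: eq_integral => x _; rewrite sumEFin.
- by move=> i; apply: measurableT_comp => //; apply/measurable_EFinP; exact: mG.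
Qed.

(** Each partial derivative of the mollification is bounded separately by [var f], whence the factor
    d. *)
Lemma BV_approx f : BV f -> L1 f /\ forall eps, 0 < eps -> exists u G, [/\ C1 u G,
  (nrm1 (fun x => u x - f x)%R <= eps%:E)%E & (\int[mu]_y (gsum G y)%:E <= (d%:R * fine (var f))%:E)%E].
Proof.
move=> [mf Lf vf]; have L1f := L1_Lp1 mf Lf; split=> // eps eps0.
have [_ /(_ _ eps0)[e0 e00 he]] := L1_L1cvg m0 L1f.
have e2 : 0 < e0 / 2 by rewrite divr_gt0.
have ee : e0 / 2 < e0 by rewrite ltr_pdivrMr // ltr_pMr // ltr1n.
exists (moll f (e0 / 2)), (dmoll f (e0 / 2)); split.
- exact: C1_moll (L1_locint L1f) e2.
- exact: he.
have v0 : (0 <= var f)%E.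
  by apply: le_trans (int_dmoll_le ord0 L1f e2); exact: integral_ge0.
rewrite nrm1_gsum; last first.
  by move=> i; apply: measurable_continuous; apply: dmoll_continuous => //; exact: L1_locint.
have vE : var f = (fine (var f))%:E by rewrite fineK ?ge0_fin_numE.
apply: (@le_trans _ _ (\sum_(i < d) (fine (var f))%:E)%E).
  by apply: lee_sum => i _; rewrite -vE; exact: int_dmoll_le.
by rewrite sumEFin sumr_const card_ord -[X in (X%:E <= _)%E]mulr_natl.
Qed.

Lemma locint_moll f e : locint f -> 0 < e -> locint (moll f e).
Proof.
move=> lf e0; split; first by exact: moll_measurable.
move=> r; apply: le_lt_trans (lf.2 (r + e)).
apply: int_moll_le => //; [exact: measurable_cube|exact: measurable_cube|].
move=> x y; rewrite /cube /= !subr0 => xr xy.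
by rewrite -[y](subKr x) (le_lt_trans (ler_normB _ _)) // ltrD.
Qed.

Lemma locint_gsum g : (forall i, locint (g i)) -> locint (gsum g).
Proof.
move=> lg; split.
  apply: (@measurable_sum _ _ _ _ _ (index_enum 'I_d) (fun i (x : T) => `|g i x|)) => i.
  by apply: measurableT_comp => //; exact: (lg i).1.
move=> r; apply: (@le_lt_trans _ _ (\sum_(i < d) \int[mu]_(y in cube 0 r) `|(g i y)%:E|)%E).
  rewrite -ge0_integral_sum.
  - apply: le_int => x _ //=; rewrite ger0_norm ?gsum_ge0 // sumEFin //.
  - exact: measurable_cube.
  - move=> i; apply: measurable_funTS; apply: measurableT_comp => //.
    by apply/measurable_EFinP; exact: (lg i).1.
  - by [].
by apply: lte_sum_pinfty => i _; exact: (lg i).2.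
Qed.

Lemma mass_gsum_moll g e c r r' : (forall i, locint (g i)) -> 0 < e -> r + e <= r' ->
  (\int[mu]_y (\1_(cube c r) y * gsum (fun i => moll (g i) e) y)%:E <= (mass (gsum g) c r')%:E)%E.
Proof.
move=> lg e0 hr; rewrite massE; last exact: locint_gsum.
have mabs F A : measurable (A : set T) -> measurable_fun setT (F : T -> R) ->
    measurable_fun (A : set T) (fun y : T => `|(F y)%:E|%E).
  move=> mA mF; apply: measurable_funTS; apply: measurableT_comp => //; exact/measurable_EFinP.
rewrite -!(int_indicE mu) .
apply: (@le_trans _ _ (\sum_(i < d) \int[mu]_(y in cube c r) `|(moll (g i) e y)%:E|)%E).
  rewrite -ge0_integral_sum.
  - apply: le_int => x _; first by rewrite lee_fin gsum_ge0.
    by rewrite sumEFin.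
  - exact: measurable_cube.
  - by move=> i; apply: mabs; [exact: measurable_cube|exact: moll_measurable].
  - by [].
apply: (@le_trans _ _ (\sum_(i < d) \int[mu]_(y in cube c r') `|(g i y)%:E|)%E).
  apply: lee_sum => i _; apply: int_moll_le => //; [exact: measurable_cube|exact: measurable_cube|].
  move=> x y; rewrite /cube /= => xr xy.
  rewrite (_ : y - c = (x - c) - (x - y)); last by rewrite opprB [RHS]addrC addrA subrK.
  by rewrite (le_lt_trans (ler_normB _ _)) // (lt_le_trans _ hr) // ltrD.
rewrite -ge0_integral_sum.
- apply: le_int => x _; first by rewrite sume_ge0.
  by rewrite sumEFin ger0_norm ?gsum_ge0.
- exact: measurable_cube.
- by move=> i; apply: mabs; [exact: measurable_cube|exact: (lg i).1].
- by [].
Qed.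

(** Integrate |u x| <= |u y| + |u x - u y| over x in the small and y in the large cube, then let x
    range over the large cube in the last term, where [poincare2] applies. *)
Lemma C1_poincare u G c (r K V : R) : C1 u G -> locint u -> 0 < r -> 1 <= K ->
  (\int[mu]_y (\1_(cube c (K * r)) y * gsum G y)%:E <= V%:E)%E ->
  mean u c r <= mean u c (K * r) + 2 * (K * r) * 2 ^+ d / (@mu1 R d' * r ^+ d) * V.
Proof.
move=> CG lu r0 K1 hV; have [cu _ _] := CG.
have K0 : 0 < K by rewrite (lt_le_trans ltr01).
set rK := K * r; have rK0 : 0 < rK by rewrite mulr_gt0.
pose m := @mu1 R d' * r ^+ d; pose mK := @mu1 R d' * rK ^+ d.
have mp : 0 < m by rewrite mulr_gt0 // exprn_gt0.
have mKp : 0 < mK by rewrite mulr_gt0 // exprn_gt0.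
have QQ : cube c r `<=` cube c rK.
  by apply: cube_sub; rewrite subrr normr0 add0r /rK ler_peMl // ltW.
have muu := measurable_continuous cu.
have mi s : measurable_fun setT (\1_(cube c s) : T -> R) by exact: measurable_indicT.
have mnu : measurable_fun setT (fun y : T => `|u y|) by exact: measurableT_comp.
set PP := (2 * (rK * 2 ^+ d) * mK).
have main : mass u c r * mK <= m * mass u c rK + PP * V.
  have hP := poincare2 c CG rK0; rewrite -/mK -/PP in hP.
  have PP0 : 0 <= PP.
    have e2 : 0 <= 2 ^+ d :> R by rewrite exprn_ge0.
    by rewrite /PP mulr_ge0 ?(ltW mKp) // mulr_ge0 // mulr_ge0 // ltW.
  have {hV}hP : (\int[mu]_x \int[mu]_y (\1_(cube c rK) x * (\1_(cube c rK) y * `|u x - u y|))%:E <= (PP * V)%:E)%E.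
    by apply: (le_trans hP); rewrite [leRHS]EFinM lee_wpmul2l ?lee_fin.
  rewrite -lee_fin EFinD; apply: le_trans (leeD2l _ hP).
  rewrite [X in (_ <= X + _)%E]EFinM -[X in (_ <= X * _ + _)%E](mu_cube c r0).
  have mf2 : measurable_fun setT (fun z : T * T => (\1_(cube c rK) z.1 * (\1_(cube c rK) z.2 * `|u z.1 - u z.2|))%:E).
    apply/measurable_EFinP; apply: measurable_funM.
      exact: (measurableT_comp (mi rK) measurable_fst).
    apply: measurable_funM; first exact: (measurableT_comp (mi rK) measurable_snd).
    apply: measurableT_comp => //; apply: measurable_funB.
      exact: (measurableT_comp muu measurable_fst).
    exact: (measurableT_comp muu measurable_snd).
  have f20 z : (0 <= (\1_(cube c rK) (z : T * T).1 * (\1_(cube c rK) z.2 * `|u z.1 - u z.2|))%:E)%E.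
    by rewrite lee_fin !mulr_ge0.
  have mJ : measurable_fun setT (fun x : T => (\int[mu]_(y in [set: T]) (\1_(cube c rK) x * (\1_(cube c rK) y * `|u x - u y|))%:E)%E).
    exact: (@measurable_fun_fubini_tonelli_F _ _ _ _ _ mu _ mf2 f20).
  have M0 : 0 <= mass u c rK by exact: mass_ge0.
  have -> : (mu (cube c r : set T) * (mass u c rK)%:E = \int[mu]_x ((mass u c rK)%:E * (\1_(cube c r) x)%:E))%E.
    rewrite ge0_integralZl_EFin //; last by apply/measurable_EFinP; exact: mi.
    by rewrite integral_indic ?setIT; [rewrite muleC|exact: measurableT|exact: measurable_cube].
  rewrite -ge0_integralD; first last.
  - exact: mJ.
  - by move=> x _; apply: integral_ge0 => y _; rewrite lee_fin !mulr_ge0.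
  - by apply/measurable_EFinP; apply: measurable_funM => //; exact: mi.
  - by move=> x _; rewrite -EFinM lee_fin mulr_ge0.
  - exact: measurableT.
  rewrite (mulrC (mass u c r)) (EFinM mK) (massE c r lu) -ge0_integralZl_EFin; first last.
  - exact: ltW.
  - by apply/measurable_EFinP; apply: measurable_funM => //; exact: mi.
  - by move=> x _; rewrite lee_fin mulr_ge0.
  - exact: measurableT.
  apply: le_int => x _; first by rewrite -EFinM lee_fin mulr_ge0 ?(ltW mKp) // mulr_ge0.
  rewrite indicE; have [/set_mem xQ|_] := boolP (x \in cube c r); last first.
    rewrite mul0r mule0 mule0 add0e; apply: integral_ge0 => y _; rewrite lee_fin !mulr_ge0 //.
  rewrite mul1r mule1 (indicE _ _ x) (mem_set (QQ _ xQ)) massE //.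
  rewrite -ge0_integralD; first last.
  - apply/measurable_EFinP; apply: measurable_funM => //; apply: measurable_funM; first exact: mi.
    by apply: measurableT_comp => //; exact: measurable_funB.
  - by move=> y _; rewrite lee_fin !mulr_ge0.
  - by apply/measurable_EFinP; apply: measurable_funM => //; exact: mi.
  - by move=> y _; rewrite lee_fin mulr_ge0.
  - exact: measurableT.
  rewrite -(mu_cube c rK0) muleC.
  have mc := measurable_cube c rK.
  rewrite -(@integral_cst _ T R mu _ mc `|u x|%:E) (int_indicE mu _ (fun=> `|u x|)).
  apply: le_int => y _; first by rewrite lee_fin mulr_ge0.
  rewrite -EFinD lee_fin mul1r -mulrDr ler_wpM2l //.
  by rewrite -[X in `|X| <= _](subrK (u y)) addrC; exact: ler_normD.
have arith (a b p q X : R) : 0 < a -> 0 < b -> (p / b + X / a * q) * (a * b) = a * p + X * b * q :> R.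
  by move=> a0 b0; field; rewrite !gt_eqF.
rewrite -(ler_pM2r (mulr_gt0 mp mKp)).
apply: (@le_trans _ _ (mass u c r * mK)).
  by rewrite /mean -/m mulrA divfK // gt_eqF.
apply: (le_trans main); rewrite /mean -/m -/mK (arith m mK) //.
by rewrite /PP (mulrA 2 rK).
Qed.

End approximation.

Section weak_gradient.
Context {R : realType} {d' : nat}.
Local Notation d := d'.+1.
Local Notation T := (vec R d').
Local Notation mu := (@mu R d').
Implicit Types (x y c : 'rV[R]_d) (f F : 'rV[R]_d -> R) (g G : 'I_d -> 'rV[R]_d -> R).
Hypothesis m0 : 0 < @mu1 R d'.

Definition weak_grad f g := forall (i : 'I_d) (phi : 'rV[R]_d -> R), test_fun phi ->
  integs (fun x => f x * partial i phi x) = (- integs (fun x => (g i x * phi x)%R))%E.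

Lemma W11_approx f g : L1 f -> (forall i, L1 (g i)) -> weak_grad f g ->
  forall eps, 0 < eps -> exists u G, [/\ C1 u G,
  (nrm1 (fun x => u x - f x)%R <= eps%:E)%E &
  (\int[mu]_y (gsum G y)%:E <= (fine (\int[mu]_y (gsum g y)%:E))%:E)%E].
Proof.
move=> Lf Lg wg eps eps0.
have [_ /(_ _ eps0)[e0 e00 he]] := L1_L1cvg m0 Lf.
have e2 : 0 < e0 / 2 by rewrite divr_gt0.
have ee : e0 / 2 < e0 by rewrite ltr_pdivrMr // ltr_pMr // ltr1n.
exists (moll f (e0 / 2)), (fun i => moll (g i) (e0 / 2)); split.
- exact: (C1_moll_weak (L1_locint Lf) (fun i => L1_locint (Lg i)) e2 wg).
- exact: he.
have mg i : measurable_fun setT (g i : T -> R) by exact: L1_measurable.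
rewrite (nrm1_gsum mg) nrm1_gsum; last first.
  by move=> i; apply: moll_measurable => //; exact: L1_locint.
rewrite fineK; last first.
  rewrite ge0_fin_numE; last by apply: sume_ge0 => i _; exact: integral_ge0.
  by apply: lte_sum_pinfty => i _; exact: L1_nrm1.
by apply: lee_sum => i _; apply: nrm1_moll_le => //; exact: L1_locint.
Qed.

Lemma moll_local f F e x : 0 < e -> (forall y, `|x - y| < e -> F y = f y) ->
  moll F e x = moll f e x.
Proof.
move=> e0 h; rewrite /moll /cvl; congr (_ / _); apply: eq_Rintegral => y _.
by have [/h ->//|xy] := ltP `|x - y| e; rewrite kern_out ?mulr0.
Qed.

(** The C1 inequality for mollifications of f, up to an arbitrary tau. The gradient is taken over a
    cube twice as large to make room for the mollification radius e <= K * r. *)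
Lemma W1p_poincare f g c (r K : R) : locint f -> (forall i, locint (g i)) -> weak_grad f g ->
  0 < r -> 1 <= K ->
  mean f c r <= mean f c (K * r) +
    2 * (K * r) * 2 ^+ d / (@mu1 R d' * r ^+ d) * mass (gsum g) c (2 * (K * r)).
Proof.
move=> lf lg wg r0 K1; set rK := K * r.
have rK0 : 0 < rK by rewrite mulr_gt0 // (lt_le_trans ltr01).
have rrK : r <= rK by rewrite /rK ler_peMl // ltW.
pose m := @mu1 R d' * r ^+ d; pose mK := @mu1 R d' * rK ^+ d.
have mp : 0 < m by rewrite mulr_gt0 // exprn_gt0.
have mKp : 0 < mK by rewrite mulr_gt0 // exprn_gt0.
(* f is only locally integrable. It is cut off outside a cube containing everything that the
   mollifications with e <= 1 see from [cube c rK], which makes convergence in L^1 available. *)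
pose N := `|c| + rK + 1.
pose F x := \1_(cube 0 N) x * f x.
have mF : measurable_fun setT (F : T -> R).
  by apply: measurable_funM; [exact: measurable_indicT|exact: lf.1].
have LF : L1 F.
  apply: L1P => //; apply: le_lt_trans (lf.2 N).
  rewrite (int_indicE mu _ (fun x => `|f x|)); apply: le_int => x _ //.
  by rewrite /F /abse lee_fin normrM (@ger0_norm _ (\1_(cube 0 N) x)).
apply/ler_addgt0Pr => tau tau0.
pose del := tau / (m^-1 + mK^-1).
have s0 : 0 < m^-1 + mK^-1 by rewrite addr_gt0 ?invr_gt0.
have del0 : 0 < del by rewrite divr_gt0.
have [_ /(_ _ del0)[e0 e00 he]] := L1_L1cvg m0 LF.
pose e := Num.min (e0 / 2) (Num.min 1 rK).
have ep : 0 < e by rewrite !lt_min divr_gt0 // ltr01.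
have ee0 : e < e0 by rewrite gt_min ltr_pdivrMr // ltr_pMr // ltr1n.
have e1 : e <= 1 by rewrite !ge_min lexx orbT.
have erK : e <= rK by rewrite !ge_min lexx !orbT.
pose u := moll f e.
have lu : locint u by exact: locint_moll.
have CG : C1 u (fun i => moll (g i) e) by exact: (C1_moll_weak lf lg ep wg).
have inN y z : cube c rK y -> `|y - z| < e -> cube 0 N z.
  rewrite /cube /= subr0 => hy hz.
  have : `|z| <= `|c| + `|y - c| + `|y - z|.
    rewrite [X in `|X| <= _](_ : z = c + (y - c) - (y - z)); last by apply/rowP => j; rewrite !mxE; ring.
    by rewrite (le_trans (ler_normB _ _)) // lerD2r ler_normD.
  by rewrite /N; lra.
have close s : s <= rK -> (\int[mu]_y (\1_(cube c s) y * `|u y - f y|)%:E <= del%:E)%E.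
  move=> srK; apply: le_trans (he _ ep ee0); apply: le_int => y _; first by rewrite lee_fin mulr_ge0.
  rewrite /abse lee_fin indicE; case: (boolP (y \in _)) => [/set_mem ys|_]; last by rewrite mul0r.
  have yQ : cube c rK y by apply: cube_sub ys; rewrite subrr normr0 add0r.
  rewrite mul1r (@moll_local f F e y ep); last first.
    by move=> z hz; rewrite /F indicE mem_set ?mul1r //; exact: inN hz.
  rewrite /F indicE mem_set ?mul1r //; apply: (inN _ _ yQ).
  by rewrite subrr normr0.
have m1 s : s <= rK -> mass f c s <= mass u c s + del.
  move=> srK; rewrite -lee_fin EFinD !massE //.
  apply: (le_trans (@int_indic_triangle _ _ f u (fun y => u y - f y) c s lu.1 _ _)).
  - by apply: measurable_funB; [exact: lu.1|exact: lf.1].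
  - by move=> y; rewrite -[f y](subKr (u y)) (le_trans (ler_normB _ _)) // subKr.
  by rewrite leeD2l // close.
have m2 s : s <= rK -> mass u c s <= mass f c s + del.
  move=> srK; rewrite -lee_fin EFinD !massE //.
  apply: (le_trans (@int_indic_triangle _ _ u f (fun y => u y - f y) c s lf.1 _ _)).
  - by apply: measurable_funB; [exact: lu.1|exact: lf.1].
  - by move=> y; rewrite -[X in `|X| <= _](subrK (f y)) addrC; exact: ler_normD.
  by rewrite leeD2l // close.
have hV : (\int[mu]_y (\1_(cube c (K * r)) y * gsum (fun i => moll (g i) e) y)%:E <=
    (mass (gsum g) c (2 * rK))%:E)%E.
  by apply: mass_gsum_moll => //; rewrite -/rK; lra.
have hP := C1_poincare m0 CG lu r0 K1 hV; rewrite -/rK in hP.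
have h1 : mean f c r <= mean u c r + del / m.
  by rewrite /mean -/m -mulrDl ler_pM2r ?invr_gt0 // m1.
have h2 : mean u c rK <= mean f c rK + del / mK.
  by rewrite /mean -/mK -mulrDl ler_pM2r ?invr_gt0 // m2.
have h3 : del / m + del / mK = tau by rewrite -mulrDr /del divfK // gt_eqF.
lra.
Qed.

End weak_gradient.

(** * The maximal functions *)

Section optimal_balls.
Context {R : realType} {d' : nat}.
Local Notation d := d'.+1.
Local Notation T := (vec R d').
Local Notation mu := (@mu R d').
Implicit Types (x y c : 'rV[R]_d) (f : 'rV[R]_d -> R) (v : 'rV[R]_d * R).

Lemma norm_le_enorm x : `|x| <= enorm x.
Proof.
apply/norm_leP => [|i]; first exact: sqrtr_ge0.
rewrite -sqrtr_sqr; apply: ler_wsqrtr.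
by rewrite (bigD1 i) //= lerDl sumr_ge0 // => j _; exact: sqr_ge0.
Qed.

Lemma eball_cube c r : eball c r `<=` cube c r.
Proof. by move=> y; apply: le_lt_trans; exact: norm_le_enorm. Qed.

Lemma cube_eball c r : cube c (r / d%:R) `<=` eball c r.
Proof.
move=> y; rewrite /cube /eball /= ltr_pdivlMr // mulrC; apply: le_lt_trans.
exact: enorm_le.
Qed.

Lemma closure_eball c r x : 0 < r -> closure (eball c r) x -> cube c (2 * r) x.
Proof.
move=> r0 /(_ (ball x r) (nbhsx_ballx _ _ r0))[y [yc yx]].
have yc' := eball_cube yc; rewrite ball_cube in yx; move: yc' yx; rewrite /cube /= => h1 h2.
rewrite (_ : x - c = (y - c) - (y - x)); last by rewrite opprB [RHS]addrC addrA subrK.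
by rewrite (le_lt_trans (ler_normB _ _)) // mulr2n mulrDl mul1r ltrD.
Qed.

Hypothesis m0 : 0 < @mu1 R d'.

Let cubeint f c r := integ (fun y => (if `[< cube c r y >] then `|f y| else 0)%:E).

Let cubeintE f c r : locint f -> cubeint f c r = (mass f c r)%:E.
Proof.
move=> lf; have [mf _] := lf; rewrite massE // /cubeint.
rewrite (_ : (fun y => _) = (fun y : T => (\1_(cube c r) y * `|f y|)%:E)); last first.
  apply/funext => y; rewrite indicE; case: asboolP => h.
    by rewrite mem_set // mul1r.
  by rewrite memNset // mul0r.
rewrite layer_cake //.
by apply/measurable_EFinP; apply: measurable_funM; [exact: measurable_indicT|exact: measurableT_comp].
Qed.

Let eint f c r := integ (fun y => (if `[< eball c r y >] then `|f y| else 0)%:E).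

Let eint_le f c r : locint f -> (eint f c r <= (mass f c r)%:E)%E.
Proof.
move=> lf; rewrite -cubeintE //; apply: le_integ => y; rewrite lee_fin.
case: asboolP => h; case: asboolP => h' //.
by case: h'; exact: eball_cube.
Qed.

Let eint_ge f c r : locint f -> ((mass f c (r / d%:R))%:E <= eint f c r)%E.
Proof.
move=> lf; rewrite -cubeintE //; apply: le_integ => y; rewrite lee_fin.
case: asboolP => h; case: asboolP => h' //.
by case: h'; exact: cube_eball.
Qed.

Let vol c r := fine (lstar (eball c r)).

Let vol_bounds c r : 0 < r -> @mu1 R d' * (r / d%:R) ^+ d <= vol c r <= @mu1 R d' * r ^+ d.
Proof.
move=> r0; have rd0 : 0 < r / d%:R by rewrite divr_gt0.
have h1 := le_lstar (@eball_cube c r); have h2 := le_lstar (@cube_eball c r).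
rewrite -(muE (cube c r)) mu_cube // in h1.
rewrite -(muE (cube c (r / d%:R))) mu_cube // in h2.
have fv : lstar (eball c r) \is a fin_num.
  by rewrite ge0_fin_numE ?lstar_ge0 // (le_lt_trans h1) // ltry.
by rewrite -!lee_fin /vol fineK // h1 h2.
Qed.

(** The ratio of the volumes of the cubes of half sides r and r / d, between which the Euclidean
    ball of radius r lies. *)
Definition dd : R := d%:R ^+ d.

Lemma dd_ge1 : 1 <= dd.
Proof. by rewrite exprn_ege1 // ler1n. Qed.

Let dd0 : 0 < dd.
Proof. by rewrite (lt_le_trans ltr01) // dd_ge1. Qed.

Lemma avg_le f c r : locint f -> 0 < r -> (avg f c r <= (dd * mean f c r)%:E)%E.
Proof.
move=> lf r0; have rd0 : 0 < r ^+ d by rewrite exprn_gt0.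
have /andP[v1 v2] := vol_bounds c r0.
have vp : 0 < @mu1 R d' * (r / d%:R) ^+ d by rewrite mulr_gt0 // exprn_gt0 // divr_gt0.
have v0 : 0 < vol c r by exact: lt_le_trans v1.
rewrite /avg -/(vol c r) -/(eint f c r).
apply: (@le_trans _ _ ((vol c r)^-1%:E * (mass f c r)%:E)%E).
  by apply: lee_wpmul2l; rewrite ?lee_fin ?invr_ge0 ?(ltW v0) // eint_le.
have h : (vol c r)^-1 <= dd / (@mu1 R d' * r ^+ d).
  have v1' : @mu1 R d' * r ^+ d <= dd * vol c r.
    by move: v1; rewrite expr_div_n mulrA (ler_pdivrMr _ _ dd0) [leRHS]mulrC.
  by rewrite ler_pdivlMr ?mulr_gt0 // mulrC ler_pdivrMr.
have -> : dd * mean f c r = dd / (@mu1 R d' * r ^+ d) * mass f c r by rewrite /mean mulrA mulrAC.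
by rewrite -EFinM lee_fin ler_wpM2r ?mass_ge0.
Qed.

Lemma avg_ge f c r : locint f -> 0 < r -> ((dd^-1 * mean f c (r / d%:R))%:E <= avg f c r)%E.
Proof.
move=> lf r0; have rd0 : 0 < r ^+ d by rewrite exprn_gt0.
have /andP[v1 v2] := vol_bounds c r0.
have vp : 0 < @mu1 R d' * (r / d%:R) ^+ d by rewrite mulr_gt0 // exprn_gt0 // divr_gt0.
have v0 : 0 < vol c r by exact: lt_le_trans v1.
rewrite /avg -/(vol c r) -/(eint f c r).
apply: (@le_trans _ _ ((vol c r)^-1%:E * (mass f c (r / d%:R))%:E)%E); last first.
  by apply: lee_wpmul2l; rewrite ?lee_fin ?invr_ge0 ?(ltW v0) // eint_ge.
have -> : dd^-1 * mean f c (r / d%:R) = (@mu1 R d' * r ^+ d)^-1 * mass f c (r / d%:R).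
  rewrite /mean expr_div_n -/dd; have := dd0; move: (r ^+ d) rd0 dd => a a0 b b0.
  by field; rewrite !gt_eqF.
rewrite -EFinM lee_fin ler_wpM2r ?mass_ge0 // lef_pV2 ?posrE //.
by rewrite mulr_gt0.
Qed.

(* What is retained of the balls in [Bc] and [Bu]; cubes and Euclidean balls are interchanged at
   the cost of [dd]. *)
Definition optimal (al : R) f v := 0 < v.2 /\ forall r, v.2 <= r ->
  mean f v.1 r <= dd * dd * (v.2 / r) `^ al * mean f v.1 v.2.

(** The cube of half side s lies in the ball of radius d * s, so the hypothesis is used at d * s.
    Each of the two passages between ball and cube costs a factor [dd]. *)
Lemma optimal_of_le (al : R) f c r : 0 <= al -> locint f -> 0 < r ->
  (forall s, r <= s -> ((s `^ al)%:E * avg f c s <= (r `^ al)%:E * avg f c r)%E) ->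
  optimal al f (c, r).
Proof.
move=> al0 lf r0 h; split => // s /= rs; have s0 : 0 < s by exact: lt_le_trans rs.
have sS : s <= d%:R * s by rewrite ler_peMl ?ler1n // ltW.
have S0 : 0 < d%:R * s by rewrite mulr_gt0.
have := h _ (le_trans rs sS).
have := avg_ge c lf S0; rewrite mulrAC divff // mul1r.
have := avg_le c lf r0.
have pS : 0 < (d%:R * s) `^ al by rewrite powR_gt0.
have pr : 0 <= r `^ al by exact: powR_ge0.
move=> h1 h2 h3.
have h4 : (d%:R * s) `^ al * (dd^-1 * mean f c s) <= r `^ al * (dd * mean f c r).
  rewrite -lee_fin EFinM [leRHS]EFinM.
  apply: le_trans (le_trans _ (le_trans h3 _)); first exact: lexx.
    by apply: lee_wpmul2l => //; rewrite lee_fin ltW.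
  by apply: lee_wpmul2l; rewrite ?lee_fin.
have ps : 0 < s `^ al by rewrite powR_gt0.
have sle : s `^ al <= (d%:R * s) `^ al by apply: ge0_ler_powR; rewrite ?nnegrE ?(ltW s0) ?(ltW S0).
have mg : 0 <= dd^-1 * mean f c s by rewrite mulr_ge0 ?invr_ge0 ?(ltW dd0) ?mean_ge0 // ltW.
have h5 := le_trans (ler_wpM2r mg sle) h4.
have -> : (r / s) `^ al = r `^ al / s `^ al.
  by apply: (@mulIf _ (s `^ al)); rewrite ?gt_eqF // divfK ?gt_eqF // -powRM ?divfK ?gt_eqF ?divr_ge0 // ltW.
rewrite -(@ler_pM2l _ (s `^ al / dd)) ?divr_gt0 //.
rewrite -[leLHS]mulrA; apply: (le_trans h5); rewrite le_eqVlt; apply/orP; left; apply/eqP.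
by field; rewrite !gt_eqF.
Qed.

Lemma enorm_scale_evec (t : R) (i : 'I_d) : 0 <= t -> enorm (t *: evec R i) = t.
Proof.
move=> t0; rewrite /enorm (bigD1 i) //= big1 ?addr0; last first.
  by move=> j ji; rewrite /evec !mxE eqxx (negbTE ji) mulr0 expr0n.
by rewrite /evec !mxE !eqxx mulr1 sqrtr_sqr ger0_norm.
Qed.

(** Only concentric dilates are compared, which treats the centered and uncentered functions alike:
    the first by the supremum at the common centre, the second by the maximality of the ball under
    inclusion. *)
Lemma optimal_ball_le centered (al : R) f y v :
  (if centered then Bc al f else Bu al f) y v -> 0 < v.2 /\
  forall s, v.2 <= s -> ((s `^ al)%:E * avg f v.1 s <= (v.2 `^ al)%:E * avg f v.1 v.2)%E.
Proof.
case: centered => -[].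
  move=> <- [r0 [E _]]; split => // s rs; rewrite E.
  by apply: ereal_sup_ubound; exists s => //; exact: lt_le_trans rs.
move=> r0 [_ [E H]]; split => // s; rewrite le_eqVlt => /orP[/eqP <-//|rs].
rewrite E; apply: ltW; apply: (H (v.1, s)); first exact: lt_trans rs.
split; first by move=> x /lt_trans; apply.
(* A point of the bounding sphere witnesses that the larger ball is strictly larger. *)
move=> /(_ (v.1 + v.2 *: evec R ord0)); rewrite /eball /= addrAC subrr add0r.
rewrite enorm_scale_evec ?(ltW r0) // => /(_ rs); rewrite ltxx; done.
Qed.

Definition Mab_values centered (al be : R) f x : set \bar R :=
  [set ((cr.2 `^ (al + be))%:E * avg f cr.1 cr.2)%E
    | cr in [set cr | (exists y, (if centered then Bc al f else Bu al f) y cr) /\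
        closure (eball cr.1 cr.2) x]].

Lemma MabE centered (al be : R) f x :
  Mab centered al be f x = ereal_sup ([set 0%E] `|` Mab_values centered al be f x).
Proof. by []. Qed.

(** Balls of mean 0 contribute only the value 0 and are split off, since a level exists only for a
    positive mean. *)
Lemma Mab_valuesP centered (al be : R) f x t : 0 <= al -> locint f ->
  Mab_values centered al be f x t -> t = 0%E \/
  exists v, [/\ optimal al f v, 0 < mean f v.1 v.2, cube v.1 (2 * v.2) x &
    (0 <= t <= (dd * (v.2 `^ (al + be) * mean f v.1 v.2))%:E)%E].
Proof.
move=> al0 lf [[c r] [[y /optimal_ball_le [/= r0 hle]] xcl] <-].
have mge : 0 <= mean f c r by rewrite mean_ge0 // ltW.
have a0 : (0 <= avg f c r)%E.
  apply: le_trans (avg_ge c lf r0).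
  by rewrite lee_fin mulr_ge0 ?invr_ge0 ?(ltW dd0) // mean_ge0 // divr_ge0 // ltW.
have p0 : (0 <= (r `^ (al + be))%:E)%E by rewrite lee_fin powR_ge0.
have ub : ((r `^ (al + be))%:E * avg f c r <= (dd * (r `^ (al + be) * mean f c r))%:E)%E.
  by rewrite mulrCA EFinM lee_wpmul2l // avg_le.
move: mge; rewrite le_eqVlt => /orP[/eqP m00|mp].
  left; apply/eqP; rewrite eq_le; rewrite -m00 !mulr0 in ub; rewrite ub /=.
  exact: mule_ge0.
right; exists (c, r); split => //.
- exact: (optimal_of_le al0 lf r0 hle).
- exact: closure_eball.
- by rewrite mule_ge0.
Qed.

End optimal_balls.

(** * Levels and real powers *)

Section powers.
Context {R : realType}.
Implicit Types (A x a b k e : R).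

Lemma exists_level A x : 1 < A -> 0 < x ->
  exists l : int, A `^ l%:~R <= x < A `^ l%:~R * A.
Proof.
move=> A1 x0; have A0 : 0 < A by exact: lt_trans A1.
have lA : 0 < ln A by rewrite ln_gt0.
exists (Num.floor (ln x / ln A)).
have xE : x = A `^ (ln x / ln A).
  by rewrite /powR gt_eqF // divfK ?gt_eqF // lnK.
have /andP[h1 h2] := floor_itv (ln x / ln A).
apply/andP; split.
  by rewrite [leRHS]xE ler_powR // ltW.
rewrite -[X in _ * X](powRr1 (ltW A0)) -powRD; last by rewrite (gt_eqF A0) implybT.
rewrite [ltLHS]xE /powR gt_eqF // ltr_expR ltr_pM2r //.
by move: h2; rewrite intrD.
Qed.

(** Levels are integers of either sign, while the sums over a finite family are run over natural
    exponents; N dominates all |lev v|. *)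
Lemma shift_levels (I : eqType) (s : seq I) (lev : I -> int) :
  exists (N : nat) (kap : I -> nat), {in s, forall v, (lev v)%:~R = (kap v)%:R - N%:R :> R}.
Proof.
pose N := (\max_(v <- s) `|lev v|)%N; exists N, (fun v => absz (lev v + N%:Z)) => v vs.
have h : (`|lev v| <= N)%N by apply: leq_bigmax_seq.
have h0 : 0 <= lev v + N%:Z.
  rewrite -lerBlDr sub0r; apply: (le_trans _ (lerNnormlW (lexx _))).
  by rewrite lerN2 -abszE lez_nat.
by rewrite natr_absz ger0_norm // intrD addrK.
Qed.

(** The exponent may have either sign, so the comparison of the bases is needed in both
    directions. *)
Lemma powR_comparable a b k e : 0 < a -> 0 < b -> 1 <= k -> a <= k * b -> b <= k * a ->
  a `^ e <= k `^ `|e| * b `^ e.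
Proof.
move=> a0 b0 k1 ab ba; have k0 : 0 < k by exact: lt_le_trans k1.
have r0 : 0 < a / b by rewrite divr_gt0.
have -> : a `^ e = (a / b) `^ e * b `^ e by rewrite -powRM ?divfK ?gt_eqF // ltW.
apply: ler_wpM2r; first exact: powR_ge0.
have [e0|e0] := leP 0 e.
  rewrite ger0_norm //; apply: ge0_ler_powR; rewrite ?nnegrE ?(ltW r0) ?(ltW k0) //.
  by rewrite ler_pdivrMr.
rewrite ltr0_norm // -[leLHS]/((a / b) `^ e) -[e in leLHS]opprK -[in leLHS]mulN1r powRrM powR_inv1 ?(ltW r0) //.
apply: ge0_ler_powR; rewrite ?nnegrE ?invr_ge0 ?(ltW r0) ?(ltW k0) ?oppr_ge0 ?(ltW e0) //.
by rewrite invf_div ler_pdivrMr.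
Qed.

End powers.

Section final_norm.
Context {R : realType} {d' : nat}.
Local Notation d := d'.+1.

Lemma Lpnorm_of_integ (u : 'rV[R]_d -> \bar R) (q s B Y : R) : 0 < q -> 0 <= B -> 0 <= Y ->
  (integ (fun x => `|u x| `^ q) <= (B * Y `^ s)%:E)%E ->
  (Lpnorm q u <= (B `^ q^-1 * Y `^ (s / q))%:E)%E.
Proof.
move=> q0 B0 Y0 h; rewrite /Lpnorm.
apply: (le_trans (le_poweR _ _ h)); first by rewrite invr_ge0 ltW.
  by apply: integral_ge0 => t _; exact: lstar_ge0.
by rewrite poweR_EFin lee_fin powRM ?powR_ge0 // -powRrM.
Qed.

End final_norm.

(** * The case p = 1 *)

Section p_one.
Context {R : realType} {d' : nat}.
Local Notation d := d'.+1.
Local Notation T := (vec R d').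
Local Notation mu := (@mu R d').
Local Notation P := ('rV[R]_d * R)%type.
Hypothesis m0 : 0 < @mu1 R d'.
Variables (al be : R).
Hypotheses (al0 : 0 < al) (ald : al <= d%:R).
Local Notation gam := (1 + al + be).
Let A : R := 2 ^+ d.
Let C1c : R := @dd R d' * @dd R d'.

(** The common ground of W^{1,1} and BV: all that the case p = 1 asks of f besides integrability. *)
Definition C1_approximable (f : 'rV[R]_d -> R) (V : R) := forall eps, 0 < eps -> exists u G,
  [/\ C1 u G, (nrm1 (fun x => u x - f x)%R <= eps%:E)%E & (\int[mu]_y (gsum G y)%:E <= V%:E)%E].

Let A1 : 1 < A.
Proof. by rewrite exprn_egt1 // ltr1n. Qed.

Let A0 : 0 < A.
Proof. exact: lt_trans A1. Qed.

Let C11 : 1 <= C1c.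
Proof. by rewrite mulr_ege1 // dd_ge1. Qed.

Let C10 : 0 < C1c.
Proof. exact: lt_le_trans C11. Qed.

Definition kcomp : R := (C1c * 3 ^+ d * A) `^ al^-1.

Let kK1 : 1 <= C1c * 3 ^+ d * A.
Proof. by rewrite mulr_ege1 ?(ltW A1) // mulr_ege1 // exprn_ege1 // ler1n. Qed.

Let k1 : 1 <= kcomp.
Proof. by rewrite -(powRr0 (C1c * 3 ^+ d * A)) ler_powR // invr_ge0 ltW. Qed.

Let k0 : 0 < kcomp.
Proof. exact: lt_le_trans k1. Qed.

(** As in [radius_growth], a dilate of v containing the cube of w would have too large a mean if w.2
    were much larger than v.2. This is needed because al + be can be negative: the Vitali selection
    only bounds the radius of a ball by that of the selected one, not conversely. *)
Lemma same_level_comparable f (v w : P) (a : R) x : locint f -> 0 < a -> optimal al f v -> 0 < w.2 ->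
  a <= mean f w.1 w.2 -> mean f v.1 v.2 < a * A ->
  cube v.1 v.2 x -> cube w.1 w.2 x -> w.2 <= kcomp * v.2.
Proof.
move=> lf a0 [v0 ho] w0 hw hv xv xw.
have [vw|vw] := leP w.2 v.2; first by rewrite (le_trans vw) // ler_peMl // ltW.
pose r := v.2 + 2 * w.2; have r0 : 0 < r by rewrite addr_gt0 // mulr_gt0.
have vr : v.2 <= r by rewrite /r; lra.
have hr3 : r <= 3 * w.2 by rewrite /r; lra.
have hm : mass f w.1 w.2 <= mass f v.1 r.
  apply: mass_sub => //; apply: cube_sub; rewrite /r.
  have : `|w.1 - v.1| < w.2 + v.2.
    rewrite (_ : w.1 - v.1 = (x - v.1) - (x - w.1)); last first.
      by rewrite opprB [RHS]addrC addrA subrK.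
    by rewrite [w.2 + _]addrC (le_lt_trans (ler_normB _ _)) // ltrD.
  lra.
rewrite !massE_mean // mulrCA [leRHS]mulrCA ler_pM2l // in hm.
have h1 := ho _ vr.
have rd0 : 0 < r ^+ d by rewrite exprn_gt0.
have wd0 : 0 < w.2 ^+ d by rewrite exprn_gt0.
have q0 : 0 < v.2 / w.2 by rewrite divr_gt0.
have p1 : (v.2 / r) `^ al <= (v.2 / w.2) `^ al.
  apply: ge0_ler_powR; rewrite ?nnegrE ?(ltW al0) ?divr_ge0 ?(ltW v0) ?(ltW r0) ?(ltW w0) //.
  by rewrite ler_pM2l // lef_pV2 ?posrE //; rewrite /r; lra.
have p2 : r ^+ d <= 3 ^+ d * w.2 ^+ d.
  by rewrite -exprMn; apply: lerXn2r; rewrite ?nnegrE ?(ltW r0) // mulr_ge0 // ltW.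
have h2 : mean f v.1 r <= C1c * (v.2 / w.2) `^ al * (a * A).
  apply: (le_trans h1); apply: ler_pM.
  - by rewrite mulr_ge0 ?powR_ge0 // ltW.
  - by rewrite mean_ge0 // ltW.
  - by rewrite ler_pM2l.
  - exact: ltW.
have h3 : a * w.2 ^+ d <= C1c * (v.2 / w.2) `^ al * (a * A) * (3 ^+ d * w.2 ^+ d).
  apply: le_trans (le_trans (ler_wpM2r (ltW wd0) hw) (le_trans hm _)); first exact: lexx.
  apply: ler_pM => //; first by rewrite mean_ge0 // ltW.
  exact: ltW.
have h4 : 1 <= C1c * 3 ^+ d * A * (v.2 / w.2) `^ al.
  rewrite -(@ler_pM2l _ (a * w.2 ^+ d)) ?mulr_gt0 // mulr1 (le_trans h3) //.
  by rewrite le_eqVlt; apply/orP; left; apply/eqP; ring.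
have h5 : 1 <= kcomp * (v.2 / w.2).
  rewrite leNgt; apply/negP => hlt; move: h4; rewrite leNgt => /negP; apply.
  have kE : C1c * 3 ^+ d * A = kcomp `^ al.
    by rewrite /kcomp -powRrM mulVf ?gt_eqF // powRr1 // (le_trans ler01).
  rewrite kE -powRM ?(ltW k0) ?(ltW q0) // -[ltRHS](_ : 1 `^ al = 1); last by rewrite powR1.
  by apply: gt0_ltr_powR; rewrite ?nnegrE // mulr_ge0 // ltW.
by move: h5; rewrite mulrA ler_pdivlMr // mul1r.
Qed.

Let lev_exists f (v : P) : exists l : int, 0 < mean f v.1 v.2 ->
  A `^ l%:~R <= mean f v.1 v.2 < A `^ l%:~R * A.
Proof.
have [h|h] := ltP 0 (mean f v.1 v.2); last by exists 0.
by have [l hl] := exists_level A1 h; exists l.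
Qed.

Lemma finite_level_sum f V (lev : P -> int) (l : seq P) : L1 f -> C1_approximable f V -> uniq l ->
  {in l, forall v, optimal al f v} ->
  {in l, forall v, A `^ (lev v)%:~R <= mean f v.1 v.2 < A `^ (lev v)%:~R * A} ->
  {in l &, forall v w, lev v = lev w -> (cube v.1 v.2 `&` cube w.1 w.2) !=set0 -> v = w} ->
  \sum_(v <- l) A `^ (lev v)%:~R * v.2 ^+ d' <= @bv_const R d' al C1c * V.
Proof.
move=> Lf HV ul ho hlev hdis.
have [N [kap hk]] := @shift_levels R _ l lev.
have levE v : v \in l -> A `^ (lev v)%:~R = A `^ (- N%:R) * A ^+ kap v.
  move=> vl; rewrite hk // addrC powRD; last by rewrite (gt_eqF A0) implybT.
  by rewrite powR_mulrn // ltW.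
have -> : \sum_(v <- l) A `^ (lev v)%:~R * v.2 ^+ d' =
    \sum_(v <- l) A `^ (- N%:R) * A ^+ kap v * v.2 ^+ d'.
  by rewrite big_seq [RHS]big_seq; apply: eq_bigr => v vl; rewrite levE.
apply: (@bv_core R d' m0 f al C1c (A `^ (- N%:R)) l kap Lf al0 ald C11 _ ul _ _ _ _ V HV).
- by rewrite powR_gt0.
- by move=> v /ho[].
- by move=> v vl; have := hlev _ vl; rewrite levE // (exprSr (2 ^+ d)) mulrA.
- by move=> v /ho[_ hov]; exact: hov.
- move=> v w vl wl kvw; apply: hdis => //.
  apply: (@intr_inj R); rewrite hk // hk // kvw //.
Qed.

(** The weights are w = A^lev * r^(d-1). As (d - gam) * q = d, the power q of r^(al+be) * A^lev
    equals w^q * r^(-d), so [assembly] applies with s = q >= 1. *)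
Lemma mab_p1 centered : 0 <= gam -> gam < d%:R ->
  exists2 C, 0 <= C & forall f V, L1 f -> 0 <= V -> C1_approximable f V ->
    (Lpnorm (1 - gam / d%:R)^-1 (Mab centered al be f) <= (C * V)%:E)%E.
Proof.
move=> g0 gd; set q := (1 - gam / d%:R)^-1.
have d0 : 0 < d%:R :> R by [].
have qi0 : 0 < 1 - gam / d%:R by rewrite subr_gt0 ltr_pdivrMr // mul1r.
have q0 : 0 < q by rewrite invr_gt0.
have q1 : 1 <= q by rewrite invf_ge1 // gerBl divr_ge0.
have qe : (d%:R - gam) * q = d%:R.
  have -> : q = d%:R / (d%:R - gam) by rewrite /q -[RHS]invf_div mulrBl divff ?gt_eqF.
  by rewrite mulrCA divff ?mulr1 // gt_eqF // subr_gt0.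
pose kk := (2 * kcomp) `^ `|al + be|; pose c0 := @dd R d' * kk * A.
have dd0 : 0 < @dd R d' by rewrite (lt_le_trans ltr01) // dd_ge1.
have c00 : 0 <= c0 by rewrite mulr_ge0 ?(ltW A0) // mulr_ge0 ?powR_ge0 // ltW.
pose B := c0 `^ q; have B0 : 0 <= B by exact: powR_ge0.
pose C := (B * 7 ^+ d * @mu1 R d') `^ q^-1 * @bv_const R d' al C1c.
have bc0 : 0 <= @bv_const R d' al C1c by exact: bv_const_ge0.
have C0 : 0 <= C by rewrite mulr_ge0 ?powR_ge0.
exists C => // f V Lf V0 HV; have lf := L1_locint Lf.
have [lev hlev] := choice (lev_exists f).
pose D : set P := [set v | optimal al f v /\ 0 < mean f v.1 v.2].
have D0 v : D v -> 0 < v.2 by move=> [[]].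
(* A mean of at least [a] over a cube of half side r > 1 gives mu1 * a * r <= mu1 * a * r^d <=
   |f|_1. *)
have Dbd l : exists M, forall v, D v -> lev v = l -> v.2 <= M.
  pose a := A `^ l%:~R; have a0 : 0 < a by rewrite powR_gt0.
  exists (Num.max 1 (fine (nrm1 f) / (@mu1 R d' * a))) => v [[v0 _] mv] lv.
  have /andP[hm _] := hlev _ mv; rewrite lv -/a in hm.
  rewrite le_max; have [v1|v1] := leP v.2 1; first by [].
  rewrite ler_pdivlMr ?mulr_gt0 //.
  apply: (@le_trans _ _ (mass f v.1 v.2)).
    rewrite (massE_mean _ _ m0 v0).
    have : v.2 <= v.2 ^+ d by rewrite exprS ler_peMr ?(ltW v0) // exprn_ege1 // ltW.
    move=> vv; rewrite mulrC -mulrA mulrCA; apply: ler_pM => //.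
    - exact: ltW.
    - by rewrite mulr_ge0 ?mu1_ge0 // ltW.
    - by rewrite ler_pM2l.
  rewrite -lee_fin massE // fineK; last by rewrite ge0_fin_numE; [exact: L1_nrm1|exact: integral_ge0].
  apply: le_int => y _; first by rewrite lee_fin mulr_ge0.
  by rewrite /abse lee_fin ler_piMl // indicE; case: (_ \in _).
have Dne v : D v -> cube v.1 v.2 !=set0.
  by move=> Dv; exists v.1; rewrite /cube /= subrr normr0; exact: D0.
have [W [WD Wdis Wcov]] := @vitali_levels R P 'rV[R]_d (fun v => cube v.1 v.2) snd D lev D0 Dbd Dne.
pose w (v : P) := A `^ (lev v)%:~R * v.2 ^+ d'.
have w0 v : W v -> 0 < v.2 /\ 0 < w v.
  by move=> /WD /D0 v0; rewrite /w mulr_gt0 ?powR_gt0 ?exprn_gt0.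
pose Y := @bv_const R d' al C1c * V; have Y0 : 0 <= Y by rewrite mulr_ge0.
have sums (l : seq P) : uniq l -> {in l, forall v, W v} -> \sum_(v <- l) w v <= Y.
  move=> ul lW; apply: (finite_level_sum Lf HV ul).
  - by move=> v /lW /WD [].
  - by move=> v /lW /WD [_ /hlev].
  - by move=> v v' /lW Wv /lW Wv' lvv mt; exact: Wdis.
have vals x t : Mab_values centered al be f x t -> t = 0%E \/
    exists v, [/\ W v, cube v.1 (7 * v.2) x & (0 <= t)%E /\ (t `^ q <= (B * w v `^ q * v.2 ^- d)%:E)%E].
  move=> /(Mab_valuesP m0 (ltW al0) lf)[->|[v [ov mv xv /andP[t0 tv]]]]; [by left|right].
  have Dv : D v by [].
  have [j [Wj ljv [z [zv zj]] vj]] := Wcov _ Dv.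
  have j0 := D0 _ (WD _ Wj); have v0 := D0 _ Dv.
  (* The point x is within 2 * v.2 of v.1, the cubes of v and j meet, and v.2 <= 2 * j.2: in all 4 +
     2 + 1 = 7 times j.2. *)
  exists j; split => //.
    move: xv zv zj; rewrite /cube /= => h1 h2 h3.
    rewrite (_ : x - j.1 = (x - v.1) - (z - v.1) + (z - j.1)); last first.
      by apply/rowP => i; rewrite !mxE; ring.
    apply: (le_lt_trans (ler_normD _ _)).
    have := ler_normB (x - v.1) (z - v.1); lra.
  split => //.
  have /andP[_ mvA] := hlev _ mv.
  have /andP[mjA _] := hlev _ (WD _ Wj).2.
  pose a := A `^ (lev v)%:~R; have a0 : 0 < a by rewrite powR_gt0.
  have jv : j.2 <= kcomp * v.2.
    apply: (same_level_comparable lf a0 ov j0 _ mvA zv zj).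
    by move: mjA; rewrite ljv.
  have cmp : v.2 `^ (al + be) <= kk * j.2 `^ (al + be).
    apply: powR_comparable => //.
    - by rewrite mulr_ege1 // ler1n.
    - by rewrite -mulrA (le_trans vj) // ler_pM2l // ler_peMl // ltW.
    - by rewrite (le_trans jv) // -mulrA mulr2n mulrDl mul1r lerDl mulr_ge0 ?ltW.
  have tb : (t <= (c0 * (j.2 `^ (al + be) * a))%:E)%E.
    apply: (le_trans tv); rewrite lee_fin /c0 -!mulrA ler_pM2l //.
    rewrite [leRHS](_ : _ = (kk * j.2 `^ (al + be)) * (a * A)); last by ring.
    apply: ler_pM => //; [exact: powR_ge0|exact: ltW|exact: ltW].
  have jp0 : 0 <= j.2 `^ (al + be) by exact: powR_ge0.
  apply: (le_trans (le_poweR (ltW q0) t0 tb)); rewrite poweR_EFin lee_fin.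
  rewrite (powRM _ c00) ?mulr_ge0 ?(ltW a0) // -/B -mulrA ler_wpM2l //.
  rewrite /w ljv -/a (powRM _ jp0 (ltW a0)) (powRM _ (ltW a0)) ?exprn_ge0 ?(ltW j0) //.
  rewrite [leLHS]mulrC -mulrA (ler_pM2l (powR_gt0 q a0)).
  rewrite -powRrM -powR_mulrn ?(ltW j0) // -powRrM -powR_mulrn ?(ltW j0) // -powRN -powRD; last first.
    by rewrite (gt_eqF j0) implybT.
  rewrite le_eqVlt; apply/orP; left; apply/eqP; congr (_ `^ _).
  have -> : d'%:R = d%:R - 1 :> R by rewrite -natr1 addrK.
  rewrite -[X in _ = _ - X]qe; ring.
have asm := @assembly R d' W w (Mab_values centered al be f) 7 q q Y B.
have {asm}asm := asm ltac:(by []) q1 q0 B0 Y0 w0 sums vals.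
have := @Lpnorm_of_integ R d' (Mab centered al be f) q q _ Y q0 _ Y0 asm.
rewrite divff ?gt_eqF // powRr1 // /C /Y mulrA; apply.
by rewrite mulr_ge0 ?mu1_ge0 // mulr_ge0 // exprn_ge0.
Qed.

(** Now al + be = d - 1, so a value is at most [dd] times the sum of [bv_core] for a family of one
    cube, with its own mean as base level. *)
Lemma mab_p1_endpoint centered : gam = d%:R ->
  exists2 C, 0 <= C & forall f V, L1 f -> 0 <= V -> C1_approximable f V ->
    (Linfnorm (Mab centered al be f) <= (C * V)%:E)%E.
Proof.
move=> gd; pose C := @dd R d' * @bv_const R d' al C1c.
have dd0 : 0 < @dd R d' by rewrite (lt_le_trans ltr01) // dd_ge1.
have bc0 : 0 <= @bv_const R d' al C1c by exact: bv_const_ge0.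
have C0 : 0 <= C by rewrite mulr_ge0 // ltW.
exists C => // f V Lf V0 HV; have lf := L1_locint Lf.
have CV0 : 0 <= C * V by rewrite mulr_ge0.
have sup x : (`|Mab centered al be f x| <= (C * V)%:E)%E.
  rewrite gee0_abs; last by apply: ereal_sup_ubound; left.
  rewrite MabE; apply: ge_ereal_sup => t [->|]; first by rewrite lee_fin.
  move=> /(Mab_valuesP m0 (ltW al0) lf)[->|[v [ov mv _ /andP[_ tv]]]]; first by rewrite lee_fin.
  apply: (le_trans tv); rewrite lee_fin /C -mulrA ler_pM2l //.
  have [v0 hopt] := ov.
  have := @bv_core R d' m0 f al C1c (mean f v.1 v.2) [:: v] (fun=> 0%N) Lf al0 ald C11 mv isT _ _ _ _ V HV.
  rewrite big_seq1 expr0 mulr1 => h; apply: le_trans (h _ _ _ _).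
  - have -> : al + be = d'%:R by move: gd; rewrite -natr1 => gd; lra.
    by rewrite powR_mulrn ?(ltW v0) // mulrC.
  - by move=> w; rewrite inE => /eqP ->.
  - move=> w; rewrite inE => /eqP ->; rewrite expr1 lexx /=.
    by rewrite ltr_pMr.
  - by move=> w; rewrite inE => /eqP ->; exact: hopt.
  - by move=> w w'; rewrite !inE => /eqP -> /eqP ->.
apply: ereal_inf_lbound; exists (C * V) => //=.
rewrite (_ : [set x | _] = set0) ?lstar0 //.
by apply/seteqP; split => // x /=; rewrite ltNge sup.
Qed.

End p_one.

(** * The case p > 1 *)

Section p_large.
Context {R : realType} {d' : nat}.
Local Notation d := d'.+1.
Local Notation T := (vec R d').
Local Notation mu := (@mu R d').
Local Notation P := ('rV[R]_d * R)%type.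
Hypothesis m0 : 0 < @mu1 R d'.
Variables (al be p : R).
Hypotheses (al0 : 0 < al) (ald : al <= d%:R) (p1 : 1 < p).
Local Notation gam := (1 + al + be).
Let C1c : R := @dd R d' * @dd R d'.
(** The dilation for which optimality forces the mean down to half. *)
Let L : R := (2 * C1c) `^ al^-1.

Let p0 : 0 < p.
Proof. exact: lt_trans p1. Qed.

Let dd0 : 0 < @dd R d'.
Proof. by rewrite (lt_le_trans ltr01) // dd_ge1. Qed.

Let C1_ge1 : 1 <= C1c.
Proof. by rewrite mulr_ege1 // dd_ge1. Qed.

Let L1 : 1 <= L.
Proof.
rewrite -(powRr0 (2 * C1c)) ler_powR ?invr_ge0 ?(ltW al0) //.
by rewrite mulr_ege1 // ler1n.
Qed.

Let L0 : 0 < L.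
Proof. exact: lt_le_trans L1. Qed.

Let L_al : L `^ al = 2 * C1c.
Proof.
rewrite /L -powRrM mulVf ?gt_eqF // powRr1 // mulr_ge0 //.
exact: le_trans C1_ge1.
Qed.

Definition gradient_const : R := 4 * L * 2 ^+ d * (2 * L) ^+ d.

Let Cg0 : 0 < gradient_const.
Proof. by rewrite /gradient_const mulr_gt0 ?exprn_gt0 ?mulr_gt0 // mulr_gt0 ?exprn_gt0 // mulr_gt0. Qed.

(** The mean over the L-dilate is at most half of the mean over the cube and is absorbed into the
    left side of the Poincare inequality, which doubles the constant. *)
Lemma optimal_mean_le (f : 'rV[R]_d -> R) (g : 'I_d -> 'rV[R]_d -> R) (v : P) :
  locint f -> (forall i, locint (g i)) -> weak_grad f g -> optimal al f v ->
  mean f v.1 v.2 <= gradient_const * v.2 * mean (gsum g) v.1 (2 * (L * v.2)).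
Proof.
move=> lf lg wg [v0 ho].
have Lv0 : 0 < L * v.2 by rewrite mulr_gt0.
have L2v0 : 0 < 2 * (L * v.2) by rewrite mulr_gt0.
have h1 := W1p_poincare m0 v.1 lf lg wg v0 L1.
have vL : v.2 <= L * v.2 by rewrite ler_peMl // ltW.
have h2 := ho _ vL.
have E : C1c * (v.2 / (L * v.2)) `^ al = 2^-1.
  have -> : v.2 / (L * v.2) = L^-1 by field; rewrite !gt_eqF.
  rewrite -(powR_inv1 (ltW L0)) -powRrM mulN1r powRN L_al.
  by field; rewrite gt_eqF // (lt_le_trans ltr01).
rewrite -/C1c E in h2; rewrite massE_mean // in h1.
have F : 2 * (L * v.2) * 2 ^+ d / (@mu1 R d' * v.2 ^+ d) *
   (mean (gsum g) v.1 (2 * (L * v.2)) * (@mu1 R d' * (2 * (L * v.2)) ^+ d)) =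
   2^-1 * (gradient_const * v.2 * mean (gsum g) v.1 (2 * (L * v.2))).
  rewrite /gradient_const [2 * (L * v.2)]mulrA exprMn.
  have := exprn_gt0 d v0; move: (v.2 ^+ d) ((2 * L) ^+ d) (mean _ _ _) (2 ^+ d) => a b c e a0.
  by field; rewrite (gt_eqF m0) (gt_eqF a0).
rewrite F in h1; lra.
Qed.

(** The points with G <= W / 2 account for at most half of W times the volume. *)
Lemma int_large_part (G : 'rV[R]_d -> R) c r (W : R) : locint G -> (forall y, 0 <= G y) ->
  0 < r -> 0 <= W -> W <= mean G c r ->
  ((W / 2 * (@mu1 R d' * r ^+ d))%:E <=
    \int[mu]_y (\1_(cube c r) y * (\1_(`]W / 2, +oo[%classic) (G y) * G y))%:E)%E.
Proof.
move=> lG G0 r0 W0 WG; have [mG _] := lG.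
have W2 : 0 <= W / 2 by rewrite divr_ge0.
have mi := measurable_indicT c r.
have mb : measurable_fun setT (fun y : T => \1_(`]W / 2, +oo[%classic) (G y) * G y).
  apply: measurable_funM => //.
  by apply: (measurableT_comp (f := (\1_(`]W / 2, +oo[%classic) : R -> R))) => //; apply: measurable_indic; exact: measurable_itv.
set J := (\int[mu]_y _)%E.
have h1 : ((W * (@mu1 R d' * r ^+ d))%:E <= (mass G c r)%:E)%E.
  by rewrite lee_fin massE_mean // ler_wpM2r // mulr_ge0 ?mu1_ge0 // exprn_ge0 // ltW.
have h2 : ((mass G c r)%:E <= (W / 2 * (@mu1 R d' * r ^+ d))%:E + J)%E.
  have mc := measurable_cube c r.
  rewrite massE // EFinM -(mu_cube c r0) -(@integral_cst _ T R mu _ mc (W / 2)%:E) (int_indicE mu _ (fun=> W / 2)).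
  rewrite -ge0_integralD; first last.
  - by apply/measurable_EFinP; apply: measurable_funM.
  - by move=> y _; rewrite lee_fin mulr_ge0 // mulr_ge0.
  - by apply/measurable_EFinP; apply: measurable_funM.
  - by move=> y _; rewrite lee_fin mulr_ge0.
  - exact: measurableT.
  apply: le_int => y _; first by rewrite lee_fin mulr_ge0.
  rewrite -EFinD lee_fin -mulrDr ler_wpM2l // ger0_norm // [X in _ <= _ + X * _]indicE.
  have [h|h] := ltP (W / 2) (G y).
    by rewrite mem_set /= ?in_itv /= ?h // mul1r lerDr.
  by rewrite memNset /= ?in_itv /= ?andbT ?mul0r ?addr0 // => /(le_lt_trans h); rewrite ltxx.
have := le_trans h1 h2; rewrite -leeBlDl // -EFinB => h3; apply: le_trans h3.
by rewrite lee_fin le_eqVlt; apply/orP; left; apply/eqP; field.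
Qed.

Let z : R := 2 `^ (p - 1).

Let z1 : 1 < z.
Proof.
rewrite /z -[ltLHS](_ : (2 : R) `^ 0 = 1); last by rewrite powRr0.
by rewrite /powR gt_eqF // ltr_expR ltr_pM2r ?subr_gt0 // ln_gt0 // ltr1n.
Qed.

(** The cubes containing y have distinct levels, so the powers 2^(lev * (p-1)) form part of a
    progression of ratio z > 1, dominated by its top term. For the latter 2^lev < 2 * a, which turns
    a times the sum into a^p. *)
Lemma large_part_sum (l : seq P) (lev : P -> int) (B : P -> set 'rV[R]_d) (a : R) (y : 'rV[R]_d) :
  uniq l -> 0 <= a ->
  {in l &, forall v w, lev v = lev w -> (B v `&` B w) !=set0 -> v = w} ->
  \sum_(v <- l) \1_(B v) y * ((2 `^ (lev v)%:~R) `^ (p - 1) *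
      (\1_(`]2 `^ (lev v)%:~R / 2, +oo[%classic) a * a)) <= z * (z / (z - 1)) * a `^ p.
Proof.
move=> ul a0 hdis; have z0 : 0 < z by exact: lt_trans z1.
have zz0 : 0 < z / (z - 1) by rewrite divr_gt0 // subr_gt0.
pose W v : R := 2 `^ (lev v)%:~R.
pose l' := [seq v <- l | (y \in B v) && (W v / 2 < a)].
have -> : \sum_(v <- l) \1_(B v) y * (W v `^ (p - 1) * (\1_(`]W v / 2, +oo[%classic) a * a)) =
    a * \sum_(v <- l') W v `^ (p - 1).
  rewrite mulr_sumr big_filter [RHS]big_mkcond; apply: eq_bigr => v _.
  rewrite !indicE; have -> : (a \in `]W v / 2, +oo[%classic) = (W v / 2 < a).
    by apply/idP/idP; rewrite inE /= in_itv /= andbT.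
  by case: (y \in B v); case: (W v / 2 < a); rewrite /= ?mul1r ?mul0r ?mulr0 // mulrC.
have [->|[v1 v1l]] : l' = [::] \/ exists v1, v1 \in l'.
    by case: l' => [|v1 l'']; [left|right; exists v1; exact: mem_head].
  by rewrite big_nil mulr0 mulr_ge0 ?powR_ge0 // mulr_ge0 ?(ltW z0) ?(ltW zz0).
have lP v : v \in l' -> [/\ v \in l, B v y & W v / 2 < a].
  by rewrite mem_filter => /andP[/andP[/set_mem ? ->] ->].
have [N [kap hk]] := @shift_levels R _ l lev.
have [j jl hj] := seq_argmax kap v1l; have [jl0 yj ja] := lP _ jl.
have WE v : v \in l -> W v `^ (p - 1) = 2 `^ (- N%:R * (p - 1)) * z ^+ kap v.
  move=> vl; rewrite /W hk // -powRrM -powR_mulrn ?(ltW z0) // /z -powRrM.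
  rewrite -powRD; last by rewrite pnatr_eq0 implybT.
  by congr (_ `^ _); ring.
have a00 : 0 < a by apply: le_lt_trans ja; rewrite divr_ge0 // powR_ge0.
have h : \sum_(v <- l') W v `^ (p - 1) <= z / (z - 1) * W j `^ (p - 1).
  apply: (@le_trans _ _ (\sum_(v <- l') 2 `^ (- N%:R * (p - 1)) * z ^+ kap v)).
    rewrite le_eqVlt; apply/orP; left; apply/eqP.
    by rewrite big_seq [RHS]big_seq; apply: eq_bigr => v /lP[vl _ _]; rewrite WE.
  rewrite -mulr_sumr (WE j jl0) mulrCA; apply: ler_wpM2l; first exact: powR_ge0.
  rewrite mulrAC -exprS; apply: geo_sum => //.
  - by rewrite filter_uniq.
  - move=> v w /lP[vl yv _] /lP[wl yw _] kvw; apply: hdis => //; last by exists y.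
    by apply: (@intr_inj R); rewrite hk // hk // kvw.
  - exact: hj.
apply: (le_trans (ler_wpM2l a0 h)).
have Wj : W j `^ (p - 1) <= z * a `^ (p - 1).
  rewrite /z -powRM //; apply: ge0_ler_powR; rewrite ?nnegrE ?powR_ge0 ?mulr_ge0 ?subr_ge0 ?(ltW p1) //.
  by move: ja; rewrite ltr_pdivrMr // mulrC => /ltW.
have -> : a `^ p = a * a `^ (p - 1).
  rewrite -[X in X * _](powRr1 a0) -powRD; last by rewrite (gt_eqF a00) implybT.
  by congr (_ `^ _); ring.
have -> : z * (z / (z - 1)) * (a * a `^ (p - 1)) = a * (z / (z - 1) * (z * a `^ (p - 1))) by ring.
by apply: ler_wpM2l => //; apply: ler_wpM2l => //; exact: ltW.
Qed.

Definition sum_const : R := z * (z / (z - 1)) / (2^-1 * (@mu1 R d' * (2 * L) ^+ d)).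

Let Cs0 : 0 <= sum_const.
Proof.
have z0 : 0 < z by exact: lt_trans z1.
rewrite /sum_const divr_ge0 //.
  by rewrite mulr_ge0 ?(ltW z0) // divr_ge0 ?(ltW z0) // subr_ge0 ltW.
by rewrite mulr_ge0 // mulr_ge0 ?mu1_ge0 // exprn_ge0 // mulr_ge0 // ltW.
Qed.

Let rad (v : P) := 2 * (L * v.2).

(** [int_large_part] times 2^(lev * (p-1)), summed over the cubes; under the integral
    [large_part_sum] bounds the sum by a multiple of G^p. *)
Lemma gradient_level_sum (G : 'rV[R]_d -> R) (I : R) (lev : P -> int) (l : seq P) :
  locint G -> (forall y, 0 <= G y) -> (\int[mu]_y (G y `^ p)%:E <= I%:E)%E -> uniq l ->
  {in l, forall v, 0 < v.2} ->
  {in l, forall v, 2 `^ (lev v)%:~R <= mean G v.1 (rad v)} ->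
  {in l &, forall v w, lev v = lev w -> (cube v.1 (rad v) `&` cube w.1 (rad w)) !=set0 -> v = w} ->
  \sum_(v <- l) (2 `^ (lev v)%:~R) `^ p * v.2 ^+ d <= sum_const * I.
Proof.
move=> lG G0 hI ul hr hlev hdis; have [mG _] := lG.
pose W v : R := 2 `^ (lev v)%:~R.
have W0 v : 0 < W v by rewrite powR_gt0.
pose k : R := 2^-1 * (@mu1 R d' * (2 * L) ^+ d).
have k0 : 0 < k by rewrite mulr_gt0 ?invr_gt0 // mulr_gt0 ?exprn_gt0 // mulr_gt0.
rewrite /sum_const -/k mulrAC ler_pdivlMr //.
rewrite mulr_suml -lee_fin -sumEFin.
pose h (v : P) (y : T) := (\1_(cube v.1 (rad v)) y * (W v `^ (p - 1) * (\1_(`]W v / 2, +oo[%classic) (G y) * G y)))%:E.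
have mh v : measurable_fun setT (h v).
  apply/measurable_EFinP; apply: measurable_funM; first exact: measurable_indicT.
  apply: measurable_funM; first exact: measurable_cst.
  apply: measurable_funM => //.
  by apply: (measurableT_comp (f := (\1_(`]W v / 2, +oo[%classic) : R -> R))) => //; apply: measurable_indic; exact: measurable_itv.
have h0 v y : (0 <= h v y)%E.
  by rewrite lee_fin mulr_ge0 // mulr_ge0 ?powR_ge0 // mulr_ge0.
apply: (@le_trans _ _ (\sum_(v <- l) \int[mu]_y h v y)%E).
  rewrite big_seq [leRHS]big_seq; apply: lee_sum => v vl; have v0 := hr _ vl.
  have rv0 : 0 < rad v by rewrite /rad mulr_gt0 // mulr_gt0.
  have := int_large_part lG G0 rv0 (ltW (W0 v)) (hlev _ vl).
  rewrite -(@lee_pmul2l _ (W v `^ (p - 1))%:E) ?lte_fin ?powR_gt0 // => hh.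
  apply: (le_trans (le_trans _ hh)).
    rewrite -EFinM lee_fin le_eqVlt; apply/orP; left; apply/eqP.
    have -> : W v `^ p = W v `^ (p - 1) * W v.
      rewrite -[X in _ * X](powRr1 (ltW (W0 v))) -powRD; last by rewrite (gt_eqF (W0 v)) implybT.
      by congr (_ `^ _); ring.
    rewrite /k /rad [2 * (L * v.2)]mulrA [(2 * L * v.2) ^+ d]exprMn.
    by move: ((2 * L) ^+ d) (v.2 ^+ d) (W v) (W v `^ (p - 1)) => b1 b2 b3 b4; field.
  rewrite -ge0_integralZl_EFin; first last.
  - exact: powR_ge0.
  - apply/measurable_EFinP; apply: measurable_funM; first exact: measurable_indicT.
    apply: measurable_funM => //.
    by apply: (measurableT_comp (f := (\1_(`]W v / 2, +oo[%classic) : R -> R))) => //; apply: measurable_indic; exact: measurable_itv.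
  - by move=> y _; rewrite lee_fin mulr_ge0 // mulr_ge0.
  - exact: measurableT.
  apply: le_int => y _; first by rewrite mule_ge0 ?lee_fin ?powR_ge0 // mulr_ge0 // mulr_ge0.
  by rewrite /h -EFinM lee_fin mulrCA.
have z0 : 0 < z by exact: lt_trans z1.
have zc0 : 0 <= z * (z / (z - 1)).
  by rewrite mulr_ge0 ?(ltW z0) // divr_ge0 ?(ltW z0) // subr_ge0 ltW.
rewrite -ge0_integral_sum; [|exact: measurableT|exact: mh|by move=> v y _; exact: h0].
rewrite EFinM; apply: le_trans (lee_wpmul2l _ hI); last by rewrite lee_fin.
rewrite -ge0_integralZl_EFin //; first last.
- apply/measurable_EFinP; exact: (measurableT_comp (measurable_powR p) mG).
- by move=> y _; rewrite lee_fin powR_ge0.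
apply: le_int => y _; first by apply: sume_ge0 => v _; exact: h0.
rewrite sumEFin -EFinM lee_fin.
exact: (@large_part_sum l lev (fun v => cube v.1 (rad v)) (G y) y ul (G0 y) hdis).
Qed.

Let lev_exists (G : 'rV[R]_d -> R) (v : P) : exists l : int, 0 < mean G v.1 (rad v) ->
  2 `^ l%:~R <= mean G v.1 (rad v) < 2 `^ l%:~R * 2.
Proof.
have [h|h] := ltP 0 (mean G v.1 (rad v)); last by exists 0.
have A1 : 1 < 2 :> R by rewrite ltr1n.
by have [l hl] := exists_level A1 h; exists l.
Qed.

Let optimal_mean_pos (f : 'rV[R]_d -> R) (g : 'I_d -> 'rV[R]_d -> R) (v : P) :
  locint f -> (forall i, locint (g i)) -> weak_grad f g ->
  optimal al f v -> 0 < mean f v.1 v.2 -> 0 < mean (gsum g) v.1 (rad v).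
Proof.
move=> lf lg wg ov mv; have v0 := ov.1.
have := lt_le_trans mv (optimal_mean_le lf lg wg ov).
by rewrite pmulr_rgt0 // mulr_gt0.
Qed.

Let val_le (f : 'rV[R]_d -> R) (g : 'I_d -> 'rV[R]_d -> R) (v : P) :
  locint f -> (forall i, locint (g i)) -> weak_grad f g -> optimal al f v ->
  @dd R d' * (v.2 `^ (al + be) * mean f v.1 v.2) <=
  @dd R d' * gradient_const * (v.2 `^ gam * mean (gsum g) v.1 (rad v)).
Proof.
move=> lf lg wg ov; have v0 := ov.1.
rewrite -mulrA ler_pM2l //.
have -> : v.2 `^ gam = v.2 `^ (al + be) * v.2.
  rewrite -[X in _ * X](powRr1 (ltW v0)) -powRD; last by rewrite (gt_eqF v0) implybT.
  by congr (_ `^ _); ring.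
rewrite (_ : gradient_const * _ = v.2 `^ (al + be) * (gradient_const * v.2 * mean (gsum g) v.1 (rad v))); last by ring.
apply: ler_wpM2l; first exact: powR_ge0.
exact: optimal_mean_le.
Qed.

(** The weights are w = 2^(lev * p) * r^d and s = q / p >= 1. As gam * q = d * s - d, the power q of
    r^gam * 2^lev equals w^s * r^(-d). Since gam >= 0, the one-sided bound v.2 <= 2 * j.2 of the
    selection is enough. *)
Lemma mab_p centered : 0 <= gam -> gam < d%:R / p ->
  exists2 C, 0 <= C & forall (f : 'rV[R]_d -> R) (g : 'I_d -> 'rV[R]_d -> R) I,
    locint f -> (forall i, locint (g i)) -> weak_grad f g -> 0 <= I ->
    (\int[mu]_y (gsum g y `^ p)%:E <= I%:E)%E ->
    (Lpnorm (p^-1 - gam / d%:R)^-1 (Mab centered al be f) <= (C * I `^ p^-1)%:E)%E.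
Proof.
move=> g0 gd; set q := (p^-1 - gam / d%:R)^-1.
have d0 : 0 < d%:R :> R by [].
have qi0 : 0 < p^-1 - gam / d%:R by rewrite subr_gt0 ltr_pdivrMr // mulrC.
have q0 : 0 < q by rewrite invr_gt0.
pose s := q / p.
have ps : p * s = q by rewrite /s mulrC divfK // gt_eqF.
have s1 : 1 <= s.
  by rewrite ler_pdivlMr // mul1r -[p]invrK lef_pV2 ?posrE ?invr_gt0 // gerBl divr_ge0.
have sq : s / q = p^-1 by rewrite /s; field; rewrite !gt_eqF.
have ge : gam * q = d%:R * s - d%:R.
  have -> : gam = d%:R / p - d%:R * q^-1.
    rewrite /q invrK mulrBr mulrCA divff ?mulr1; last by rewrite gt_eqF.
    by rewrite opprB addrCA subrr addr0.
  by rewrite mulrBl /s -!mulrA mulVf ?mulr1 ?gt_eqF // [p^-1 * q]mulrC.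
have p0' : 0 <= p by exact: ltW.
pose c0 := @dd R d' * gradient_const * (2 `^ gam * 2).
have c00 : 0 <= c0 by rewrite mulr_ge0 // mulr_ge0 ?powR_ge0 // ltW.
pose B := c0 `^ q; have B0 : 0 <= B by exact: powR_ge0.
pose kp : R := 10 * L; have kp0 : 0 < kp by rewrite mulr_gt0.
pose C := (B * kp ^+ d * @mu1 R d') `^ q^-1 * sum_const `^ p^-1.
have C0 : 0 <= C by rewrite mulr_ge0 ?powR_ge0.
exists C => // f g I lf lg wg I0 hI.
have lG := locint_gsum lg; set G := gsum g in lG hI.
have G0 y : 0 <= G y by exact: gsum_ge0.
have [lev hlev] := choice (lev_exists G).
pose D : set P := [set v | optimal al f v /\ 0 < mean f v.1 v.2].
have D0 v : D v -> 0 < v.2 by move=> [[]].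
have DG v : D v -> 0 < mean G v.1 (rad v) by move=> [ov mv]; exact: (optimal_mean_pos lf lg wg ov mv).
have rad0 v : D v -> 0 < rad v by move=> /D0 v0; rewrite /rad mulr_gt0 // mulr_gt0.
pose w (v : P) := (2 `^ (lev v)%:~R) `^ p * v.2 ^+ d.
pose Y := sum_const * I; have Y0 : 0 <= Y by rewrite mulr_ge0.
(* The level sum of a single cube already bounds its radius: 2^(l * p) * r^d <= Y. *)
have Dbd l : exists M, forall v, D v -> lev v = l -> rad v <= M.
  pose a : R := (2 `^ l%:~R) `^ p; have a0 : 0 < a by rewrite powR_gt0 // powR_gt0.
  exists (2 * (L * Num.max 1 (Y / a))) => v Dv lv; have v0 := D0 _ Dv.
  rewrite /rad !ler_pM2l // le_max; have [v1|v1] := leP v.2 1; first by [].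
  have := @gradient_level_sum G I lev [:: v] lG G0 hI isT _ _ _.
  rewrite big_seq1 lv -/a -/Y => h.
  rewrite ler_pdivlMr // mulrC; apply: (le_trans _ (h _ _ _)).
  - rewrite ler_pM2l // exprS ler_peMr ?(ltW v0) // exprn_ege1 // ltW //.
  - by move=> u; rewrite inE => /eqP ->.
  - by move=> u; rewrite inE => /eqP ->; have /andP[] := hlev _ (DG _ Dv).
  - by move=> u u'; rewrite !inE => /eqP -> /eqP ->.
have Dne v : D v -> cube v.1 (rad v) !=set0.
  by move=> Dv; exists v.1; rewrite /cube /= subrr normr0; exact: rad0.
have [W [WD Wdis Wcov]] := @vitali_levels R P 'rV[R]_d (fun v => cube v.1 (rad v)) rad D lev rad0 Dbd Dne.
have w0 v : W v -> 0 < v.2 /\ 0 < w v.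
  move=> /WD /D0 v0; rewrite /w; split => //.
  by rewrite mulr_gt0 ?exprn_gt0 // powR_gt0 // powR_gt0.
have sums (l : seq P) : uniq l -> {in l, forall v, W v} -> \sum_(v <- l) w v <= Y.
  move=> ul lW; apply: (gradient_level_sum lG G0 hI ul).
  - by move=> v /lW /WD /D0.
  - by move=> v /lW /WD /DG /hlev /andP[].
  - by move=> v v' /lW Wv /lW Wv' lvv mt; exact: Wdis.
have vals x t : Mab_values centered al be f x t -> t = 0%E \/
    exists v, [/\ W v, cube v.1 (kp * v.2) x & (0 <= t)%E /\ (t `^ q <= (B * w v `^ s * v.2 ^- d)%:E)%E].
  move=> /(Mab_valuesP m0 (ltW al0) lf)[->|[v [ov mv xv /andP[t0 tv]]]]; [by left|right].
  have Dv : D v by [].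
  have [j [Wj ljv [y [yv yj]] rvj]] := Wcov _ Dv.
  have j0 := D0 _ (WD _ Wj); have v0 := D0 _ Dv.
  have vj : v.2 <= 2 * j.2.
    by move: rvj; rewrite /rad (mulrCA 2 2) ler_pM2l // (mulrCA 2 L) ler_pM2l.
  (* Distances add up to 2 * v.2 + rad v + rad j, at most (4 + 4 + 2) * L * j.2. *)
  exists j; split => //.
    move: xv yv yj; rewrite /cube /kp /rad /= => h1 h2 h3.
    rewrite (_ : x - j.1 = (x - v.1) - (y - v.1) + (y - j.1)); last first.
      by apply/rowP => i; rewrite !mxE; ring.
    apply: (le_lt_trans (ler_normD _ _)).
    have := ler_normB (x - v.1) (y - v.1).
    have : 2 * (L * v.2) <= 4 * (L * j.2).
      rewrite (_ : 4 * (L * j.2) = 2 * (L * (2 * j.2))); last by ring.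
      by rewrite !ler_pM2l.
    have : j.2 <= L * j.2 by rewrite ler_peMl // ltW.
    have -> : 10 * L * j.2 = 10 * (L * j.2) by rewrite mulrA.
    lra.
  split => //.
  have /andP[_ mvA] := hlev _ (DG _ Dv).
  pose a : R := 2 `^ (lev v)%:~R; have a0 : 0 < a by rewrite powR_gt0.
  have jp0 : 0 <= j.2 `^ gam by exact: powR_ge0.
  have tb : (t <= (c0 * (j.2 `^ gam * a))%:E)%E.
    apply: (le_trans tv); rewrite lee_fin; apply: (le_trans (val_le lf lg wg ov)).
    have -> : c0 * (j.2 `^ gam * a) = @dd R d' * gradient_const * ((2 `^ gam * j.2 `^ gam) * (a * 2)).
      by rewrite /c0; ring.
    apply: ler_wpM2l; first by rewrite mulr_ge0 // ltW.
    apply: ler_pM; [exact: powR_ge0|exact: ltW (DG _ Dv)| |exact: ltW].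
    rewrite -powRM ?(ltW j0) //; apply: ge0_ler_powR; rewrite ?nnegrE ?(ltW v0) //.
    by rewrite mulr_ge0 // ltW.
  apply: (le_trans (le_poweR (ltW q0) t0 tb)); rewrite poweR_EFin lee_fin.
  rewrite (powRM _ c00) ?mulr_ge0 ?(ltW a0) // -/B -mulrA ler_wpM2l //.
  rewrite /w ljv -/a (powRM _ jp0 (ltW a0)) (powRM _ (powR_ge0 a p)) ?exprn_ge0 ?(ltW j0) //.
  rewrite -(powRrM a) ps [leLHS]mulrC -mulrA (ler_pM2l (powR_gt0 q a0)).
  rewrite -powRrM -powR_mulrn ?(ltW j0) // -powRrM -powRN -powRD; last first.
    by rewrite (gt_eqF j0) implybT.
  by rewrite ge.
have asm := @assembly R d' W w (Mab_values centered al be f) kp q s Y B kp0 s1 q0 B0 Y0 w0 sums vals.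
have := @Lpnorm_of_integ R d' (Mab centered al be f) q s _ Y q0 _ Y0 asm.
rewrite sq /C /Y (powRM _ Cs0 I0) mulrA; apply.
by rewrite mulr_ge0 ?mu1_ge0 // mulr_ge0 // exprn_ge0 // ltW.
Qed.

(* [G <= h + h `^ (1 - p) * G `^ p]; optimized over [h] this replaces the inequality of Hoelder. *)
Lemma mean_le_young (G : 'rV[R]_d -> R) c r (h I : R) : locint G -> (forall y, 0 <= G y) ->
  (\int[mu]_y (G y `^ p)%:E <= I%:E)%E -> 0 < r -> 0 < h ->
  mean G c r <= h + h `^ (1 - p) * I / (@mu1 R d' * r ^+ d).
Proof.
move=> lG G0 hI r0 h0; have [mG _] := lG.
have m1 : 0 < @mu1 R d' * r ^+ d by rewrite mulr_gt0 // exprn_gt0.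
rewrite -(ler_pM2r m1) -massE_mean // mulrDl divfK ?gt_eqF //.
have hp : 0 <= h `^ (1 - p) by exact: powR_ge0.
rewrite -lee_fin massE // EFinD [(h `^ (1 - p) * I)%:E]EFinM.
have mc := measurable_cube c r.
rewrite [(h * _)%:E]EFinM -(mu_cube c r0) -(@integral_cst _ T R mu _ mc h%:E) (int_indicE mu _ (fun=> h)).
apply: le_trans (leeD2l _ (lee_wpmul2l _ hI)); last by rewrite lee_fin.
have mGp : measurable_fun setT (fun y : T => (G y `^ p)%:E).
  by apply/measurable_EFinP; exact: (measurableT_comp (measurable_powR p) mG).
rewrite -ge0_integralZl_EFin //; last by move=> y _; rewrite lee_fin powR_ge0.
rewrite -ge0_integralD; first last.
- by apply: emeasurable_funM => //; apply/measurable_EFinP; exact: measurable_cst.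
- by move=> y _; rewrite -EFinM lee_fin mulr_ge0 ?powR_ge0.
- by apply/measurable_EFinP; apply: measurable_funM => //; exact: measurable_indicT.
- by move=> y _; rewrite lee_fin mulr_ge0 // ltW.
- exact: measurableT.
apply: le_int => y _; first by rewrite lee_fin mulr_ge0.
rewrite -EFinM -EFinD lee_fin ger0_norm // indicE.
case: (_ \in _); rewrite ?mul1r ?mul0r; last by rewrite addr_ge0 // mulr_ge0 ?powR_ge0.
have [hG|hG] := leP (G y) h; first by rewrite (le_trans hG) // lerDl mulr_ge0 ?powR_ge0.
have Gy0 : 0 < G y by exact: lt_trans hG.
apply: (@le_trans _ _ (h `^ (1 - p) * G y `^ p)); last by rewrite lerDr ltW.
have -> : G y `^ p = G y `^ (p - 1) * G y.
  rewrite -[X in _ * X](powRr1 (G0 y)) -powRD; last by rewrite (gt_eqF Gy0) implybT.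
  by congr (_ `^ _); ring.
rewrite mulrA ler_peMl // -opprB powRN mulrC ler_pdivlMr ?powR_gt0 // mul1r.
by apply: ge0_ler_powR; rewrite ?nnegrE ?subr_ge0 ?(ltW h0) ?(ltW p1) ?(ltW Gy0) // ltW.
Qed.

(** With gam = d / p the factor r^gam exactly cancels the r^(-d/p) of the bound on the mean of the
    gradient, so each ball gives a bound free of its radius. *)
Lemma mab_p_endpoint centered : 0 <= gam -> gam = d%:R / p ->
  exists2 C, 0 <= C & forall (f : 'rV[R]_d -> R) (g : 'I_d -> 'rV[R]_d -> R) I,
    locint f -> (forall i, locint (g i)) -> weak_grad f g -> 0 <= I ->
    (\int[mu]_y (gsum g y `^ p)%:E <= I%:E)%E ->
    (Linfnorm (Mab centered al be f) <= (C * I `^ p^-1)%:E)%E.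
Proof.
move=> g0 ge.
pose k := @mu1 R d' * (2 * L) ^+ d.
have k0 : 0 < k by rewrite mulr_gt0 // exprn_gt0 // mulr_gt0.
pose C := @dd R d' * gradient_const * (2 * (k^-1) `^ p^-1).
have dg0 : 0 <= @dd R d' * gradient_const by rewrite mulr_ge0 // ltW.
have C0 : 0 <= C by rewrite mulr_ge0 // mulr_ge0 ?powR_ge0.
exists C => // f g I lf lg wg I0 hI.
have lG := locint_gsum lg; set G := gsum g in lG hI.
have G0 y : 0 <= G y by exact: gsum_ge0.
have CI0 : 0 <= C * I `^ p^-1 by rewrite mulr_ge0 ?powR_ge0.
have sup x : (`|Mab centered al be f x| <= (C * I `^ p^-1)%:E)%E.
  rewrite gee0_abs; last by apply: ereal_sup_ubound; left.
  rewrite MabE; apply: ge_ereal_sup => t [->|]; first by rewrite lee_fin.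
  move=> /(Mab_valuesP m0 (ltW al0) lf)[->|[v [ov mv _ /andP[_ tv]]]]; first by rewrite lee_fin.
  apply: (le_trans tv); rewrite lee_fin; apply: (le_trans (val_le lf lg wg ov)).
  have v0 := ov.1; have rv0 : 0 < rad v by rewrite /rad mulr_gt0 // mulr_gt0.
  have mG := optimal_mean_pos lf lg wg ov mv; rewrite -/G in mG *.
  have young h : 0 < h -> mean G v.1 (rad v) <= h + h `^ (1 - p) * I / (@mu1 R d' * rad v ^+ d).
    by move=> h0; exact: mean_le_young.
  rewrite /C -[leRHS]mulrA; apply: ler_wpM2l => //.
  move: I0; rewrite le_eqVlt => /orP[/eqP I0|Ip].
    (* For I = 0 the choice of h below would not be positive; half the mean gives mean <= mean / 2,
       which is absurd. *)
    have hm : 0 < mean G v.1 (rad v) / 2 by rewrite divr_gt0.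
    have := young _ hm; rewrite -I0 mulr0 mul0r addr0; lra.
  have rE : @mu1 R d' * rad v ^+ d = k * v.2 ^+ d.
    by rewrite /rad /k [2 * (L * v.2)]mulrA exprMn mulrA.
  pose X := I / (k * v.2 ^+ d).
  have X0 : 0 < X by rewrite divr_gt0 // mulr_gt0 // exprn_gt0.
  (* With h = X^(1/p) both terms of [mean_le_young] are equal to h. *)
  have h0 : 0 < X `^ p^-1 by rewrite powR_gt0.
  have := young _ h0; rewrite rE -mulrA -/X.
  have -> : (X `^ p^-1) `^ (1 - p) * X = X `^ p^-1.
    rewrite -powRrM -[X in _ * X](powRr1 (ltW X0)) -powRD; last by rewrite (gt_eqF X0) implybT.
    by congr (_ `^ _); field; rewrite gt_eqF.
  move=> hy; apply: (le_trans (ler_wpM2l (powR_ge0 _ _) hy)).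
  have -> : X `^ p^-1 = I `^ p^-1 * (k^-1 `^ p^-1 * v.2 `^ (- gam)).
    rewrite /X invfM (powRM _ (ltW Ip)); last by rewrite mulr_ge0 ?invr_ge0 ?exprn_ge0 ?(ltW k0) ?(ltW v0).
    rewrite powRM ?invr_ge0 ?exprn_ge0 ?(ltW k0) ?(ltW v0) //; congr (_ * (_ * _)).
    rewrite -powR_mulrn ?(ltW v0) // -powRN -powRrM; congr (_ `^ _).
    by rewrite ge mulNr.
  have vv : v.2 `^ gam * v.2 `^ (- gam) = 1.
    by rewrite powRN divff // gt_eqF // powR_gt0.
  rewrite le_eqVlt; apply/orP; left; apply/eqP.
  set a := I `^ p^-1; set b := k^-1 `^ p^-1.
  transitivity ((v.2 `^ gam * v.2 `^ (- gam)) * (2 * (b * a))); first by ring.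
  by rewrite vv mul1r mulrA.
apply: ereal_inf_lbound; exists (C * I `^ p^-1) => //=.
rewrite (_ : [set x | _] = set0) ?lstar0 //.
by apply/seteqP; split => // x /=; rewrite ltNge sup.
Qed.

End p_large.

(** * From the sum of partial derivatives to the gradient norm *)

Section gradient_norm.
Context {R : realType} {d' : nat}.
Local Notation d := d'.+1.
Local Notation T := (vec R d').
Local Notation mu := (@mu R d').
Variables (g : 'I_d -> 'rV[R]_d -> R).
Let gn (y : 'rV[R]_d) : R := Num.sqrt (\sum_(i < d) g i y ^+ 2).

Lemma gsum_le_gradnorm y : gsum g y <= d%:R * gn y.
Proof.
rewrite /gsum mulrC.
apply: (@le_trans _ _ (\sum_(i < d) gn y)); last by rewrite sumr_const card_ord mulr_natr.
apply: ler_sum => i _; rewrite -sqrtr_sqr ler_wsqrtr // (bigD1 i) //= lerDl.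
by apply: sumr_ge0 => j _; exact: sqr_ge0.
Qed.

Hypothesis mg : forall i, lmeasurable_fun (g i).

Lemma lmeasurable_gradnorm : lmeasurable_fun gn.
Proof.
apply/lmeasurable_funP.
rewrite (_ : gn = fun y : T => (\sum_(i < d) g i y ^+ 2) `^ 2^-1); last first.
  by apply/funext => y; rewrite powR12_sqrt // sumr_ge0 // => i _; exact: sqr_ge0.
apply: (measurableT_comp (measurable_powR 2^-1)).
apply: (@measurable_sum _ T R setT _ _ (fun i (y : T) => g i y ^+ 2)) => i.
by apply: measurable_funX; apply/lmeasurable_funP; exact: mg.
Qed.

(** The constant is C + 1 rather than C so that it is positive: its product with an infinite
    gradient norm is then infinite, and the bound holds trivially in that case. *)
Lemma le_Lpnorm_gradnorm (p C : R) (N : \bar R) : 1 <= p -> 0 <= C ->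
  (forall I, 0 <= I -> (\int[mu]_y (gsum g y `^ p)%:E <= I%:E)%E -> (N <= (C * I `^ p^-1)%:E)%E) ->
  (N <= ((C + 1) * d%:R)%:E * Lpnorm p (gradnorm g))%E.
Proof.
move=> p1 C0 h; have p0 : 0 < p by exact: lt_le_trans p1.
have d0 : 0 < d%:R :> R by rewrite ltr0n.
have C10 : 0 < C + 1 by rewrite ltr_wpDl.
rewrite (@Lpnorm_int _ _ p gn lmeasurable_gradnorm).
have gn0 y : 0 <= gn y by exact: sqrtr_ge0.
have mgn : measurable_fun setT (fun y : T => (`|gn y| `^ p)%:E).
  apply/measurable_EFinP; apply: (measurableT_comp (measurable_powR p)).
  by apply: measurableT_comp => //; apply/lmeasurable_funP; exact: lmeasurable_gradnorm.
have J0 : (0 <= \int[mu]_y (`|gn y| `^ p)%:E)%E.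
  by apply: integral_ge0 => y _; rewrite lee_fin powR_ge0.
have hJ : (\int[mu]_y (gsum g y `^ p)%:E <= (d%:R `^ p)%:E * \int[mu]_y (`|gn y| `^ p)%:E)%E.
  rewrite -ge0_integralZl_EFin; first last.
  - exact: powR_ge0.
  - exact: mgn.
  - by move=> y _; rewrite lee_fin powR_ge0.
  - exact: measurableT.
  apply: le_int => y _; first by rewrite lee_fin powR_ge0.
  rewrite -EFinM lee_fin (ger0_norm (gn0 y)) -powRM ?(ltW d0) //.
  by apply: ge0_ler_powR; rewrite ?nnegrE ?(ltW p0) ?gsum_ge0 ?mulr_ge0 ?(ltW d0) // gsum_le_gradnorm.
move: J0 hJ; case: (integral _ _ _) => [J| |] //.
- rewrite lee_fin => J0; rewrite -EFinM => hJ.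
  have I0 : 0 <= d%:R `^ p * J by rewrite mulr_ge0 ?powR_ge0.
  apply: (le_trans (h _ I0 hJ)).
  rewrite poweR_EFin -EFinM lee_fin powRM ?powR_ge0 // -powRrM divff ?gt_eqF //.
  rewrite powRr1 ?(ltW d0) // mulrA; apply: ler_wpM2r; first exact: powR_ge0.
  by apply: ler_wpM2r; [exact: ltW|rewrite lerDl].
- move=> _ _; rewrite poweRyr ?invr_neq0 ?gt_eqF // gt0_muley ?leey //.
  by rewrite lte_fin mulr_gt0.
Qed.

End gradient_norm.

Section assembly_of_cases.
Context {R : realType} {d' : nat}.
Local Notation d := d'.+1.
Hypothesis m0 : 0 < @mu1 R d'.

(** [N] stands for either norm of the maximal function. For p = 1 the Sobolev and the BV statement
    both go through [C1_approximable], with one constant. *)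
Lemma sobolev_bounds (p : R) (N : ('rV[R]_d -> R) -> \bar R) : 1 <= p ->
  (p = 1 -> exists2 C, 0 <= C & forall f V, L1 f -> 0 <= V -> C1_approximable f V ->
    (N f <= (C * V)%:E)%E) ->
  (1 < p -> exists2 C, 0 <= C & forall f g I, locint f -> (forall i, locint (g i)) ->
    weak_grad f g -> 0 <= I -> (\int[@mu R d']_y (gsum g y `^ p)%:E <= I%:E)%E ->
    (N f <= (C * I `^ p^-1)%:E)%E) ->
  exists C : R,
    (forall f g, W1p_grad p f g -> (N f <= C%:E * Lpnorm p (gradnorm g))%E) /\
    (p = 1 -> forall f, BV f -> (N f <= C%:E * var f)%E).
Proof.
move=> p1 N1 Np.
have [p1E|pn1] := eqVneq p 1.
  have [C C0 hC] := N1 p1E; exists ((C + 1) * d%:R); split=> [f g [mf Lf mg Lg wg]|_ f bf].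
    apply: le_Lpnorm_gradnorm => // I I0; subst p.
    rewrite invr1 powRr1 //; under eq_integral do rewrite powRr1 ?gsum_ge0 //.
    move=> hI; have L1f := L1_Lp1 mf Lf.
    have L1g i : L1 (g i) by exact: (L1_Lp1 (mg i) (Lg i)).
    apply: hC => // eps eps0.
    have [u [G [Cu hu hG]]] := W11_approx m0 L1f L1g wg eps0.
    exists u, G; split => //; apply: (le_trans hG).
    rewrite fineK // ge0_fin_numE; first exact: le_lt_trans hI (ltry _).
    by apply: integral_ge0 => y _; rewrite lee_fin gsum_ge0.
  have [L1f hf] := BV_approx m0 bf; have [_ _ vf] := bf.
  have v0 : (0 <= var f)%E.
    apply: le_trans (@int_dmoll_le _ _ m0 f 1 ord0 L1f ltr01).
    by apply: integral_ge0 => y _; exact: abse_ge0.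
  have vE : var f = (fine (var f))%:E by rewrite fineK // ge0_fin_numE.
  have fv0 : 0 <= fine (var f) by exact: fine_ge0.
  apply: (le_trans (hC _ _ L1f _ hf)); first by rewrite mulr_ge0.
  rewrite [in leRHS]vE -EFinM lee_fin mulrA; apply: ler_wpM2r => //.
  by apply: ler_wpM2r => //; rewrite lerDl.
have {pn1} p1' : 1 < p by rewrite lt_neqAle eq_sym pn1.
have [C C0 hC] := Np p1'; exists ((C + 1) * d%:R); split=> [f g [mf Lf mg Lg wg]|pE].
  apply: le_Lpnorm_gradnorm => // I I0 hI; apply: (hC f g I) => //; first exact: locint_Lp Lf.
  by move=> i; apply: locint_Lp (Lg i).
by move: p1'; rewrite pE ltxx.
Qed.

End assembly_of_cases.

Section null.
Context {R : realType} {d' : nat}.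
Hypothesis m0 : @mu1 R d' = 0.

Lemma Lpnorm_null (q : R) (u : 'rV[R]_d'.+1 -> \bar R) : q != 0 -> Lpnorm q u = 0%E.
Proof.
move=> q0; rewrite /Lpnorm /integ; under eq_integral do rewrite (lstar_null _ m0).
by rewrite integral0 poweR0r // invr_neq0.
Qed.

Lemma Linfnorm_null (u : 'rV[R]_d'.+1 -> \bar R) : (Linfnorm u <= 0)%E.
Proof. by apply: ereal_inf_lbound; exists 0 => //=; rewrite (lstar_null _ m0). Qed.

End null.

Theorem theorem1p2 (R : realType) (d : nat) (alpha beta p : R) (centered : bool) :
  1 <= p -> 0 < alpha -> alpha < d%:R ->
  (0 <= alpha + beta + 1 -> alpha + beta + 1 < d%:R / p ->
    exists C : R,
      (forall (f : 'rV[R]_d -> R) (g : 'I_d -> 'rV[R]_d -> R), W1p_grad p f g ->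
         (Lpnorm (p^-1 - (1 + alpha + beta) / d%:R)^-1 (Mab centered alpha beta f)
            <= C%:E * Lpnorm p (gradnorm g))%E) /\
      (p = 1 -> forall f : 'rV[R]_d -> R, BV f ->
         (Lpnorm (p^-1 - (1 + alpha + beta) / d%:R)^-1 (Mab centered alpha beta f)
            <= C%:E * var f)%E)) /\
  (p = d%:R / (1 + alpha + beta) ->
    exists C : R,
      (forall (f : 'rV[R]_d -> R) (g : 'I_d -> 'rV[R]_d -> R), W1p_grad p f g ->
         (Linfnorm (Mab centered alpha beta f) <= C%:E * Lpnorm p (gradnorm g))%E) /\
      (p = 1 -> forall f : 'rV[R]_d -> R, BV f ->
         (Linfnorm (Mab centered alpha beta f) <= C%:E * var f)%E)).
Proof.
case: d => [|d']; first by move=> _ a0 /(lt_trans a0); rewrite ltxx.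
move=> p1 a0 ad; rewrite (addrC (alpha + beta) 1) addrA.
set gam := 1 + alpha + beta.
have p0 : 0 < p by exact: lt_le_trans p1.
have d0 : 0 < d'.+1%:R :> R by rewrite ltr0n.
have [m0|m0] := eqVneq (@mu1 R d') 0.
  split=> [_ gd|_]; exists 0; split=> [f g _|_ f _]; rewrite mul0e ?Linfnorm_null //;
    rewrite Lpnorm_null // invr_neq0 // gt_eqF // subr_gt0 ltr_pdivrMr // mulrC //.
have {}m0 : 0 < @mu1 R d' by rewrite lt_neqAle eq_sym m0 mu1_ge0.
have ad' := ltW ad.
split=> [g0 gd|pE].
  apply: (@sobolev_bounds _ _ m0 p (fun f => Lpnorm (p^-1 - gam / d'.+1%:R)^-1 (Mab centered alpha beta f))) => // [pE|p1'].
    by rewrite pE invr1; apply: mab_p1 => //; move: gd; rewrite pE divr1.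
  exact: mab_p.
have gE : gam = d'.+1%:R / p.
  rewrite pE invf_div mulrCA divff ?mulr1 // gt_eqF //.
have g0 : 0 <= gam by rewrite gE divr_ge0 // ltW.
apply: (@sobolev_bounds _ _ m0 p (fun f => Linfnorm (Mab centered alpha beta f))) => // [p1E|p1'].
  by apply: mab_p1_endpoint => //; rewrite -/gam gE p1E divr1.
exact: mab_p_endpoint.
Qed.
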